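(* Let $W$ be a finite Coxeter group with set of simple reflections $S$, $|S|\ge 3$, and let $L\subseteq S$ with $|L|=2$. Then for each $W_L$-conjugacy class $C$ of cuspidal elements of $W_L$, with fixed representative $w_C\in C$, there exist linear characters $\widetilde\varphi_{w_C}$ and $\widetilde\psi_{w_C}$ of $C_W(w_C)$ such that (i) $\widetilde\Phi_L=\sum_{C\in\mathcal C_L}\operatorname{Ind}_{C_W(w_C)}^{N_W(W_L)}\widetilde\varphi_{w_C}$; (ii) $\widetilde\Psi_L=\sum_{C\in\mathcal C_L}\operatorname{Ind}_{C_W(w_C)}^{N_W(W_L)}\widetilde\psi_{w_C}$; (iii) $\widetilde\psi_{w_C}=\widetilde\varphi_{w_C}\,\epsilon\,\alpha_L$ (restricted to $C_W(w_C)$) for all $C\in\mathcal C_L$.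
   Context: $W$ has length function $\ell$ and acts on the right as a reflection group on $V=\mathbb R^{|S|}$ (and $V_{\mathbb C}=\mathbb C^{|S|}$). Write $x^w=w^{-1}xw$ and $J^w=\{s^w:s\in J\}$. $\epsilon$ is the sign character $w\mapsto\det(w|_V)$. For $J\subseteq S$: $W_J=\langle J\rangle$; $X_J=\{w\in W:\ell(sw)>\ell(w)\ \forall s\in J\}$; $x_J=\sum_{x\in X_J}x^{-1}\in\mathbb CW$; $X_J^\sharp=\{x\in X_J:J^x\subseteq S\}$; $N_J=\{x\in X_J:J^x=J\}$, a subgroup with $N_W(W_J)=W_J\rtimes N_J$. For $K,L\subseteq S$ put $m_{KL}=|X_K\cap X_L^\sharp|$ if $L\subseteq K$ and $m_{KL}=0$ otherwise; this matrix is invertible and elements $e_L\in\mathbb CW$ are defined by $x_K=\sum_{L\subseteq S}m_{KL}e_L$ for all $K\subseteq S$. For $L\subseteq S$, let $e_L^L$ be the element $e_L$ constructed in the Coxeter group $(W_L,L)$; $\Phi_L$ is the character of $W_L$ acting by right multiplication on $e^L_L\mathbb CW_L$, and $\widetilde\Phi_L$ is the character of $N_W(W_L)$ acting by right multiplication on $e_L\mathbb CW_L$ (this space is $N_W(W_L)$-stable and its character extends $\Phi_L$). Orlik–Solomon algebra: $T=\{s^w\}$ is the set of reflections, $H_t\subseteq V_{\mathbb C}$ the hyperplane fixed by $t$. $A(W)$ is the $\mathbb C$-algebra generated by $a_t$ ($t\in T$) subject to $a_ta_{t'}=-a_{t'}a_t$ and $\sum_{i=1}^p(-1)^ia_{t_1}\cdots\widehat{a_{t_i}}\cdots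 a_{t_p}=0$ whenever $\{H_{t_1},\dots,H_{t_p}\}$ is linearly dependent; $W$ acts by $a_t.w=a_{t^w}$. For $X=\operatorname{Fix}(W_L)\subseteq V_{\mathbb C}$ of codimension $p$, $A_X$ is the span of all $a_{t_1}\cdots a_{t_p}$ with $H_{t_1}\cap\dots\cap H_{t_p}=X$; it is $N_W(W_L)$-stable, and $\widetilde\Psi_L$ denotes the character of $N_W(W_L)$ on $A_X$ (it extends the character $\Psi_L$ of $W_L$ on the top component of the Orlik–Solomon algebra of $W_L$). $\alpha_L$ is the linear character of $N_W(W_L)$ given by $\alpha_L(w)=\det(w|_{\operatorname{Fix}(W_L)})$. An element $w\in W_L$ is cuspidal in $W_L$ if it has no nonzero fixed vector in the orthogonal complement of $\operatorname{Fix}(W_L)$ in $V$; $\mathcal C_L$ is the set of $W_L$-conjugacy classes of cuspidal elements of $W_L$. For cuspidal $w$, $C_W(w)\le N_W(W_L)$. *)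

(* Defs.v *)
From HB Require Import structures.
From mathcomp Require Import all_boot all_order all_algebra all_fingroup.
From mathcomp Require Import all_solvable all_field all_character.
Set Implicit Arguments. Unset Strict Implicit. Unset Printing Implicit Defensive.
Import Order.TTheory GRing.Theory Num.Theory.
Local Open Scope ring_scope.

Section Coxeter.
Variable gT : finGroupType.

Definition coxeter_system (S : {set gT}) : Prop :=
  (forall s, s \in S -> #[s]%g = 2%N) /\
  forall (hT : finGroupType) (f : gT -> hT),
    (forall s t, s \in S -> t \in S -> ((f s * f t) ^+ #[(s * t)%g])%g = 1%g) ->
    exists g : gT -> hT,
      {in <<S>>%g &, {morph g : x y / (x * y)%g}} /\ {in S, g =1 f}.

Fixpoint words (S : {set gT}) (k : nat) : {set gT} :=
  if k is k'.+1 then (S * words S k')%g else [set 1%g].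

Definition len (S : {set gT}) (w : gT) : nat :=
  find (fun k => w \in words S k) (iota 0 #|gT|.+1).

Definition Xset (S J : {set gT}) : {set gT} :=
  [set w in <<S>>%g | [forall s in J, len S w < len S (s * w)%g]]%N.

Definition Xsharp (S J : {set gT}) : {set gT} :=
  [set x in Xset S J | (J :^ x \subset S)%g].

(* ---------- group algebra CW as row vectors indexed by gT ---------- *)
Definition gN := #|gT|.
Definition gvec (g : gT) : 'rV[algC]_gN := delta_mx 0 (enum_rank g).

Definition rmul (h : gT) : 'M[algC]_gN :=
  \sum_(g : gT) (gvec g)^T *m gvec (g * h)%g.

Definition xJ (S J : {set gT}) : 'rV[algC]_gN :=
  \sum_(x in Xset S J) gvec (x^-1)%g.

Definition mKL (S K L : {set gT}) : algC :=
  if L \subset K then (#|Xset S K :&: Xsharp S L|)%:R else 0.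

Definition Pset (S : {set gT}) := powerset S.

Lemma set0_Pset (S : {set gT}) : set0 \in Pset S.
Proof. by rewrite powersetE sub0set. Qed.

Definition Mmat (S : {set gT}) : 'M[algC]_#|Pset S| :=
  \matrix_(i, j) mKL S (enum_val i) (enum_val j).

(* e_L, defined by x_K = sum_L m_{KL} e_L for all K, i.e. e = M^{-1} x *)
Definition eL (S L : {set gT}) : 'rV[algC]_gN :=
  \sum_(K in Pset S)
    (if (L \in Pset S) && (K \in Pset S) then
       invmx (Mmat S) (enum_rank_in (set0_Pset S) L)
                      (enum_rank_in (set0_Pset S) K)
     else 0) *: xJ S K.

Definition restr (m : nat) (X F : 'M[algC]_m) : 'M[algC]_(\rank X) :=
  row_base X *m F *m pinvmx (row_base X).

(* character of N_W(W_L) on e_L CW_L (right multiplication) *)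
Definition eLCWL (S L : {set gT}) : 'M[algC]_gN :=
  (\sum_(h in <<L>>%g) <<eL S L *m rmul h>>)%MS.

Definition PhiT (S L : {set gT}) (g : gT) : algC :=
  \tr (restr (eLCWL S L) (rmul g)).

Variable n : nat.
Variable sv : 'I_n -> gT.
Variable rho : gT -> 'M[algC]_n.

(* B(alpha_i, alpha_j) = - cos (pi / m_ij), with cos(pi/m) = Re (m.-root (-1)) *)
Definition Gram : 'M[algC]_n :=
  \matrix_(i, j) (- 'Re ((#[sv i * sv j])%g.-root (-1))).

(* reflection s_i on row vectors: alpha_j |-> alpha_j - 2 B(alpha_i,alpha_j) alpha_i *)
Definition refl (i : 'I_n) : 'M[algC]_n :=
  1%:M - \matrix_(j, k) (2 * Gram i j * (k == i)%:R).

Definition geom_rep : Prop :=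
  {in <<[set sv i | i : 'I_n]>>%g &, forall x y, rho (x * y)%g = rho x *m rho y}
  /\ forall i, rho (sv i) = refl i.

Definition Fix (A : {set gT}) : 'M[algC]_n :=
  (\bigcap_(a in A) kermx (rho a - 1%:M))%MS.

Definition perpB (X : 'M[algC]_n) : 'M[algC]_n := kermx (Gram *m X^T).

Definition epsilon (w : gT) : algC := \det (rho w).

Definition alphaL (L : {set gT}) (w : gT) : algC :=
  \det (restr (Fix <<L>>%g) (rho w)).

Definition cuspidal (L : {set gT}) (w : gT) : bool :=
  (w \in <<L>>%g) && (\rank (kermx (rho w - 1%:M) :&: perpB (Fix <<L>>%g))%MS == 0%N).

Definition cusp_classes (L : {set gT}) : {set {set gT}} :=
  [set C in classes <<L>>%g | [forall w in C, cuspidal L w]].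

Definition Tset (S : {set gT}) : {set gT} := [set (s ^ w)%g | s in S, w in <<S>>%g].

Definition capH (R : {set gT}) : 'M[algC]_n :=
  (\bigcap_(t in R) kermx (rho t - 1%:M))%MS.

(* {H_t : t in R} linearly dependent: rank (= codim of intersection) < |R| *)
Definition dependent (R : {set gT}) : bool := (n - \rank (capH R) < #|R|)%N.

(* exterior algebra on generators e_t (t in gT), with basis e_R, R a set,
   e_R = e_{t1} ^ ... ^ e_{tp} for t1 < ... < tp in the enumeration order *)
Definition eN := #|{set gT}|.
Definition ebas (R : {set gT}) : 'rV[algC]_eN := delta_mx 0 (enum_rank R).

Definition inversions (s : seq gT) : nat :=
  (\sum_(i < size s) \sum_(j < size s | (i < j)%N)
     (enum_rank (nth 1%g s j) < enum_rank (nth 1%g s i))%N)%N.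

Definition wedge (s : seq gT) : 'rV[algC]_eN :=
  if uniq s then (-1) ^+ inversions s *: ebas [set x in s] else 0.

Definition osact (w : gT) : 'M[algC]_eN :=
  \sum_(R : {set gT}) (ebas R)^T *m wedge [seq (t ^ w)%g | t <- enum R].

Definition dropi (i : nat) (s : seq gT) := take i s ++ drop i.+1 s.

(* e_U ^ d(e_R) *)
Definition rel (U R : {set gT}) : 'rV[algC]_eN :=
  \sum_(i < #|R|) (-1) ^+ i *: wedge (enum U ++ dropi i (enum R)).

Definition OSideal (S : {set gT}) (p : nat) : 'M[algC]_eN :=
  (\sum_(U in powerset (Tset S))
     \sum_(R in powerset (Tset S) | dependent R && (#|U| + #|R| == p.+1)%N)
        <<rel U R>>)%MS.

Definition EX (S : {set gT}) (p : nat) (X : 'M[algC]_n) : 'M[algC]_eN :=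
  (\sum_(R in powerset (Tset S) | (#|R| == p) && (capH R == X)%MS)
      <<wedge (enum R)>>)%MS.

(* character of N_W(W_L) on A_X = (EX + I^p)/I^p, X = Fix(W_L), p = codim X *)
Definition PsiT (S L : {set gT}) (w : gT) : algC :=
  let X := Fix <<L>>%g in
  let p := (n - \rank X)%N in
  \tr (restr (EX S p X + OSideal S p)%MS (osact w))
  - \tr (restr (OSideal S p) (osact w)).

End Coxeter.

(* Main.v *)
Require Import Defs.
From HB Require Import structures.
From mathcomp Require Import all_boot all_order all_algebra all_fingroup.
From mathcomp Require Import all_solvable all_field all_character.
From mathcomp Require Import ring lra zify.
Import Order.TTheory GRing.Theory Num.Theory.
Set Implicit Arguments. Unset Strict Implicit. Unset Printing Implicit Defensive.
Local Open Scope group_scope.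
Local Open Scope ring_scope.

(* A root [alpha i * w] is a nonnegative or a nonpositive combination of the
   simple roots according to the length of [s_i w] (Tits).  Hence the pointwise
   stabilizer of [Fix W_L] is [W_L], and [N_W(W_L)] is the product of [W_L] with
   the dominant elements, which permute the two simple roots of [L].

   Let [L = {s, t}], [r = s t], and let [w_L] be the longest element of [W_L].
   Up to a nonzero scalar [e_L] is [x_L ((1 + w_L) / 2 - (sum of W_L) / |W_L|)],
   so [Phi~_L + 1] is the permutation character of [N_W(W_L)] on the cosets of
   [<w_L>] in [W_L]; and [A_X] is the sum-zero part of the permutation module on
   the reflections of [W_L], by [a_u a_v |-> v - u].

   The cuspidal elements of [W_L] are the nontrivial powers of [r].  Fix a perfect
   pairing of the cyclic group [<r>] with itself, invariant under [N_W(W_L)], and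
   put [psi_x g = <x, s s^g>] on the centralizer of [x].  Both permutation
   characters are then computed by Fourier inversion on [<r>], because
   [epsilon * alpha_L] is the determinant on the plane spanned by the roots of [L],
   that is, the sign by which [g] acts on [<r>]. *)

(** * The root of unity [m.-root (-1)] *)

(** The two characters agree up to a sign because a count of fourth roots collapses to a count of
    square roots. Put [c = s * s ^ g]. If [g] centralizes [<r>], both traces are [|<r>| - 1] or
    [-1], according to whether [c = 1]. If [g] inverts [<r>], [Psi~_L + 1] counts the solutions of
    [z^2 = c], and [Phi~_L + 1] is half the number of solutions of [z^4 = c r] and of
    [z^4 = c r^-1]. Fourier inversion turns the latter into a sum over [x^4 = 1] of [<x, c>]
    weighted by the real part of [<x, r>], which is 1 at [x = 1], -1 at order two and 0 at order
    four: only the 2-torsion survives, with the sign of [epsilon * alpha_L].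

    The map [g |-> s s^g] is a cocycle with values in [<r>], which is why [psi_x] is a character on
    the centralizer of [x].

    The analytic obstacle is that [cos (pi / m)] is the real part of [m.-root (-1)], known only as
    the root of -1 in the upper half plane with the largest real part. The positivity of roots needs
    [sin (k pi / m) >= 0] for [k <= m], which has to be extracted from this extremal property. *)

Lemma unit_circle_sub (R : realFieldType) (a b x y : R) :
    a ^+ 2 + b ^+ 2 = 1 -> x ^+ 2 + y ^+ 2 = 1 -> 0 < b -> 0 <= y -> x <= a ->
  0 <= y * a - x * b /\ x < x * a + y * b.
Proof.
move=> ab xy b0 y0 xa.
have a1 : a < 1 by rewrite ltNge; apply/negP => ?; nra.
have yb : (0 <= x -> b <= y) /\ (x <= 0 -> 0 <= a -> x * b <= 0).
  split=> [x0|x0 a0]; last by nra.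
  rewrite leNgt; apply/negP => yb; nra.
split.
  case: (lerP 0 a) => a0.
    case: (lerP 0 x) => x0; last by nra.
    by have := yb.1 x0; nra.
  have x0 : x < 0 by lra.
  have : y <= b by rewrite leNgt; apply/negP => ?; nra.
  nra.
case: (lerP x 0) => x0.
  have [x0'|x0'] := eqVneq x 0; last by have : x < 0; [lra|nra].
  by subst x; have : y = 1; [have /eqP := xy; rewrite expr0n add0r sqrf_eq1 => /orP[]/eqP //;
      lra|nra].
have := yb.1 (ltW x0); nra.
Qed.

(** With [(a, b)] and [(x, y)] at angles [p] and [q] in the open upper half plane and [p + q] beyond
    [pi], the opposite of their product has angle [p + q - pi], which is less than [p]. *)
Lemma unit_circle_wrap (R : realFieldType) (a b x y : R) :
    a ^+ 2 + b ^+ 2 = 1 -> x ^+ 2 + y ^+ 2 = 1 -> 0 < b -> 0 < y ->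
    x * b + y * a < 0 -> a < - (x * a - y * b).
Proof.
move=> ab xy b0 y0 h.
have x1 : 0 < 1 + x.
  by rewrite ltNge; apply/negP => ?; nra.
(* The claim reads [a * (1 + x) < y * b]; the extra factor [y] brings in
   [y ^+ 2 = (1 - x) * (1 + x)], so that the positive [1 + x] divides out. *)
suff : y * (a * (1 + x)) < y * (y * b) by rewrite ltr_pM2l //; lra.
have -> : y * (y * b) = (1 - x) * (1 + x) * b.
  have y2 : y ^+ 2 = 1 - x ^+ 2 by lra.
  by rewrite mulrA -expr2 y2; ring.
have : 0 < (1 + x) * - (x * b + y * a) by rewrite mulr_gt0 // oppr_gt0.
have : 0 < (1 + x) * b by rewrite mulr_gt0.
lra.
Qed.

Section RootOfMinusOne.
Variable m : nat.
Hypothesis m_gt1 : (1 < m)%N.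
Let z : algC := m.-root (-1).
Let m_gt0 : (0 < m)%N. Proof. exact: ltnW. Qed.

Let zm : z ^+ m = -1. Proof. exact: rootCK. Qed.

Let unity_circle (w : algC) : w ^+ m.*2 = 1 -> 'Re w ^+ 2 + 'Im w ^+ 2 = 1.
Proof.
move=> w1; rewrite -normC2_Re_Im.
suff -> : `|w| = 1 by rewrite expr1n.
apply/eqP; rewrite -(@pexpr_eq1 _ _ m.*2) ?double_gt0 //.
by rewrite -normrX w1 normr1.
Qed.

Let z_unity : z ^+ m.*2 = 1.
Proof. by rewrite -mul2n mulnC exprM zm sqrrN expr1n. Qed.

Let unity_pm (w : algC) : w ^+ m.*2 = 1 -> w ^+ m = 1 \/ w ^+ m = -1.
Proof.
by rewrite -mul2n mulnC exprM => /eqP; rewrite sqrf_eq1 => /orP[]/eqP; [left|right].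
Qed.

(** In terms of arguments: that of [w] is at least that of [u], and division by [u] leaves their
    difference, still in the closed upper half plane and strictly smaller. *)
Let circle_sub (u w : algC) :
    u ^+ m.*2 = 1 -> w ^+ m.*2 = 1 -> 0 < 'Im u -> 0 <= 'Im w -> 'Re w <= 'Re u ->
  0 <= 'Im (w * u^*) /\ 'Re w < 'Re (w * u^*).
Proof.
move=> u1 w1 Iu Iw le.
have := @unit_circle_sub algR (in_algR (Creal_Re u)) (in_algR (Creal_Im u))
  (in_algR (Creal_Re w)) (in_algR (Creal_Im w)).
case=> //.
- by apply: val_inj; apply: unity_circle.
- by apply: val_inj; apply: unity_circle.
move=> h1 h2; rewrite ReM ImM Re_conj Im_conj !mulrN opprK addrC mulrC; split=> //.
Qed.

Lemma exists_primitive_upper :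
  exists2 w : algC, (m.*2).-primitive_root w & 0 < 'Im w.
Proof.
have [w pw] := C_prim_root_exists (n := m.*2) ltac:(by rewrite double_gt0).
have Rw : 'Im w != 0.
  apply/negP => /eqP Iw0.
  have := unity_circle (prim_expr_order pw); rewrite Iw0 expr0n addr0.
  have wRe : w = 'Re w by rewrite [LHS]Crect Iw0 mulr0 addr0.
  rewrite -wRe => w2; have := prim_order_dvd pw 2.
  rewrite w2 eqxx => /dvdn_leq; rewrite -mul2n; lia.
have := Creal_Im w; rewrite realE => /orP[] h.
  by exists w => //; rewrite lt0r Rw.
exists w^* ; first by rewrite fmorph_primitive_root.
by rewrite Im_conj oppr_gt0 lt_neqAle Rw.
Qed.

(** A real [z] would be -1, the leftmost point of the circle, and any other root of -1 in the upper
    half plane would have a larger real part. *)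
Lemma rootN1_Im_gt0 : 0 < 'Im z.
Proof.
rewrite lt0r Im_rootC_ge0 // andbT; apply/negP => /eqP Iz0.
have zRe : z = 'Re z by rewrite [LHS]Crect Iz0 mulr0 addr0.
have := unity_circle z_unity; rewrite Iz0 expr0n addr0 -zRe => /eqP.
rewrite sqrf_eq1 => /orP[]/eqP z1.
  by move: zm; rewrite z1 expr1n => /esym/eqP; rewrite -subr_eq0 -opprD oppr_eq0 -mulr2n pnatr_eq0.
have [w pw Iw] := exists_primitive_upper.
have wm : w ^+ m = -1.
  case: (unity_pm (prim_expr_order pw)) => // /eqP.
  rewrite -(prim_order_dvd pw) => /dvdn_leq; rewrite -mul2n; lia.
have := rootC_Re_max m_gt0 wm (ltW Iw); rewrite -/z -zRe z1 => h.
have : 'Re w ^+ 2 < 1.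
  by rewrite -(unity_circle (prim_expr_order pw)) ltrDl exprn_gt0.
rewrite -sqrrN expr_lt1 //; last by rewrite -oppr_le0 opprK (le_trans h) ?lerN10.
move=> h2; have h3 : 1 <= - 'Re w by rewrite lerNr.
by have := le_lt_trans h3 h2; rewrite ltxx.
Qed.

(** The root [z] is extremal only among the [m]-th roots of -1. A root of 1 to the right of [z]
    would rotate [z] to an [m]-th root of -1 further right than [z] itself. *)
Let z_Re_max (w : algC) : w ^+ m.*2 = 1 -> 0 < 'Im w -> 'Re w <= 'Re z.
Proof.
move=> w1 Iw; case: (unity_pm w1) => wm; last exact: rootC_Re_max (ltW Iw).
rewrite real_leNgt ?Creal_Re //; apply/negP => lt.
have [h1 h2] := circle_sub w1 z_unity Iw (ltW rootN1_Im_gt0) (ltW lt).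
have : (z * w^* ) ^+ m = -1 by rewrite exprMn zm -rmorphXn wm /= rmorph1 mulr1.
move=> /(rootC_Re_max m_gt0) /(_ h1); rewrite -/z => h3.
by have := lt_le_trans h2 h3; rewrite ltxx.
Qed.

(** Among the products of a primitive root [w] by powers of [z] in the closed upper half plane, take
    the rightmost. It lies to the right of [z], since otherwise division by [z] would improve it;
    hence it is real, so 1 or -1. Then [z ^+ j = -1] would make the order of [w] divide [2 j]. *)
Let z_expN1 j : (0 < j < m)%N -> z ^+ j != -1.
Proof.
case/andP=> j0 jm; apply/negP => /eqP zj.
have [w pw Iw] := exists_primitive_upper.
have ex : (fun i : 'I_m.*2 => 0 <= 'Im (w * z ^+ i)) (Ordinal (ltac:(by rewrite double_gt0) : (0
    < m.*2)%N)).
  by rewrite expr0 mulr1 ltW.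
have wz i : (w * z ^+ i) ^+ m.*2 = 1.
  by rewrite exprMn (prim_expr_order pw) exprAC z_unity expr1n mulr1.
pose i0 : 'I_m.*2 := Ordinal (ltac:(by rewrite double_gt0) : (0 < m.*2)%N).
have [i Pi imax] : exists2 i : 'I_m.*2, 0 <= 'Im (w * z ^+ i) &
   forall k : 'I_m.*2, 0 <= 'Im (w * z ^+ k) -> 'Re (w * z ^+ k) <= 'Re (w * z ^+ i).
  have := @arg_maxP _ algR _ i0 (fun i : 'I_m.*2 => 0 <= 'Im (w * z ^+ i))
    (fun i => in_algR (Creal_Re (w * z ^+ i))) ex.
  by case=> i Pi h; exists i => // k /h.
have zV : z^* = z ^+ (m.*2).-1.
  have zz : z * z^* = 1.
    by rewrite -normCK normC2_Re_Im unity_circle.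
  apply: (mulfI (x := z)); first by apply/negP => /eqP z0; move: zz; rewrite z0 mul0r =>
      /esym/eqP; rewrite oner_eq0.
  by rewrite zz -exprS prednK ?double_gt0 // z_unity.
have lt : 'Re z < 'Re (w * z ^+ i).
  rewrite real_ltNge ?Creal_Re //; apply/negP => le.
  have [h1 h2] := circle_sub z_unity (wz i) rootN1_Im_gt0 Pi le.
  have e : w * z ^+ i * z^* = w * z ^+ ((i + (m.*2).-1) %% m.*2).
    by rewrite expr_mod ?z_unity // exprD zV mulrA.
  rewrite e in h1 h2.
  have i1 : ((i + (m.*2).-1) %% m.*2 < m.*2)%N by rewrite ltn_pmod ?double_gt0.
  have := imax (Ordinal i1) h1.
  by move=> /(lt_le_trans h2); rewrite ltxx.
have Im0 : 'Im (w * z ^+ i) = 0.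
  apply/eqP/contraT => h; have := z_Re_max (wz i).
  rewrite lt0r h Pi => /(_ isT) /(lt_le_trans lt); by rewrite ltxx.
have wpm : w * z ^+ i = 1 \/ w * z ^+ i = -1.
  have e : w * z ^+ i = 'Re (w * z ^+ i) by rewrite [LHS]Crect Im0 mulr0 addr0.
  have := unity_circle (wz i); rewrite Im0 expr0n addr0 -e => /eqP.
  by rewrite sqrf_eq1 => /orP[]/eqP; [left|right].
have : w ^+ j.*2 = 1.
  have : (w * z ^+ i) ^+ j.*2 = 1.
    by case: wpm => ->; rewrite ?expr1n // -mul2n exprM sqrrN !expr1n.
  by rewrite exprMn -mul2n mulnC [z ^+ _ ^+ _]exprAC !exprM zj sqrrN !expr1n mulr1.
move/eqP; rewrite -(prim_order_dvd pw) => /dvdn_leq; rewrite -!mul2n; lia.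
Qed.

(* If [z ^+ k] leaves the upper half plane at [k.+1], then [- z ^+ k.+1] has a
   smaller argument than [z], against the maximality of ['Re z]. *)
Lemma rootN1_exp_Im_ge0 k : (k <= m)%N -> 0 <= 'Im (z ^+ k).
Proof.
elim: k => [|k IHk] km; first by rewrite expr0 (Creal_ImP _ _) ?rpred1.
have {IHk} Ik := IHk (ltnW km).
rewrite real_leNgt ?Creal_Im //; apply/negP => lt.
have xi1 : (z ^+ k) ^+ m.*2 = 1 by rewrite exprAC z_unity expr1n.
have [I0|I0] := eqVneq ('Im (z ^+ k)) 0.
  have e : z ^+ k = 'Re (z ^+ k) by rewrite [LHS]Crect I0 mulr0 addr0.
  have := unity_circle xi1; rewrite I0 expr0n addr0 -e => /eqP.
  rewrite sqrf_eq1 => /orP[]/eqP zk.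
    move: lt; rewrite exprS zk mulr1 => lt.
    by have := lt_trans lt rootN1_Im_gt0; rewrite ltxx.
  have k0 : (0 < k)%N.
    rewrite lt0n; apply/negP => /eqP k0; move: zk; rewrite k0 expr0.
    by move=> /esym/eqP; rewrite -subr_eq0 -opprD oppr_eq0 -mulr2n pnatr_eq0.
  by have := z_expN1 (j := k); rewrite zk eqxx k0 km => /(_ isT).
have Ik' : 0 < 'Im (z ^+ k) by rewrite lt0r I0.
have lt2 : 'Re z < 'Re (- z ^+ k.+1).
  have := @unit_circle_wrap algR (in_algR (Creal_Re z)) (in_algR (Creal_Im z))
    (in_algR (Creal_Re (z ^+ k))) (in_algR (Creal_Im (z ^+ k))).
  move=> h; have -> : 'Re (- z ^+ k.+1) = - ('Re (z ^+ k) * 'Re z - 'Im (z ^+ k) * 'Im z).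
    by rewrite raddfN /= exprSr ReM.
  apply: h => //.
  - by apply: val_inj; apply: unity_circle.
  - by apply: val_inj; apply: unity_circle.
  - exact: rootN1_Im_gt0.
  - by move: lt; rewrite exprSr ImM [X in _ + X]mulrC.
have := z_Re_max (w := - z ^+ k.+1).
rewrite exprNn -mul2n exprM sqrrN !expr1n mul1r mul2n exprAC z_unity expr1n.
rewrite raddfN /= oppr_gt0 => /(_ erefl lt) /(lt_le_trans lt2).
by rewrite ltxx.
Qed.

End RootOfMinusOne.

(** The Chebyshev numbers [sin (k pi / m) / sin (pi / m)], for [c = cos (pi / m)]. *)
Fixpoint chebU (c : algC) (k : nat) : algC :=
  if k is k1.+1 then (if k1 is k2.+1 then 2 * c * chebU c k1 - chebU c k2 else 1)
  else 0.

Lemma chebUSS c k : chebU c k.+2 = 2 * c * chebU c k.+1 - chebU c k.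
Proof. by []. Qed.

Lemma chebU_ge0 m k : (1 < m)%N -> (k <= m)%N -> 0 <= chebU ('Re (m.-root (-1))) k.
Proof.
move=> m1; set z : algC := m.-root (-1).
have Iz := rootN1_Im_gt0 m1.
have circ : 'Re z ^+ 2 + 'Im z ^+ 2 = 1.
  rewrite -normC2_Re_Im; suff -> : `|z| = 1 by rewrite expr1n.
  apply/eqP; rewrite -(@pexpr_eq1 _ _ m) ?(ltnW m1) //.
  by rewrite -normrX rootCK ?(ltnW m1) // normrN1.
have UE j : chebU ('Re z) j * 'Im z = 'Im (z ^+ j) /\ chebU ('Re z) j.+1 * 'Im z = 'Im (z ^+ j.+1).
  elim: j => [|j [IH1 IH2]]; first by rewrite mul0r mul1r expr0 expr1 (Creal_ImP _ _) ?rpred1.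
  split=> //; rewrite chebUSS mulrBl -[2 * _ * _ * _]mulrA IH2 IH1 !exprS !ImM !ReM.
  set a := 'Re z; set b := 'Im z; set x := 'Re _; set y := 'Im _.
  have h : y = y * (a ^+ 2 + b ^+ 2) by rewrite circ mulr1.
  by rewrite [X in _ - X = _]h; ring.
move=> km; rewrite -(pmulr_lge0 _ Iz) (UE k).1; exact: rootN1_exp_Im_ge0.
Qed.

(** Sylvester's identity: both sides of [e] are products of block triangular matrices. It gives the
    determinant of a reflection, and later moves determinants between the whole space and a
    subspace. *)
Lemma det_1addMC (R : comNzRingType) (m n : nat) (A : 'M[R]_(m, n)) (B : 'M[R]_(n, m)) :
  \det (1%:M + A *m B) = \det (1%:M + B *m A).
Proof.
have e : block_mx (1%:M + A *m B) (- A) 0 1%:M *m block_mx 1%:M 0 B 1%:M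
       = block_mx 1%:M 0 B 1%:M *m block_mx 1%:M (- A) 0 (1%:M + B *m A).
  rewrite !mulmx_block !mulmx1 !mul1mx !mulmx0 !mul0mx !addr0 !add0r.
  by rewrite mulNmx addrK mulmxN (addrC (- _)) addrK.
have := congr1 determinant e.
by rewrite !det_mulmx !det_ublock !det_lblock !det1 !mul1r !mulr1.
Qed.

(** * Lengths and positivity of roots *)

Section Words.
Variables (gT : finGroupType) (S : {set gT}).
Hypothesis S_invol : forall s, s \in S -> (s * s = 1)%g.
Implicit Types (u v w s x y : gT) (k : nat).

Lemma words_sub k : words S k \subset <<S>>.
Proof.
elim: k => [|k IHk] /=; first by rewrite sub1set group1.
by rewrite mul_subG ?subset_gen.
Qed.

Lemma words_mul j k u v : u \in words S j -> v \in words S k -> (u * v)%g \in words S (j + k).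
Proof.
elim: j u => [|j IHj] u /=; first by move/set1P->; rewrite mul1g.
case/mulsgP=> s u' sS u'j -> vk; rewrite -mulgA.
by apply/mulsgP; exists s (u' * v)%g => //; apply: IHj.
Qed.

Lemma words1 s : s \in S -> s \in words S 1.
Proof. by move=> sS; rewrite /= mulg1. Qed.

Let words_ex w : w \in <<S>> -> exists k, w \in words S k.
Proof.
case/gen_prodgP=> k [c cS ->]; exists k.
elim: k c cS => [|k IHk] c cS; first by rewrite big_ord0 set11.
rewrite big_ord_recl /=; apply/mulsgP; exists (c ord0) (\prod_(i < k) c (lift ord0 i))%g => //.
by apply: IHk => i; apply: cS.
Qed.

(** [len] searches word lengths only up to [#|gT|]. The tails of a shortest word have pairwise
    distinct lengths, hence are distinct elements, so the search never misses. *)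
Let words_bound w : w \in <<S>> -> exists2 k, (k <= #|gT|)%N & w \in words S k.
Proof.

have dP w' : w' \in <<S>> -> {k | w' \in words S k & forall j, w' \in words S j -> (k <= j)%N}.
  by move=> /words_ex ex; case: (ex_minnP ex) => k wk kmin; exists k.
move=> wW; have [k wk kmin] := dP w wW.
exists k => //.
have step j : (j <= k)%N -> exists v, (v \in words S j) && [forall i : 'I_j, v \notin words S i].
  move=> jk; have -> : j = (k - (k - j))%N by rewrite subKn.
  elim: (k - j)%N (leq_subr j k) => [_|i IHi ik].
    exists w; rewrite subn0 wk; apply/forallP => i; apply/negP => /kmin.
    by rewrite leqNgt ltn_ord.
  have [v /andP[vk vmin]] := IHi (ltnW ik).
  have e : (k - i = (k - i.+1).+1)%N by lia.
  move: vk vmin; rewrite e /= => /mulsgP[s v' sS v'k ->] /forallP vmin.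
  exists v'; rewrite v'k; apply/forallP => a; apply/negP => v'a.
  have := vmin (lift ord0 a); rewrite lift0 /= => /negP; apply.
  by apply/mulsgP; exists s v'.
have /fin_all_exists[f fP] : forall j : 'I_k.+1, exists v, (v \in words S j) && [forall i : 'I_j,
    v \notin words S i].
  by move=> j; apply: step; rewrite -ltnS.
have f_inj : injective f.
  suff lt (a b : 'I_k.+1) : (a < b)%N -> f a != f b.
    move=> a b e; apply: val_inj => /=; case: (ltngtP a b) => // /lt.
    - by rewrite e eqxx.
    - by rewrite e eqxx.
  move=> ab; apply/negP => /eqP e.
  have /andP[_ /forallP/(_ (Ordinal ab))] := fP b.
  by have /andP[h _] := fP a; rewrite -e /= h.
by have := leq_card _ f_inj; rewrite card_ord => /ltnW.
Qed.

Lemma len_words w : w \in <<S>> -> w \in words S (len S w).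
Proof.
move=> /words_bound[k k1 wk].
have hs : has (fun j => w \in words S j) (iota 0 #|gT|.+1).
  by apply/hasP; exists k; rewrite // mem_iota.
by have := nth_find 0 hs; rewrite nth_iota // -[X in (_ < X)%N](size_iota 0) -has_find.
Qed.

Lemma len_le w k : w \in words S k -> (len S w <= k)%N.
Proof.
move=> wk; rewrite leqNgt; apply/negP => lt.
have := before_find 0 lt; rewrite nth_iota ?add0n ?wk //.
by rewrite -[X in (_ < X)%N](size_iota 0); apply: leq_trans lt (find_size _ _).
Qed.

Lemma len1 : len S 1%g = 0%N.
Proof. by apply/eqP; rewrite -leqn0 len_le //= set11. Qed.

Lemma len_mull k u v : u \in words S k -> v \in <<S>> -> (len S (u * v)%g <= k + len S v)%N.
Proof. by move=> uk vW; apply/len_le/words_mul/len_words. Qed.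

Lemma len_genl s v : s \in S -> v \in <<S>> -> (len S (s * v)%g <= (len S v).+1)%N.
Proof. by move=> sS; rewrite -add1n; apply: len_mull; apply: words1. Qed.

Lemma len_descent w : w \in <<S>> -> w != 1%g ->
  exists2 s, s \in S & (len S (s * w)%g < len S w)%N.
Proof.
move=> wW w1; have := len_words wW.
case e: (len S w) => [|k] /=; first by move/set1P=> we; rewrite we eqxx in w1.
case/mulsgP=> s v sS vk we; exists s => //.
by rewrite we mulgA S_invol // mul1g ltnS len_le.
Qed.

Fixpoint alt x y k : gT := if k is k'.+1 then (x * alt y x k')%g else 1%g.

Lemma altSr x y k : alt x y k.+1 = (alt x y k * (if odd k then y else x))%g.
Proof.
elim: k x y => [|k IHk] x y; first by rewrite /= mulg1 mul1g.
by rewrite [LHS]/= -/(alt y x k.+1) IHk mulgA /=; case: odd.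
Qed.

Lemma alt_words x y k : x \in S -> y \in S -> alt x y k \in words S k.
Proof.
elim: k x y => [|k IHk] x y xS yS /=; first exact: set11.
by apply/mulsgP; exists x (alt y x k) => //; apply: IHk.
Qed.

Lemma alt_add x y j k :
  alt x y (j + k) = (alt x y j * (if odd j then alt y x k else alt x y k))%g.
Proof.
elim: j x y => [|j IHj] x y; first by rewrite /= mul1g.
by rewrite addSn /= IHj mulgA; case: odd.
Qed.

(** At [k] equal to the order of [x * y] this is the braid relation. *)
Lemma alt_swap x y k : x \in S -> y \in S -> (alt x y k = (x * y) ^+ k * alt y x k)%g.
Proof.
elim: k x y => [|k IHk] x y xS yS; first by rewrite expg0 mul1g.
have conj j : (x * (y * x) ^+ j = (x * y) ^+ j * x)%g.
  by elim: j => [|j IHj]; rewrite ?expg0 ?mul1g ?mulg1 // !expgS -!mulgA IHj !mulgA.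
rewrite [LHS]/= IHk // mulgA conj expgSr /= -!mulgA; congr (_ * (_ * _))%g.
by rewrite mulgA S_invol // mul1g.
Qed.

(** Strip the longest alternating prefix starting with [x] for which lengths add up. The next letter
    does not shorten [v], by maximality; the last stripped letter does not either, because restoring
    the other [k] letters would make [w] too short. *)
Lemma strip_alt x y w : x \in S -> y \in S -> w \in <<S>> ->
    (len S (x * w)%g < len S w)%N ->
    (forall s v, s \in S -> v \in <<S>> -> len S (s * v)%g != len S v) ->
  exists k v, [/\ v \in <<S>>, w = (alt x y k.+1 * v)%g, (len S w = k.+1 + len S v)%N,
    (len S v < len S (x * v)%g)%N & (len S v < len S (y * v)%g)%N].
Proof.
move=> xS yS wW desc parity.
pose P k := (k + len S ((alt x y k)^-1 * w)%g == len S w)%N.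
have xV : (x^-1 = x)%g by apply/eqP; rewrite eq_invg_mul S_invol.
have yV : (y^-1 = y)%g by apply/eqP; rewrite eq_invg_mul S_invol.
have altW k : alt x y k \in <<S>> by apply: (subsetP (words_sub k)); apply: alt_words.
have P1 : P 1.
  rewrite /P /= mulg1 xV; apply/eqP.
  have := @len_genl x (x * w)%g xS (groupM (mem_gen xS) wW).
  by rewrite mulgA S_invol // mul1g => h; apply/eqP; rewrite eqn_leq desc h.
have exP : exists k, P k by exists 1.
have bP k : P k -> (k <= len S w)%N by move/eqP<-; apply: leq_addr.
case: (ex_maxnP exP bP) => -[|k] Pk kmax; first by have := kmax _ P1.
pose v := ((alt x y k.+1)^-1 * w)%g.
have vW : v \in <<S>> by rewrite groupM ?groupV.
have wv : w = (alt x y k.+1 * v)%g by rewrite mulKVg.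
have Pv : (k.+1 + len S v = len S w)%N by apply/eqP.
suff h : (len S v < len S ((if odd k.+1 then y else x) * v)%g)%N /\
         (len S v < len S ((if odd k then y else x) * v)%g)%N.
  by exists k, v; split; rewrite ?Pv //; move: h => /=; case: (odd k) => /= -[h1 h2].
have cS b : (if b then y else x) \in S by case: b.
have cV b : ((if b then y else x)^-1 = (if b then y else x))%g by case: b.
split.
  set c := (if _ then _ else _); rewrite ltnNge; apply/negP => le.
  have lt : (len S (c * v)%g < len S v)%N by rewrite ltn_neqAle le parity //; apply: cS.
  have e : len S v = (len S (c * v)%g).+1.
    have := @len_genl c (c * v)%g (cS _) (groupM (mem_gen (cS _)) vW).
    rewrite mulgA S_invol ?mul1g; last exact: cS.
    by move=> h; apply/eqP; rewrite eqn_leq h lt.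
  suff /kmax : P k.+2 by rewrite ltnn.
  by rewrite /P altSr invMg cV -mulgA -/v -/c -Pv e addSnnS.
set c := (if _ then _ else _).
have : (len S w <= k + len S (c * v)%g)%N.
  rewrite wv altSr -/c -mulgA; apply: len_mull; first exact: alt_words.
  by rewrite groupM // mem_gen //; apply: cS.
by rewrite -Pv addSn ltn_add2l.
Qed.

End Words.

(** * The geometric representation: invariant form, roots and faithfulness *)

Record coxeter_rep (gT : finGroupType) n (sv : 'I_n -> gT) (rho : gT -> 'M[algC]_n) : Prop :=
  CoxeterRep {
    cox_inj : injective sv;
    cox_order : forall i, #[sv i]%g = 2%N;
    cox_geom : geom_rep sv rho }.

Definition nng n (v : 'rV[algC]_n) : bool := [forall j, 0 <= v 0 j].

Lemma nngP n (v : 'rV[algC]_n) : reflect (forall j, 0 <= v 0 j) (nng v).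
Proof. exact: forallP. Qed.

Lemma nngD n (u v : 'rV[algC]_n) : nng u -> nng v -> nng (u + v).
Proof. by move=> /nngP hu /nngP hv; apply/nngP => j; rewrite mxE addr_ge0. Qed.

Lemma nngZ n a (v : 'rV[algC]_n) : 0 <= a -> nng v -> nng (a *: v).
Proof. by move=> a0 /nngP hv; apply/nngP => j; rewrite mxE mulr_ge0. Qed.

Lemma nng_anti n (v : 'rV[algC]_n) : nng v -> nng (- v) -> v = 0.
Proof.
move=> /nngP h1 /nngP h2; apply/rowP => j; rewrite mxE; apply/eqP.
by rewrite eq_le h1 andbT -oppr_ge0; have := h2 j; rewrite mxE.
Qed.

Section Geometry.
Variables (gT : finGroupType) (n : nat) (sv : 'I_n -> gT) (rho : gT -> 'M[algC]_n).
Hypothesis H : coxeter_rep sv rho.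
Local Notation S := [set sv i | i : 'I_n].
Local Notation W := <<[set sv i | i : 'I_n]>>%g.
Local Notation G := (Gram sv).
Local Notation alpha i := (delta_mx 0 i : 'rV[algC]_n).

Lemma mem_sv i : sv i \in S. Proof. exact: imset_f. Qed.

Lemma sv_gen i : sv i \in W. Proof. by rewrite mem_gen ?mem_sv. Qed.

Lemma svK i : (sv i * sv i = 1)%g.
Proof. by have := expg_order (sv i); rewrite (cox_order H) expgS expg1. Qed.

Lemma svV i : ((sv i)^-1 = sv i)%g.
Proof. by apply/eqP; rewrite eq_invg_mul svK. Qed.

Lemma S_invol s : s \in S -> (s * s = 1)%g.
Proof. by case/imsetP=> i _ ->; apply: svK. Qed.

Lemma W_ind (P : gT -> Prop) :
    P 1%g -> (forall i w, w \in W -> P w -> P (sv i * w)%g) ->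
  forall w, w \in W -> P w.
Proof.
move=> P1 PS w wW; have := len_words wW; move: (len _ _) => k.
elim: k w {wW} => [|k IHk] w /=; first by move/set1P->.
case/mulsgP=> s v /imsetP[i _ ->] vk ->; apply: PS; last exact: IHk.
exact: (subsetP (words_sub _ _)) vk.
Qed.

Lemma rhoM x y : x \in W -> y \in W -> rho (x * y)%g = rho x *m rho y.
Proof. by have [h _] := cox_geom H; apply: h. Qed.

Lemma rho_sv i : rho (sv i) = refl sv i.
Proof. by have [_ ->] := cox_geom H. Qed.

Lemma Gram_sym i j : G i j = G j i.
Proof. by rewrite !mxE -[in LHS]orderV invMg !svV. Qed.

Lemma trGram : G^T = G.
Proof. by apply/matrixP => i j; rewrite mxE Gram_sym. Qed.

Lemma Gram_diag i : G i i = 1.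
Proof. by rewrite mxE svK order1 root1C raddfN /= opprK (Creal_ReP _ _) ?rpred1. Qed.

Definition rfl (b : 'rV[algC]_n) : 'M[algC]_n := 1%:M - (2 *: (G *m b^T)) *m b.

Lemma reflE i : refl sv i = rfl (alpha i).
Proof.
rewrite /refl /rfl; move: (Gram sv) Gram_sym => g g_sym.
congr (_ - _); apply/matrixP => j k; rewrite !mxE big_ord1 !mxE eqxx /=.
rewrite (bigD1 i) //= big1 ?addr0 => [|l li]; last by rewrite !mxE (negPf li) andbF mulr0.
by rewrite !mxE !eqxx mulr1 g_sym.
Qed.

Lemma mul_rfl (v b : 'rV[algC]_n) : v *m rfl b = v - (2 * (v *m G *m b^T) 0 0) *: b.
Proof.
rewrite mulmxBr mulmx1 mulmxA -scalemxAr [v *m (G *m _)]mulmxA; congr (_ - _).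
by rewrite -scalemxAl {1}[v *m G *m b^T]mx11_scalar mul_scalar_mx scalerA.
Qed.

Lemma mul_delta_mx_mx m (i : 'I_n) (A : 'M[algC]_(n, m)) : alpha i *m A = row i A.
Proof. by rewrite -rowE. Qed.

Lemma alpha_refl i j : alpha j *m refl sv i = alpha j - (2 * G i j) *: alpha i.
Proof.
rewrite reflE mul_rfl mul_delta_mx_mx trmx_delta -colE Gram_sym.
by move: (Gram sv) => g; rewrite !mxE.
Qed.

Lemma alpha_norm i : alpha i *m G *m (alpha i)^T = 1%:M.
Proof.
rewrite mul_delta_mx_mx trmx_delta -colE [LHS]mx11_scalar.
by move: (Gram sv) (Gram_diag i) => g gi; rewrite !mxE gi.
Qed.

Lemma mul_rfl_id (b : 'rV[algC]_n) : b *m G *m b^T = 1%:M -> b *m rfl b = - b.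
Proof.
move=> nb; rewrite mul_rfl nb mxE mulr1 scaler_nat mulr2n opprD addrA subrr.
by rewrite add0r.
Qed.

Lemma rfl_preserves (b : 'rV[algC]_n) :
  b *m G *m b^T = 1%:M -> rfl b *m G *m (rfl b)^T = G.
Proof.
move=> nb; have -> : (rfl b)^T = 1%:M - b^T *m (2 *: (b *m G)).
  by rewrite /rfl linearB /= trmx1 trmx_mul linearZ /= trmx_mul trmxK trGram.
rewrite /rfl !mulmxBl !mulmxBr !mulmx1 !mul1mx.
set c := G *m b^T; set d := b *m G.
have e1 : G *m (b^T *m (2 *: d)) = 2 *: (c *m d) by rewrite mulmxA -scalemxAr.
have e2 : 2 *: c *m b *m G = 2 *: (c *m d) by rewrite -mulmxA -scalemxAl.
have e3 : 2 *: c *m b *m G *m (b^T *m (2 *: d)) = 2 *: (2 *: (c *m d)).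
  rewrite e2 -scalemxAl; congr (_ *: _).
  by rewrite -(mulmxA c) (mulmxA d) nb mul1mx -scalemxAr.
rewrite e1 e3 e2; move: (2 *: (c *m d)) => y.
by rewrite scaler_nat mulr2n opprB addrK subrK.
Qed.

Lemma rflK (b : 'rV[algC]_n) : b *m G *m b^T = 1%:M -> rfl b *m rfl b = 1%:M.
Proof.
move=> nb; apply/row_matrixP => i; rewrite -[row i (_ *m _)]mul_delta_mx_mx mulmxA.
rewrite [alpha i *m rfl b]mul_rfl mulmxBl -scalemxAl (mul_rfl_id nb) mul_rfl.
by rewrite scalerN opprK subrK row1.
Qed.

Lemma rho1 : rho 1%g = 1%:M.
Proof.
apply/row_matrixP => i; congr row.
by rewrite -(svK i) rhoM ?sv_gen // rho_sv reflE rflK ?alpha_norm.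
Qed.

Lemma rhoVr x : x \in W -> rho x *m rho x^-1%g = 1%:M.
Proof. by move=> xW; rewrite -rhoM ?groupV // mulgV rho1. Qed.

Lemma rho_unit x : x \in W -> rho x \in unitmx.
Proof. by move=> xW; case: (mulmx1_unit (rhoVr xW)). Qed.

Lemma rhoV x : x \in W -> rho x^-1%g = invmx (rho x).
Proof.
by move=> xW; rewrite -[LHS](mulKmx (rho_unit xW)) rhoVr // mulmx1.
Qed.

Lemma rho_preserves w : w \in W -> rho w *m G *m (rho w)^T = G.
Proof.
move: w; apply: W_ind => [|i w wW IHw]; first by rewrite rho1 mul1mx trmx1 mulmx1.
rewrite rhoM ?sv_gen // trmx_mul -!mulmxA (mulmxA G) 2!(mulmxA (rho w)) IHw.
by rewrite rho_sv reflE mulmxA rfl_preserves ?alpha_norm.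
Qed.

Lemma det_rfl (b : 'rV[algC]_n) : b *m G *m b^T = 1%:M -> \det (rfl b) = -1.
Proof.
move=> nb; rewrite /rfl -mulNmx det_1addMC mulmxN -scalemxAr mulmxA nb.
by rewrite det_mx11 !mxE mulr1 opprD addrA subrr add0r.
Qed.

Lemma det_rho_sv i : \det (rho (sv i)) = -1.
Proof. by rewrite rho_sv reflE det_rfl ?alpha_norm. Qed.

Lemma det_rho_words k w : w \in words S k -> \det (rho w) = (-1) ^+ k.
Proof.
elim: k w => [|k IHk] w /=; first by move/set1P->; rewrite rho1 det1.
case/mulsgP=> s v /imsetP[i _ ->] vk ->.
by rewrite rhoM ?sv_gen ?(subsetP (words_sub _ _) _ vk) // det_mulmx (IHk v) // det_rho_sv exprS.
Qed.

Lemma det_rho w : w \in W -> \det (rho w) = (-1) ^+ len S w.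
Proof. by move=> wW; apply/det_rho_words/len_words. Qed.

(** The determinant of [rho v] records the parity of the length, and a simple reflection has
    determinant -1. *)
Lemma len_parity s v : s \in S -> v \in W -> len S (s * v)%g != len S v.
Proof.
case/imsetP=> i _ -> vW; apply/negP => /eqP e.
have := det_rho (groupM (sv_gen i) vW); rewrite e rhoM ?sv_gen // det_mulmx det_rho_sv.
rewrite det_rho // mulN1r => /eqP; rewrite -subr_eq0 -opprD oppr_eq0 -mulr2n.
by rewrite mulrn_eq0 signr_eq0.
Qed.

Local Notation root i w := (row i (rho w)).

(** Each further letter reflects in the plane of [alpha i] and [alpha j], which is one step of the
    Chebyshev recurrence with [c = - G i j]; the parity of [k] tells which simple root was updated
    last. *)
Lemma row_alt i j k : i != j ->
  root i (alt (sv j) (sv i) k) =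
    chebU (- G i j) k.+1 *: alpha (if odd k then j else i) +
    chebU (- G i j) k *: alpha (if odd k then i else j).
Proof.
move=> ij; have sW a b l : alt (sv a) (sv b) l \in W.
  by apply: (subsetP (words_sub _ _)); apply: alt_words; apply: mem_sv.
elim: k => [|k IHk].
  by rewrite [alt _ _ _]/= rho1 scale1r scale0r addr0 -mul_delta_mx_mx mulmx1.
rewrite altSr rhoM //; last by case: odd; rewrite sv_gen.
rewrite row_mul IHk chebUSS [odd k.+1]/=.
move: (chebU _ k.+1) (chebU _ k) => u v; case: (odd k); rewrite /= rho_sv mulmxDl -!scalemxAl;
  rewrite !alpha_refl Gram_diag ?(Gram_sym j i); move: (G i j) => c.
  by apply/rowP => l; rewrite !mxE; ring.
by apply/rowP => l; rewrite !mxE; ring.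
Qed.

Lemma order_sv_gt1 i j : i != j -> (1 < #[sv i * sv j]%g)%N.
Proof.
move=> ij; rewrite ltn_neqAle order_gt0 andbT eq_sym order_eq1; apply/negP => /eqP e.
case/negP: ij; apply/eqP/(cox_inj H)/eqP.
by rewrite -[sv j]svV eq_mulgV1 invgK e.
Qed.

(* Strip from [w] a maximal alternating word in [sv j], [sv i]: it is shorter than
   the order of [sv i * sv j], since otherwise the braid relation would let [w]
   start with [sv i]; so its Chebyshev coefficients are nonnegative. *)
Lemma root_nng i w : w \in W -> (len S w < len S (sv i * w)%g)%N -> nng (root i w).
Proof.
move: {2}(len S w).+1 (ltnSn (len S w)) => N; elim: N i w => // N IHN i w lenw wW lt.
have [->|w1] := eqVneq w 1%g.
  by rewrite rho1; apply/nngP => j; rewrite !mxE ler0n.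
have [s /imsetP[j _ ->] desc] := len_descent S_invol wW w1.
have ij : i != j.
  by apply/negP => /eqP e; move: lt; rewrite e ltnNge (ltnW desc).
have [k [v [vW we wl v1 v2]]] :=
  strip_alt S_invol (mem_sv j) (mem_sv i) wW desc len_parity.
have m1 := order_sv_gt1 ij.
have km : (k.+1 < #[sv i * sv j]%g)%N.
  set m := #[_]%g; rewrite ltnNge; apply/negP => mk; move: lt; apply/negP; rewrite -leqNgt.
  pose b := if odd m then alt (sv i) (sv j) (k.+1 - m) else alt (sv j) (sv i) (k.+1 - m).
  have bk : b \in words S (k.+1 - m).
    by rewrite /b; case: odd; apply: alt_words; apply: mem_sv.
  have wE : w = (sv i * (alt (sv j) (sv i) m.-1 * (b * v)))%g.
    rewrite we -(subnK mk) addnC alt_add -/b !mulgA; congr (_ * _ * _)%g.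
    rewrite (alt_swap S_invol) ?mem_sv //.
    have -> : ((sv j * sv i) ^+ m = 1)%g.
      by rewrite -[(sv j * sv i)%g]invgK invMg !svV expgVn expg_order invg1.
    by rewrite mul1g -[X in alt _ _ X](prednK (order_gt0 _)).
  rewrite {1}wE mulgA svK mul1g wl.
  apply: leq_trans (_ : (m.-1 + ((k.+1 - m) + len S v) <= _)%N).
    apply: len_le; apply: words_mul; first by apply: alt_words; apply: mem_sv.
    by apply: words_mul => //; apply: len_words.
  by rewrite addnA leq_add2r -[X in (_ <= X)%N](subnKC mk) leq_add2r leq_pred.
rewrite we rhoM //; last by apply: (subsetP (words_sub _ _)); apply: alt_words; apply: mem_sv.
rewrite row_mul row_alt // mulmxDl -!scalemxAl !mul_delta_mx_mx.
have cE : - G i j = 'Re (#[sv i * sv j]%g.-root (-1)) by rewrite mxE opprK.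
have lv : (len S v < N)%N by rewrite -ltnS (leq_trans _ lenw) // wl; lia.
apply: nngD; apply: nngZ; rewrite ?cE ?chebU_ge0 //; try exact: ltnW.
- by case: odd; apply: IHN.
- by case: odd; apply: IHN.
Qed.

Lemma root_neq0 i w : w \in W -> root i w != 0.
Proof.
move=> wW; apply/negP => /eqP r0.
have := mulmxA (alpha i) (rho w) (rho w^-1%g).
rewrite rhoVr // mulmx1 mul_delta_mx_mx r0 mul0mx => /rowP/(_ i).
by rewrite !mxE !eqxx => /eqP; rewrite oner_eq0.
Qed.

Lemma rootS i w : w \in W -> root i (sv i * w)%g = - root i w.
Proof.
move=> wW; rewrite rhoM ?sv_gen // row_mul -[root i (sv i)]mul_delta_mx_mx rho_sv.
rewrite alpha_refl Gram_diag mulr1 scaler_nat mulr2n opprD addrA subrr add0r.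
by rewrite mulNmx mul_delta_mx_mx.
Qed.

Lemma root_dich i w : w \in W -> nng (root i w) \/ nng (- root i w).
Proof.
move=> wW; have := len_parity (mem_sv i) wW; rewrite neq_ltn => /orP[] lt.
  right; rewrite -rootS //; apply: root_nng; rewrite ?groupM ?sv_gen //.
  by rewrite mulgA svK mul1g.
by left; apply: root_nng.
Qed.

Lemma root_nngE i w : w \in W -> nng (root i w) = (len S w < len S (sv i * w)%g)%N.
Proof.
move=> wW; apply/idP/idP => [pw|]; last exact: root_nng.
rewrite ltnNge leq_eqVlt negb_or (len_parity (mem_sv i) wW) /=; apply/negP => lt.
have := root_neq0 i wW; rewrite (nng_anti pw) ?eqxx // -rootS //.
by apply: root_nng; rewrite ?groupM ?sv_gen // mulgA svK mul1g.
Qed.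

Lemma nng_roots_id w : w \in W -> (forall i, nng (root i w)) -> w = 1%g.
Proof.
move=> wW h; apply/eqP/contraT => w1.
have [s /imsetP[i _ ->] desc] := len_descent S_invol wW w1.
by have := h i; rewrite root_nngE // ltnNge ltnW.
Qed.

Lemma rho_inj : {in W &, injective rho}.
Proof.
move=> x y xW yW e; apply/eqP; rewrite eq_mulgV1; apply/eqP.
apply: nng_roots_id => [|i]; first by rewrite groupM ?groupV.
by rewrite rhoM ?groupV // e rhoVr //; apply/nngP => j; rewrite !mxE ler0n.
Qed.

(* Averaging [rho] over [W] gives [0], because [alpha i] is negated by [sv i];
   but the average fixes the radical of [G]. *)
Lemma Gram_inj (v : 'rV[algC]_n) : v *m G = 0 -> v = 0.
Proof.
move=> v0; pose P := \sum_(w in W) rho w.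
have vP : v *m P = #|W|%:R *: v.
  rewrite mulmx_sumr -sum1_card natr_sum scaler_suml; apply: eq_bigr => w wW.
  rewrite scale1r; move: w wW; apply: W_ind => [|i w wW IHw]; first by rewrite rho1 mulmx1.
  by rewrite rhoM ?sv_gen // mulmxA rho_sv reflE mul_rfl v0 mul0mx mxE mulr0 scale0r subr0.
have P0 : P = 0.
  apply/row_matrixP => i; rewrite row0 -mul_delta_mx_mx.
  have e : rho (sv i) *m P = P.
    rewrite mulmx_sumr [RHS](reindex_inj (mulgI (sv i))) /=.
    by apply: eq_big => w; rewrite ?groupMl ?sv_gen // => wW; rewrite rhoM ?sv_gen.
  have : alpha i *m P = - (alpha i *m P).
    rewrite -{1}e mulmxA rho_sv alpha_refl Gram_diag mulr1 scaler_nat mulr2n.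
    by rewrite opprD addrA subrr add0r mulNmx.
  move/eqP; rewrite -addr_eq0 -mulr2n -scaler_nat scaler_eq0 pnatr_eq0 /=.
  by move/eqP.
move: vP; rewrite P0 mulmx0 => /esym/eqP; rewrite scaler_eq0 pnatr_eq0.
by rewrite eqn0Ngt cardG_gt0 /= => /eqP.
Qed.

Lemma Gram_unit : G \in unitmx.
Proof.
rewrite -row_free_unit -kermx_eq0; apply/eqP/row_matrixP => i.
by rewrite row0; apply: Gram_inj; rewrite -row_mul mulmx_ker row0.
Qed.

End Geometry.

Lemma gen_ind (gT : finGroupType) (A : {set gT}) (P : gT -> Prop) :
    P 1%g -> (forall a w, a \in A -> w \in <<A>>%g -> P w -> P (a * w)%g) ->
  forall w, w \in <<A>>%g -> P w.
Proof.
move=> P1 PS w wA; have := len_words wA; move: (len _ _) => k.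
elim: k w {wA} => [|k IHk] w /=; first by move/set1P->.
case/mulsgP=> a v aA vk ->; apply: PS; [by [] | | exact: IHk].
exact: (subsetP (words_sub _ _)) vk.
Qed.

(** * Reflections, their roots and their hyperplanes *)

Section Reflections.
Variables (gT : finGroupType) (n : nat) (sv : 'I_n -> gT) (rho : gT -> 'M[algC]_n).
Hypothesis H : coxeter_rep sv rho.
Local Notation S := [set sv i | i : 'I_n].
Local Notation W := <<[set sv i | i : 'I_n]>>%g.
Local Notation G := (Gram sv).
Local Notation alpha i := (delta_mx 0 i : 'rV[algC]_n).
Local Notation root i w := (row i (rho w)).

Lemma rfl_conj b w : w \in W -> rho w^-1%g *m rfl sv b *m rho w = rfl sv (b *m rho w).
Proof.
move=> wW; rewrite mulmxBr mulmx1 mulmxBl -(rhoM H) ?groupV // mulVg (rho1 H).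
congr (_ - _); rewrite !mulmxA; congr (_ *m _ *m _).
rewrite -scalemxAr trmx_mul !mulmxA; congr (_ *: (_ *m _)).
rewrite -[in LHS](rho_preserves H wW) !mulmxA -(rhoM H) ?groupV // mulVg (rho1 H).
by rewrite mul1mx.
Qed.

Lemma rho_svJ i w : w \in W -> rho (sv i ^ w)%g = rfl sv (root i w).
Proof.
move=> wW; rewrite conjgE !(rhoM H) ?groupV ?groupM ?sv_gen // (rho_sv H) (reflE H).
by rewrite mulmxA rfl_conj // mul_delta_mx_mx.
Qed.

Lemma root_norm i w : w \in W -> root i w *m G *m (root i w)^T = 1%:M.
Proof.
move=> wW; rewrite -(mul_delta_mx_mx i) trmx_mul -(alpha_norm H i).
by rewrite -!mulmxA (mulmxA G) 2!(mulmxA (rho w)) (rho_preserves H wW).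
Qed.

Lemma root_eq_conj i j w : w \in W -> root i w = alpha j -> (sv i ^ w)%g = sv j.
Proof.
move=> wW e; apply: (rho_inj H); rewrite ?groupJ ?sv_gen //.
by rewrite rho_svJ // e (rho_sv H) (reflE H).
Qed.

Lemma Tset_rfl t : t \in Tset S ->
  exists2 b : 'rV[algC]_n, rho t = rfl sv b & b *m G *m b^T = 1%:M.
Proof.
case/imset2P=> s w /imsetP[i _ ->] wW ->.
by exists (root i w); [apply: rho_svJ | apply: root_norm].
Qed.

Lemma TsetW t : t \in Tset S -> t \in W.
Proof.
case/imset2P=> s w sS wW ->; rewrite groupJ //; exact: mem_gen.
Qed.

Lemma TsetJ t w : t \in Tset S -> w \in W -> (t ^ w)%g \in Tset S.
Proof.
case/imset2P=> s v sS vW -> wW; rewrite -conjgM.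
by apply/imset2P; exists s (v * w)%g; rewrite ?groupM.
Qed.

Lemma sub_ker_rfl m (A : 'M[algC]_(m, n)) (b : 'rV[algC]_n) : b *m G *m b^T = 1%:M ->
  (A <= kermx (rfl sv b - 1%:M))%MS = (A *m G *m b^T == 0).
Proof.
move=> nb; rewrite sub_kermx /rfl addrAC subrr add0r mulmxN oppr_eq0.
rewrite -scalemxAl -scalemxAr scaler_eq0 pnatr_eq0 /= !mulmxA.
apply/eqP/eqP => [e | ->]; last by rewrite mul0mx.
rewrite -[LHS]mulmx1 -nb [_ *m (b *m _ *m _)]mulmxA [_ *m (b *m _)]mulmxA.
by rewrite e !mul0mx.
Qed.

Lemma rfl_eq_sub (b c : 'rV[algC]_n) : b *m G *m b^T = 1%:M -> c *m G *m c^T = 1%:M ->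
  (c <= b)%MS -> rfl sv c = rfl sv b.
Proof.
move=> nb nc /sub_rVP[a ca]; rewrite ca in nc *.
have a2 : a * a = 1.
  move: nc; rewrite linearZ /= -!scalemxAl -scalemxAr nb scalerA => /matrixP/(_ 0 0).
  by rewrite !mxE mulr1.
rewrite /rfl [(a *: b)^T]linearZ /= -!scalemxAr -!scalemxAl !scalerA; congr (_ - _ *: _).
by rewrite mulrAC a2 mul1r.
Qed.

Lemma rank_ker_col m (C : 'M[algC]_(m, n)) : \rank (kermx (G *m C^T)) = (n - \rank C)%N.
Proof.
rewrite mxrank_ker; congr (_ - _)%N.
by rewrite (eqmxMfull _ _) ?mxrank_tr // row_full_unit (Gram_unit H).
Qed.

(** Proportional roots of norm 1 define the same reflection, and [rho] is faithful. *)
Lemma Tset_free t t' (b c : 'rV[algC]_n) : t \in Tset S -> t' \in Tset S -> t != t' ->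
    rho t = rfl sv b -> rho t' = rfl sv c ->
    b *m G *m b^T = 1%:M -> c *m G *m c^T = 1%:M ->
  \rank (col_mx b c) = 2%N.
Proof.
move=> tT t'T tt' rb rc nb nc.
have ncb : ~~ (c <= b)%MS.
  apply: contra tt' => /(rfl_eq_sub nb nc) e; apply/eqP/(rho_inj H); rewrite ?TsetW //.
  by rewrite rb rc e.
have b1 : \rank b = 1%N.
  rewrite rank_rV; case: eqP nb => // -> /matrixP/(_ 0 0).
  by rewrite !mul0mx !mxE => /eqP; rewrite eq_sym oner_eq0.
apply/eqP; rewrite eqn_leq -[X in (_ <= X)%N]/(1 + 1)%N rank_leq_row /=.
have : (b < b + c)%MS.
  by rewrite ltmxE addsmxSl /=; apply: contra ncb => h; apply: submx_trans (addsmxSr _ _) h.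
by rewrite ltmxErank addsmxSl b1 /= addsmxE.
Qed.

Lemma sub_capH m (A : 'M[algC]_(m, n)) (R : {set gT}) :
  (A <= capH rho R)%MS = [forall t in R, (A <= kermx (rho t - 1%:M))%MS].
Proof.
apply/sub_bigcapmxP/forall_inP => h t tR; exact: h.
Qed.

Lemma eqmx_of_sub m1 m2 (A : 'M[algC]_(m1, n)) (B : 'M[algC]_(m2, n)) :
  (forall C : 'M[algC]_n, (C <= A)%MS = (C <= B)%MS) -> (A :=: B)%MS.
Proof.
move=> h; apply/eqmxP/andP; split.
  by have := h <<A>>%MS; rewrite !genmxE submx_refl => <-.
by have := h <<B>>%MS; rewrite !genmxE submx_refl => ->.
Qed.

End Reflections.

(** * A parabolic subgroup of rank two *)

Section RankTwo.
Variables (gT : finGroupType) (n : nat) (sv : 'I_n -> gT) (rho : gT -> 'M[algC]_n).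
Hypothesis H : coxeter_rep sv rho.
Variables i0 j0 : 'I_n.
Hypothesis ij : i0 != j0.
Local Notation S := [set sv i | i : 'I_n].
Local Notation W := <<[set sv i | i : 'I_n]>>%g.
Local Notation G := (Gram sv).
Local Notation alpha i := (delta_mx 0 i : 'rV[algC]_n).
Local Notation root i w := (row i (rho w)).
Local Notation WL := <<[set sv i0; sv j0]>>%g.
Local Notation FixL := (Fix rho WL).

Definition inPlane (v : 'rV[algC]_n) : Prop := forall k, k != i0 -> k != j0 -> v 0 k = 0.

(* [d] is the shortest element of its coset [W_L d]. *)
Definition XL (d : gT) : bool := nng (root i0 d) && nng (root j0 d).

(* The projection of [V] onto [Fix W_L] along the plane of [L]. *)
Definition PL : 'M[algC]_n := #|WL|%:R^-1 *: \sum_(u in WL) rho u.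

Lemma inPlane_decomp v : inPlane v -> v = v 0 i0 *: alpha i0 + v 0 j0 *: alpha j0.
Proof.
move=> vE; apply/rowP => k; rewrite !mxE !eqxx /=.
have [->|ki] := eqVneq k i0; first by rewrite (negPf ij) mulr1 mulr0 addr0.
have [->|kj] := eqVneq k j0; first by rewrite mulr1 mulr0 add0r.
by rewrite !mulr0 addr0 vE.
Qed.

Lemma inPlaneD u v : inPlane u -> inPlane v -> inPlane (u + v).
Proof. by move=> hu hv k k1 k2; rewrite mxE hu // hv // addr0. Qed.

Lemma inPlaneZ a v : inPlane v -> inPlane (a *: v).
Proof. by move=> hv k k1 k2; rewrite mxE hv // mulr0. Qed.

Lemma inPlaneN v : inPlane v -> inPlane (- v).
Proof. by move=> hv k k1 k2; rewrite mxE hv // oppr0. Qed.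

Lemma inPlane_alphai : inPlane (alpha i0).
Proof. by move=> k k1 k2; rewrite mxE (negPf k1) andbF. Qed.

Lemma inPlane_alphaj : inPlane (alpha j0).
Proof. by move=> k k1 k2; rewrite mxE (negPf k2) andbF. Qed.

Lemma WL_sub : WL \subset W.
Proof. by rewrite genS //; apply/subsetP => x /set2P[]->; apply: mem_sv. Qed.

Lemma WLW u : u \in WL -> u \in W. Proof. exact: (subsetP WL_sub). Qed.

Lemma svi_WL : sv i0 \in WL. Proof. by rewrite mem_gen ?set21. Qed.
Lemma svj_WL : sv j0 \in WL. Proof. by rewrite mem_gen ?set22. Qed.

Lemma mul_sv (v : 'rV[algC]_n) i : v *m rho (sv i) = v - (2 * (v *m G *m (alpha i)^T) 0 0) *:
    alpha i.
Proof. by rewrite (rho_sv H) (reflE H) mul_rfl. Qed.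

Lemma WL_out u (v : 'rV[algC]_n) : u \in WL -> inPlane (v *m rho u - v).
Proof.
move=> uL; move: u uL v.
apply: gen_ind => [v|a u aL uL IHu v].
  by rewrite (rho1 H) mulmx1 subrr => k _ _; rewrite mxE.
have aW : a \in W by apply: WLW; apply: mem_gen.
rewrite (rhoM H) ?(WLW uL) // mulmxA.
rewrite -[X in inPlane (X - v)](subrK (v *m rho a)) -addrA; apply: inPlaneD; first exact: IHu.
case/set2P: aL => ->; rewrite mul_sv addrAC subrr add0r; apply: inPlaneN; apply: inPlaneZ.
  exact: inPlane_alphai.
exact: inPlane_alphaj.
Qed.

Lemma inPlane_rho u v : u \in WL -> inPlane v -> inPlane (v *m rho u).
Proof. by move=> uL vE; rewrite -[_ *m _](subrK v); apply: inPlaneD => //; apply: WL_out. Qed.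

Lemma root_inPlanei u : u \in WL -> inPlane (root i0 u).
Proof. by move=> uL; rewrite -mul_delta_mx_mx; apply/inPlane_rho/inPlane_alphai. Qed.

Lemma root_inPlanej u : u \in WL -> inPlane (root j0 u).
Proof. by move=> uL; rewrite -mul_delta_mx_mx; apply/inPlane_rho/inPlane_alphaj. Qed.

(* Outside [i0] and [j0] the diagonal coefficients of [w] are [1], so the roots
   [root k w] stay positive. *)
Lemma XL_triv w : w \in W -> (forall v : 'rV[algC]_n, inPlane (v *m rho w - v)) -> XL w -> w = 1%g.
Proof.
move=> wW triv /andP[pi pj]; apply: (nng_roots_id H) => // k.
have [->//|ki] := eqVneq k i0; have [->//|kj] := eqVneq k j0.
case: (root_dich H k wW) => // /nngP/(_ k).
have := triv (alpha k) k ki kj; rewrite mul_delta_mx_mx !mxE !eqxx /= => /eqP.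
by rewrite subr_eq0 => /eqP ->; rewrite oppr_ge0 ler10.
Qed.

Lemma mul_inPlane v w : inPlane v -> v *m rho w = v 0 i0 *: root i0 w + v 0 j0 *: root j0 w.
Proof.
by move=> vE; rewrite {1}(inPlane_decomp vE) mulmxDl -!scalemxAl !mul_delta_mx_mx.
Qed.

Lemma nng_comb v d : inPlane v -> nng v -> XL d -> nng (v *m rho d).
Proof.
by move=> vE /nngP vp /andP[pi pj]; rewrite mul_inPlane //; apply: nngD; apply: nngZ.
Qed.

(** A dominant [d] keeps nonnegative vectors of the plane nonnegative, so the sign of a root in the
    plane depends only on the [W_L]-part of [u * d]. *)
Lemma nng_root_mul k u d : inPlane (root k u) -> u \in WL -> d \in W -> XL d ->
  nng (root k (u * d)%g) = nng (root k u).
Proof.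
move=> kE uL dW dX; have uW := WLW uL; have -> : root k (u * d)%g = root k u *m rho d.
  by rewrite (rhoM H) // row_mul.
apply/idP/idP => [pud|pu]; last exact: nng_comb.
case: (root_dich H k uW) => // nu.
have := root_neq0 H k (groupM uW dW); rewrite (rhoM H) // row_mul.
rewrite (nng_anti pud) ?eqxx // -mulNmx; exact: nng_comb (inPlaneN kE) nu dX.
Qed.

Lemma XL_uniq u d : u \in WL -> d \in W -> XL d -> XL (u * d)%g -> u = 1%g.
Proof.
move=> uL dW dX /andP[].
rewrite !nng_root_mul //; [move=> p1 p2 | exact: root_inPlanej | exact: root_inPlanei].
by apply: XL_triv; rewrite ?WLW // /XL ?p1 // => v; apply: WL_out.
Qed.

Lemma XLE d : d \in W -> XL d =
  (len S d < len S (sv i0 * d)%g)%N && (len S d < len S (sv j0 * d)%g)%N.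
Proof. by move=> dW; rewrite /XL !(root_nngE H). Qed.

Lemma XL_decomp w : w \in W -> exists u d, [/\ u \in WL, d \in W, XL d & w = (u * d)%g].
Proof.
move=> wW; case: (@arg_minnP _ 1%g (mem WL) (fun u => len S (u * w)%g) (group1 _)) => u uL umin.
have uW := WLW uL; exists u^-1%g, (u * w)%g; rewrite groupV mulKg groupM //; split=> //.
rewrite XLE ?groupM // !ltn_neqAle ![_ == len S (sv _ * _)%g]eq_sym.
rewrite !(len_parity H) ?mem_sv ?groupM //= !mulgA.
by rewrite (umin _ (groupM svi_WL uL)) (umin _ (groupM svj_WL uL)).
Qed.

Lemma memFix m (A : {set gT}) (v : 'M[algC]_(m, n)) :
  (v <= Fix rho A)%MS <-> (forall a, a \in A -> v *m rho a = v).
Proof.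
split=> [/sub_bigcapmxP h a /h|h].
  by rewrite sub_kermx mulmxBr mulmx1 subr_eq0 => /eqP.
by apply/sub_bigcapmxP => a /h e; rewrite sub_kermx mulmxBr mulmx1 e subrr.
Qed.

Let cWL : (#|WL|%:R : algC) != 0. Proof. by rewrite pnatr_eq0 -lt0n cardG_gt0. Qed.

Lemma rho_PL u : u \in WL -> rho u *m PL = PL.
Proof.
move=> uL; rewrite /PL -scalemxAr mulmx_sumr; congr (_ *: _).
rewrite [RHS](reindex_inj (mulgI u)) /=.
by apply: eq_big => w; rewrite ?groupMl // => wW; rewrite (rhoM H) ?WLW.
Qed.

Lemma PL_rho u : u \in WL -> PL *m rho u = PL.
Proof.
move=> uL; rewrite /PL -scalemxAl mulmx_suml; congr (_ *: _).
rewrite [RHS](reindex_inj (mulIg u)) /=.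
by apply: eq_big => w; rewrite ?groupMr // => wW; rewrite (rhoM H) ?WLW.
Qed.

Lemma PL_Fix m (v : 'M[algC]_(m, n)) : (v *m PL <= FixL)%MS.
Proof. by apply/memFix => u uL; rewrite -mulmxA PL_rho. Qed.

Lemma Fix_PL m (v : 'M[algC]_(m, n)) : (v <= FixL)%MS -> v *m PL = v.
Proof.
move/memFix=> h; rewrite /PL -scalemxAr mulmx_sumr (eq_bigr (fun=> v)) //.
by rewrite sumr_const -scaler_nat scalerA mulVf ?scale1r.
Qed.

Lemma sub_PL_inPlane (v : 'rV[algC]_n) : inPlane (v - v *m PL).
Proof.
move=> k k1 k2; rewrite mxE mxE /PL -scalemxAr mulmx_sumr mxE summxE.
rewrite (eq_bigr (fun=> v 0 k)) => [|u uL].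
  by rewrite sumr_const -[v 0 k *+ _]mulr_natl mulrA mulVf // mul1r subrr.
by have /eqP := WL_out v uL k1 k2; rewrite !mxE subr_eq0 => /eqP.
Qed.

Lemma alpha_PL i : sv i \in WL -> alpha i *m PL = 0.
Proof.
move=> iL; have : alpha i *m PL = - (alpha i *m PL).
  rewrite -{1}(rho_PL iL) mulmxA mul_delta_mx_mx -[sv i]mulg1 (rootS H) //.
  by rewrite (rho1 H) row1 mulNmx.
move/eqP; rewrite -addr_eq0 -mulr2n -scaler_nat scaler_eq0 pnatr_eq0 /=.
by move/eqP.
Qed.

Lemma inPlane_PL v : inPlane v -> v *m PL = 0.
Proof.
move=> vE; rewrite (inPlane_decomp vE) mulmxDl -!scalemxAl !alpha_PL ?svi_WL ?svj_WL //.
by rewrite !scaler0 addr0.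
Qed.

Lemma Fix_alpha (x : 'rV[algC]_n) i : sv i \in WL -> (x <= FixL)%MS -> x *m G *m (alpha i)^T = 0.
Proof.
move=> iL /memFix/(_ _ iL)/eqP; rewrite mul_sv -subr_eq0 addrAC subrr add0r oppr_eq0.
rewrite scaler_eq0 mulf_eq0 pnatr_eq0 /= => /orP[/eqP e|/eqP e].
  by rewrite [LHS]mx11_scalar e; apply/matrixP=> a b; rewrite !mxE mul0rn.
by have := congr1 (fun M : 'rV_n => M 0 i) e; rewrite !mxE !eqxx => /eqP; rewrite oner_eq0.
Qed.

Lemma Fix_perp (x v : 'rV[algC]_n) : (x <= FixL)%MS -> inPlane v -> x *m G *m v^T = 0.
Proof.
move=> xF vE; rewrite (inPlane_decomp vE) linearD !linearZ /= mulmxDr -!scalemxAr.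
by rewrite !Fix_alpha ?svi_WL ?svj_WL // !scaler0 addr0.
Qed.

Lemma Gram_trC (x y : 'rV[algC]_n) : x *m G *m y^T = 0 -> y *m G *m x^T = 0.
Proof.
by move/(congr1 trmx); rewrite !trmx_mul trmxK (trGram H) trmx0 mulmxA.
Qed.

(** The projection [v *m PL] is orthogonal to the plane because it is fixed, and to [Fix W_L]
    because [v] is; the form being nondegenerate, it vanishes. *)
Lemma perp_inPlane (v : 'rV[algC]_n) :
  (forall x : 'rV_n, (x <= FixL)%MS -> x *m G *m v^T = 0) -> inPlane v.
Proof.
move=> h; suff v0 : v *m PL = 0 by rewrite -[v]subr0 -v0; apply: sub_PL_inPlane.
apply: (Gram_inj H); apply/rowP => k; rewrite [RHS]mxE.
pose y : 'rV[algC]_n := alpha k.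
have : v *m PL *m G *m y^T = 0.
  rewrite -[y](subrK (y *m PL)) linearD /= mulmxDr.
  rewrite Fix_perp ?PL_Fix ?add0r //; last exact: sub_PL_inPlane.
  have -> : v *m PL *m G *m (y *m PL)^T = v *m G *m (y *m PL)^T - (v - v *m PL) *m G *m (y *m PL)^T.
    by rewrite !mulmxBl subKr.
  rewrite [X in X - _]Gram_trC ?sub0r; last by apply: h; apply: PL_Fix.
  rewrite [X in - X]Gram_trC ?oppr0 //.
  by apply: Fix_perp; [apply: PL_Fix | apply: sub_PL_inPlane].
by rewrite /y trmx_delta -colE; move: (v *m PL *m G) => z /matrixP/(_ 0 0); rewrite !mxE.
Qed.

(** By orthogonality [p] preserves the plane, so it displaces every vector by an element of the
    plane. The same holds for its dominant part [d], which is then trivial by [XL_triv]. *)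
Lemma Fix_stabilizer p : p \in W -> (FixL <= kermx (rho p - 1%:M))%MS -> p \in WL.
Proof.
move=> pW pfix.
have fixp (x : 'rV[algC]_n) : (x <= FixL)%MS -> x *m rho p = x.
  by move=> /submx_trans/(_ pfix); rewrite sub_kermx mulmxBr mulmx1 subr_eq0 => /eqP.
have Ep v : inPlane v -> inPlane (v *m rho p).
  move=> vE; apply: perp_inPlane => x xF.
  rewrite -(fixp x xF) trmx_mul -!mulmxA (mulmxA G) 2!(mulmxA (rho p)) (rho_preserves H pW).
  by rewrite mulmxA Fix_perp.
have triv (v : 'rV[algC]_n) : inPlane (v *m rho p - v).
  rewrite -[in X in inPlane X](subrK (v *m PL) v) mulmxDl (fixp _ (PL_Fix _)).
  rewrite opprD addrACA subrr addr0.
  by apply: inPlaneD; [apply: Ep | apply: inPlaneN]; apply: sub_PL_inPlane.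
have [u [d [uL dW dX e]]] := XL_decomp pW.
suff d1 : d = 1%g by rewrite e d1 mulg1.
apply: XL_triv => // v.
have -> : d = (u^-1 * p)%g by rewrite e mulKg.
rewrite (rhoM H (groupVr (WLW uL)) pW) mulmxA.
rewrite -[X in inPlane (X - v)](subrK (v *m rho u^-1%g)) -addrA; apply: inPlaneD; first exact: triv.
by apply: WL_out; rewrite groupV.
Qed.

Lemma fix_inPlane (v : 'rV[algC]_n) : inPlane v -> (v <= FixL)%MS -> v = 0.
Proof. by move=> vE vF; rewrite -(Fix_PL vF) inPlane_PL. Qed.

Lemma cuspidalP w :
  reflect (w \in WL /\ forall v, inPlane v -> v *m rho w = v -> v = 0)
          (cuspidal sv rho [set sv i0; sv j0] w).
Proof.
rewrite /cuspidal; case: (boolP (w \in WL)) => wL /=; last by right; case.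
have perpE (v : 'rV[algC]_n) : (v <= perpB sv FixL)%MS <-> inPlane v.
  split=> [vp|vE].
    apply: perp_inPlane => x /submxP[D ->]; apply: Gram_trC.
    by move: vp; rewrite sub_kermx mulmxA => /eqP e; rewrite trmx_mul mulmxA e mul0mx.
  rewrite sub_kermx mulmxA; apply/eqP/trmx_inj; rewrite trmx0.
  apply/row_matrixP => k; rewrite row0 !trmx_mul trmxK (trGram H) mulmxA !row_mul.
  by apply: Fix_perp vE; apply: row_sub.
apply: (iffP idP) => [/eqP r0|[_ h]].
  split=> // v vE vw; apply/eqP; rewrite -submx0.
  move/eqP: r0; rewrite mxrank_eq0 => /eqP <-.
  by rewrite sub_capmx sub_kermx mulmxBr mulmx1 vw subrr eqxx /=; apply/perpE.
rewrite mxrank_eq0; apply/eqP/row_matrixP => k; rewrite row0; apply: h.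
  by apply/perpE; apply: submx_trans (row_sub _ _) (capmxSr _ _).
have : (row k (kermx (rho w - 1%:M) :&: perpB sv FixL) <= kermx (rho w - 1%:M))%MS.
  by apply: submx_trans (row_sub _ _) (capmxSl _ _).
by rewrite sub_kermx mulmxBr mulmx1 subr_eq0 => /eqP.
Qed.

End RankTwo.

(** * The dihedral group [W_L] and its normalizer *)

Section Dihedral.
Variables (gT : finGroupType) (n : nat) (sv : 'I_n -> gT) (rho : gT -> 'M[algC]_n).
Hypothesis H : coxeter_rep sv rho.
Variables i0 j0 : 'I_n.
Hypothesis ij : i0 != j0.
Local Notation S := [set sv i | i : 'I_n].
Local Notation W := <<[set sv i | i : 'I_n]>>%g.
Local Notation G := (Gram sv).
Local Notation alpha i := (delta_mx 0 i : 'rV[algC]_n).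
Local Notation root i w := (row i (rho w)).
Local Notation WL := <<[set sv i0; sv j0]>>%g.
Local Notation inPlane := (inPlane i0 j0).
Local Notation XL := (XL rho i0 j0).
Local Notation s := (sv i0).
Local Notation t := (sv j0).
Local Notation r := (sv i0 * sv j0)%g.
Local Notation R := <[(sv i0 * sv j0)%g]>%g.
Local Notation N := 'N_W(WL)%g.
Local Notation sW := (WLW (i0 := i0) (j0 := j0)).

Lemma sr : (s * r)%g = t.
Proof. by rewrite mulgA (svK H) mul1g. Qed.

Lemma r_WL : r \in WL.
Proof. by rewrite groupM ?svi_WL ?svj_WL. Qed.

Lemma R_WL x : x \in R -> x \in WL.
Proof. by move=> xR; apply: (subsetP _ _ xR); rewrite cycle_subG r_WL. Qed.

Lemma RJs x : x \in R -> (x ^ s = x^-1)%g.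
Proof.
case/cycleP=> k ->; rewrite conjXg -expgVn; congr (_ ^+ _)%g.
by rewrite conjgE invMg !(svV H) !mulgA (svK H) mul1g.
Qed.

Lemma mulRs x : x \in R -> (x * s = s * x^-1)%g.
Proof. by move=> xR; rewrite -RJs // conjgE (svV H) !mulgA (svK H) mul1g. Qed.

Lemma RC x y : x \in R -> y \in R -> (x * y = y * x)%g.
Proof. by move=> xR yR; apply: (centsP (cycle_abelian r)). Qed.

Lemma WL_cases u : u \in WL -> u \in R \/ (s * u)%g \in R.
Proof.
move: u; apply: gen_ind => [|a u aL uL IHu]; first by left; apply: group1.
case/set2P: aL => ->.
  by case: IHu => uR; [right; rewrite mulgA (svK H) mul1g | left].
case: IHu => uR.
  by right; rewrite mulgA groupM ?cycle_id.
left; have -> : (t * u = r^-1 * (s * u))%g.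
  by rewrite invMg !(svV H) -mulgA [(s * (s * _))%g]mulgA (svK H) mul1g.
by rewrite groupM ?groupV ?cycle_id.
Qed.

Lemma det_R x : x \in R -> \det (rho x) = 1.
Proof.
case/cycleP=> k ->; elim: k => [|k IHk]; first by rewrite expg0 (rho1 H) det1.
have rW := sW r_WL; rewrite expgS (rhoM H) ?groupX // det_mulmx IHk mulr1.
by rewrite (rhoM H) ?sv_gen // det_mulmx !(det_rho_sv H) mulrNN mulr1.
Qed.

Lemma det_sR x : x \in R -> \det (rho (s * x)%g) = -1.
Proof.
move=> xR; rewrite (rhoM H) ?sv_gen ?(sW (R_WL xR)) // det_mulmx (det_R xR).
by rewrite (det_rho_sv H) mulr1.
Qed.

Lemma N1_neq1 : (-1 == 1 :> algC) = false.
Proof. by rewrite -subr_eq0 -opprD oppr_eq0 -mulr2n pnatr_eq0. Qed.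

Lemma R_det u : u \in WL -> (u \in R) = (\det (rho u) == 1).
Proof.
move=> uL; apply/idP/idP => [/det_R->//|].
case: (WL_cases uL) => // suR; have := det_sR suR; rewrite mulgA (svK H) mul1g => ->.
by rewrite N1_neq1.
Qed.

Lemma sR_det u : u \in WL -> ((s * u)%g \in R) = (\det (rho u) == -1).
Proof.
move=> uL; apply/idP/idP => [suR|].
  by have := det_sR suR; rewrite mulgA (svK H) mul1g => ->.
by case: (WL_cases uL) => // /det_R->; rewrite eq_sym N1_neq1.
Qed.

Lemma sR_WL x : x \in R -> (s * x)%g \in WL.
Proof. by move=> xR; rewrite groupM ?svi_WL ?R_WL. Qed.

Lemma sR_notin x : x \in R -> (s * x)%g \notin R.
Proof.
by move=> xR; rewrite R_det ?sR_WL // det_sR // N1_neq1.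
Qed.

Lemma sRK x : x \in R -> (s * x * (s * x) = 1)%g.
Proof. by move=> xR; rewrite mulgA -(mulgA s) mulRs // mulgA (svK H) mul1g mulVg. Qed.

(** For even exponents [s r^(2k)] is the conjugate of [s] by [r^k]; for odd ones
    [s r^(2k+1) = t r^(2k)] is the conjugate of [t]. *)
Lemma sR_Tset x : x \in R -> (s * x)%g \in Tset S.
Proof.
have conj k : (s ^ (r ^+ k) = s * r ^+ k.*2)%g.
  by rewrite conjgE mulgA mulRs ?groupV ?mem_cycle // invgK -mulgA -expgD addnn.
case/cycleP=> k ->; rewrite -(odd_double_half k).
case: odd; last first.
  rewrite add0n -conj; apply/imset2P; exists s (r ^+ k./2)%g; rewrite ?mem_sv //.
  by rewrite groupX ?sW ?r_WL.
rewrite add1n expgS mulgA sr; apply/imset2P; exists t (r ^+ k./2)%g; rewrite ?mem_sv //.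
  by rewrite groupX ?sW ?r_WL.
have -> : (t ^ (r ^+ k./2) = s ^ (r ^+ k./2) * r ^ (r ^+ k./2))%g by rewrite -conjMg sr.
rewrite conj conjgE -[(r * r ^+ _)%g]expgS expgSr mulKg -mulgA -expgSr expgS mulgA.
by rewrite sr.
Qed.

Lemma Tset_WL a : a \in Tset S -> a \in WL -> (s * a)%g \in R.
Proof.
move=> aT aL; rewrite sR_det //; have [b -> nb] := Tset_rfl H aT.
by rewrite det_rfl.
Qed.

Lemma NWP g : g \in N -> g \in W /\ (forall u, (u ^ g \in WL)%g = (u \in WL)).
Proof.
case/setIP=> gW gN; split=> // u.
by rewrite memJ_norm.
Qed.

(** The reflection [sv i ^ g] lies in [W_L] and negates [root i g], so it displaces this root by
    minus twice itself; but displacements under [W_L] lie in the plane. *)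
Lemma N_inPlane i g : sv i \in WL -> g \in N -> inPlane (root i g).
Proof.
move=> iL /NWP[gW gN].
have gL : (sv i ^ g)%g \in WL by rewrite gN.
have := WL_out H (root i g) gL; rewrite (rho_svJ H) // mul_rfl_id ?(root_norm H) // => h.
have -> : root i g = (- 2^-1) *: (- root i g - root i g).
  rewrite -opprD scalerN scaleNr opprK -mulr2n -scaler_nat scalerA mulVf ?scale1r //.
  by rewrite pnatr_eq0.
exact: inPlaneZ.
Qed.

Lemma N_inPlanei g : g \in N -> inPlane (root i0 g).
Proof. by apply: N_inPlane; apply: svi_WL. Qed.

Lemma N_inPlanej g : g \in N -> inPlane (root j0 g).
Proof. by apply: N_inPlane; apply: svj_WL. Qed.

Lemma WL_N u : u \in WL -> u \in N.
Proof. by move=> uL; apply/setIP; split; [apply: sW | rewrite (subsetP (normG _))]. Qed.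

Lemma N_decomp g : g \in N -> exists u d, [/\ u \in WL, d \in N, XL d & g = (u * d)%g].
Proof.
move=> gN; have [gW _] := NWP gN; have [u [d [uL dW dX e]]] := XL_decomp H i0 j0 gW.
exists u, d; split=> //; have -> : d = (u^-1 * g)%g by rewrite e mulKg.
by rewrite groupM ?groupV // WL_N.
Qed.

Lemma unit_simple (b : 'rV[algC]_n) j a :
  b *m G *m b^T = 1%:M -> 0 <= a -> b = a *: alpha j -> b = alpha j.
Proof.
move=> nb a0 e; move: nb; rewrite e linearZ /= -!scalemxAl -scalemxAr.
rewrite (alpha_norm H) scalerA => /matrixP/(_ 0 0); rewrite !mxE mulr1 => /eqP.
rewrite -expr2 sqrf_eq1 => /orP[]/eqP a1; first by rewrite a1 scale1r.
by move: a0; rewrite a1 oppr_ge0 ler10.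
Qed.

(* A nonnegative matrix with a nonnegative inverse is monomial. *)
Lemma N_monomial e d : e * e = 1 -> d \in N ->
    nng (e *: root i0 d) -> nng (e *: root j0 d) ->
    nng (e *: root i0 d^-1%g) -> nng (e *: root j0 d^-1%g) ->
  (e *: root i0 d = alpha i0 /\ e *: root j0 d = alpha j0) \/
  (e *: root i0 d = alpha j0 /\ e *: root j0 d = alpha i0).
Proof.
move=> ee dN /nngP qi /nngP qj /nngP pi /nngP pj.
have [dW _] := NWP dN; have dVN : d^-1%g \in N by rewrite groupV.
have [dVW _] := NWP dVN.
have ei : alpha i0 = (e *: root i0 d^-1%g) 0 i0 *: (e *: root i0 d)
    + (e *: root i0 d^-1%g) 0 j0 *: (e *: root j0 d).
  rewrite ![(e *: root i0 d^-1%g) _ _]mxE !scalerA ![e * _ * e]mulrAC !ee !mul1r.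
  by rewrite -(mul_inPlane rho ij _ (N_inPlanei dVN)) -row_mul -(rhoM H) // mulVg (rho1 H) row1.
have ej : alpha j0 = (e *: root j0 d^-1%g) 0 i0 *: (e *: root i0 d)
    + (e *: root j0 d^-1%g) 0 j0 *: (e *: root j0 d).
  rewrite ![(e *: root j0 d^-1%g) _ _]mxE !scalerA ![e * _ * e]mulrAC !ee !mul1r.
  by rewrite -(mul_inPlane rho ij _ (N_inPlanej dVN)) -row_mul -(rhoM H) // mulVg (rho1 H) row1.
have Ei := inPlaneZ e (N_inPlanei dN); have Ej := inPlaneZ e (N_inPlanej dN).
have normZ i : (e *: root i d) *m G *m (e *: root i d)^T = 1%:M.
  by rewrite linearZ /= -!scalemxAl -scalemxAr (root_norm H) // scalerA ee scale1r.
have := normZ i0; have := normZ j0.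
move: (e *: root i0 d) (e *: root j0 d) qi qj Ei Ej ei ej => x y qi qj Ei Ej ei ej ny nx.
set p := (e *: root i0 d^-1%g) 0 i0 in ei; set q := (e *: root i0 d^-1%g) 0 j0 in ei.
set p' := (e *: root j0 d^-1%g) 0 i0 in ej; set q' := (e *: root j0 d^-1%g) 0 j0 in ej.
have p0 : 0 <= p := pi i0; have q0 : 0 <= q := pi j0.
have p0' : 0 <= p' := pj i0; have q0' : 0 <= q' := pj j0.
have sum0 (a b : algC) : 0 <= a -> 0 <= b -> 0 = a + b -> a = 0 /\ b = 0.
  by move=> a0 b0 /esym/eqP; rewrite paddr_eq0 // => /andP[/eqP-> /eqP->].
have [pb qb] : p * x 0 j0 = 0 /\ q * y 0 j0 = 0.
  apply: sum0; rewrite ?mulr_ge0 //.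
  have := congr1 (fun v : 'rV_n => v 0 j0) ei.
  by rewrite /= [in LHS]mxE [(j0 == i0)]eq_sym (negPf ij) andbF [in RHS]mxE [(p *: x) _ _]mxE [(q
      *: y) _ _]mxE.
have [pa qa] : p' * x 0 i0 = 0 /\ q' * y 0 i0 = 0.
  apply: sum0; rewrite ?mulr_ge0 //.
  have := congr1 (fun v : 'rV_n => v 0 i0) ej.
  by rewrite /= [in LHS]mxE (negPf ij) andbF [in RHS]mxE [(p' *: x) _ _]mxE [(q' *: y) _ _]mxE.
have i_simple (z : 'rV[algC]_n) : inPlane z -> (forall k, 0 <= z 0 k) -> z *m G *m z^T = 1%:M ->
    z 0 j0 = 0 -> z = alpha i0.
  move=> zE z0 nz e0; apply: (unit_simple nz (z0 i0)).
  by rewrite [LHS](inPlane_decomp ij zE) e0 scale0r addr0.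
have j_simple (z : 'rV[algC]_n) : inPlane z -> (forall k, 0 <= z 0 k) -> z *m G *m z^T = 1%:M ->
    z 0 i0 = 0 -> z = alpha j0.
  move=> zE z0 nz e0; apply: (unit_simple nz (z0 j0)).
  by rewrite [LHS](inPlane_decomp ij zE) e0 scale0r add0r.
have aii : alpha i0 0 i0 = 1 by rewrite mxE !eqxx.
have ajj : alpha j0 0 j0 = 1 by rewrite mxE !eqxx.
have [pz|pz] := eqVneq p 0.
  have qz : q != 0.
    apply/negP => /eqP qz; move: aii; rewrite ei pz qz !scale0r addr0 mxE => /eqP.
    by rewrite eq_sym oner_eq0.
  right; have rj : y = alpha i0.
    by apply: i_simple => //; move/eqP: qb; rewrite mulf_eq0 (negPf qz) => /eqP.
  split=> //; apply: j_simple => //.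
  apply/eqP; move/eqP: pa; rewrite mulf_eq0 => /orP[] // /eqP p'0.
  move: qa; rewrite rj aii mulr1 => q'0.
  by move/eqP: ajj; rewrite ej p'0 q'0 !scale0r addr0 mxE eq_sym oner_eq0.
left; have ri : x = alpha i0.
  by apply: i_simple => //; move/eqP: pb; rewrite mulf_eq0 (negPf pz) => /eqP.
split=> //; apply: j_simple => //.
move: pa; rewrite ri aii mulr1 => p'0.
apply/eqP; move/eqP: qa; rewrite mulf_eq0 => /orP[] // /eqP q'0.
by move/eqP: ajj; rewrite ej p'0 q'0 !scale0r addr0 mxE eq_sym oner_eq0.
Qed.

Lemma NL_dich d : d \in N -> XL d ->
  (root i0 d = alpha i0 /\ root j0 d = alpha j0) \/
  (root i0 d = alpha j0 /\ root j0 d = alpha i0).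
Proof.
move=> dN dX; have [dW _] := NWP dN; have dVN : d^-1%g \in N by rewrite groupV.
have [dVW _] := NWP dVN.
have pV i : inPlane (root i d^-1%g) -> nng (root i d^-1%g).
  move=> iE; case: (root_dich H i dVW) => // np.
  have : nng (- alpha i).
    have -> : - alpha i = - root i d^-1%g *m rho d.
      by rewrite mulNmx -row_mul -(rhoM H) // mulVg (rho1 H) row1.
    exact: (nng_comb ij (inPlaneN iE) np dX).
  by move/nngP/(_ i); rewrite !mxE !eqxx oppr_ge0 ler10.
have pi := pV _ (N_inPlanei dVN); have pj := pV _ (N_inPlanej dVN).
case/andP: dX => qi qj.
by have := @N_monomial 1 d (mulr1 1) dN; rewrite !scale1r; apply.
Qed.

End Dihedral.

(** * Splitting the determinant of a normalizing element along the plane and [Fix W_L] *)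

Lemma mul_split_proj (F : fieldType) n (D P : 'M[F]_n) :
    P *m P = P -> D *m P = P *m D ->
  (1%:M + D *m P) *m (1%:M + D *m (1%:M - P)) = 1%:M + D.
Proof.
move=> PP DP; rewrite mulmxDl mul1mx [D *m P *m (_ + _)]mulmxDr mulmx1.
have -> : D *m P *m (D *m (1%:M - P)) = 0.
  by rewrite mulmxA -(mulmxA D P) -DP -!mulmxA mulmxBr mulmx1 PP subrr !mulmx0.
by rewrite addr0 mulmxBr mulmx1 -addrA subrK.
Qed.

Section NormalizerSign.
Variables (gT : finGroupType) (n : nat) (sv : 'I_n -> gT) (rho : gT -> 'M[algC]_n).
Hypothesis H : coxeter_rep sv rho.
Variables i0 j0 : 'I_n.
Hypothesis ij : i0 != j0.
Local Notation W := <<[set sv i | i : 'I_n]>>%g.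
Local Notation alpha i := (delta_mx 0 i : 'rV[algC]_n).
Local Notation L := [set sv i0; sv j0].
Local Notation WL := <<[set sv i0; sv j0]>>%g.
Local Notation FixL := (Fix rho WL).
Local Notation inPlane := (inPlane i0 j0).
Local Notation PL := (PL sv rho i0 j0).
Local Notation R := <[(sv i0 * sv j0)%g]>%g.
Local Notation N := 'N_W(WL)%g.
Local Notation sW := (WLW (i0 := i0) (j0 := j0)).
Local Notation f := (fun k : 'I_2 => if k == 0 then i0 else j0).

Definition Eb : 'M[algC]_(2, n) := rowsub f 1%:M.
(* On [N_W(W_L)] this is the determinant on the plane of [L] (lemma [dlE]). *)
Definition dl (g : gT) : algC := epsilon rho g * alphaL rho L g.
Definition Mx (g : gT) : 'M[algC]_2 := Eb *m rho g *m Eb^T.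

Lemma row_Eb k : row k Eb = alpha (f k).
Proof. by rewrite /Eb row_rowsub row1. Qed.

Lemma EbT : Eb *m Eb^T = 1%:M.
Proof.
have f_inj : injective f.
  move=> [[|[|//]] ?] [[|[|//]] ?] //= e; apply: val_inj => //=.
  - by case/eqP: ij.
  - by case/eqP: ij.
apply/matrixP => k l; rewrite mxE (bigD1 (f k)) //= big1 ?addr0 => [|i ik].
  by rewrite !mxE eqxx mul1r eq_sym (inj_eq f_inj) eq_sym.
by rewrite !mxE eq_sym (negPf ik) mul0r.
Qed.

Lemma Eb_proj v : inPlane v -> v *m Eb^T *m Eb = v.
Proof.
have h k : alpha (f k) *m Eb^T *m Eb = alpha (f k).
  by rewrite -row_Eb -row_mul EbT row1 -mul_delta_mx_mx -rowE.
have bi := h 0. have bj := h 1.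
by move=> vE; rewrite (inPlane_decomp ij vE) !mulmxDl -!scalemxAl [alpha i0 *m _ *m _]bi [alpha
    j0 *m _ *m _]bj.
Qed.

Lemma Eb_PL : Eb *m PL = 0.
Proof.
apply/row_matrixP => k; rewrite row_mul row_Eb row0.
by case: eqP => _; rewrite (alpha_PL H) ?svi_WL ?svj_WL.
Qed.

Lemma PL_comm g : g \in N -> rho g *m PL = PL *m rho g.
Proof.
move=> gN; have [gW gJ] := NWP gN.
rewrite /PL -scalemxAr -scalemxAl mulmx_sumr mulmx_suml; congr (_ *: _).
rewrite (reindex_inj (conjg_inj g)) /=.
apply: eq_big => u; first exact: gJ.
by rewrite gJ => uL; rewrite -!(rhoM H) ?groupJ ?(sW uL) // conjgE mulKVg.
Qed.

Lemma Mx_Eb g : g \in N -> Eb *m rho g = Mx g *m Eb.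
Proof.
move=> gN; apply/row_matrixP => k; rewrite /Mx !row_mul Eb_proj //.
rewrite row_Eb mul_delta_mx_mx; case: eqP => _; [exact: (N_inPlanei H) | exact: (N_inPlanej H)].
Qed.

Lemma MxM g h : g \in N -> h \in N -> Mx (g * h)%g = Mx g *m Mx h.
Proof.
move=> gN hN; have [gW _] := NWP gN; have [hW _] := NWP hN.
by rewrite {1}/Mx (rhoM H) // mulmxA Mx_Eb // -!(mulmxA (Mx g)).
Qed.

(** The projection [1 - PL] factors through the plane as [K *m Eb] with [Eb *m K = 1], so
    Sylvester's identity rewrites the 2 by 2 determinant as one on [V]. The same device with a basis
    of [Fix W_L] gives [alphaLE]. *)
Lemma det_Mx g : g \in N -> \det (Mx g) = \det (1%:M + (rho g - 1%:M) *m (1%:M - PL)).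
Proof.
move=> gN; pose K := (1%:M - PL) *m Eb^T.
have KE : K *m Eb = 1%:M - PL.
  apply/row_matrixP => k; rewrite !row_mul Eb_proj // !linearB /= row1 -mul_delta_mx_mx.
  exact: sub_PL_inPlane.
have EK : Eb *m K = 1%:M by rewrite mulmxA mulmxBr mulmx1 Eb_PL subr0 EbT.
rewrite -KE mulmxA det_1addMC mulmxA mulmxBr mulmxBl mulmx1 EK addrC subrK.
congr (\det _); rewrite /K mulmxA mulmxBr mulmx1 mulmxBl; apply/esym.
by rewrite -[Eb *m _ *m PL]mulmxA PL_comm // mulmxA Eb_PL !mul0mx subr0.
Qed.

Lemma alphaLE g : g \in N -> alphaL rho L g = \det (1%:M + (rho g - 1%:M) *m PL).
Proof.
move=> gN; rewrite /alphaL /restr; set B := row_base _.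
have BX : (B :=: FixL)%MS := eq_row_base _.
have Bfree : row_free B by apply: row_base_free.
pose K := PL *m pinvmx B.
have BP : B *m PL = B by apply: Fix_PL; rewrite BX.
have KB : K *m B = PL.
  by rewrite mulmxKpV // BX -[PL]mul1mx; apply: PL_Fix.
have BK : B *m K = 1%:M.
  by apply: (row_free_inj Bfree); rewrite -mulmxA KB mul1mx.
set A := B *m _ *m _.
have AB : A *m B = B *m rho g.
  by rewrite mulmxKpV // BX -BP -mulmxA -PL_comm // mulmxA; apply: PL_Fix.
rewrite -KB mulmxA det_1addMC mulmxA mulmxBr mulmxBl mulmx1 BK addrC subrK.
by rewrite -AB -mulmxA BK mulmx1.
Qed.

(** As [PL] commutes with [rho g], the latter is the product of a factor acting only on [Fix W_L]
    and one acting only on the plane. *)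
Lemma epsilonE g : g \in N -> epsilon rho g = alphaL rho L g * \det (Mx g).
Proof.
move=> gN; rewrite alphaLE // det_Mx // -det_mulmx /epsilon; congr (\det _).
have PP : PL *m PL = PL by apply: Fix_PL; rewrite -[PL in (PL <= _)%MS]mul1mx; apply: PL_Fix.
rewrite mul_split_proj //; first by rewrite addrC subrK.
by rewrite mulmxBl mulmxBr PL_comm // mulmx1 mul1mx.
Qed.

End NormalizerSign.

(** * The action of the normalizer on the rotations, and cuspidal elements *)

Lemma det22 (R : comNzRingType) (A : 'M[R]_2) : \det A = A 0 0 * A 1 1 - A 0 1 * A 1 0.
Proof.
rewrite (expand_det_row _ 0) !big_ord_recl big_ord0 addr0 /cofactor !det_mx11 !mxE /=.
rewrite expr0 mul1r expr1 mulN1r mulrN.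
by congr (A _ _ * A _ _ - A _ _ * A _ _); apply: val_inj.
Qed.

Section NormalizerAction.
Variables (gT : finGroupType) (n : nat) (sv : 'I_n -> gT) (rho : gT -> 'M[algC]_n).
Hypothesis H : coxeter_rep sv rho.
Variables i0 j0 : 'I_n.
Hypothesis ij : i0 != j0.
Local Notation W := <<[set sv i | i : 'I_n]>>%g.
Local Notation G := (Gram sv).
Local Notation alpha i := (delta_mx 0 i : 'rV[algC]_n).
Local Notation root i w := (row i (rho w)).
Local Notation L := [set sv i0; sv j0].
Local Notation WL := <<[set sv i0; sv j0]>>%g.
Local Notation FixL := (Fix rho WL).
Local Notation inPlane := (inPlane i0 j0).
Local Notation XL := (XL rho i0 j0).
Local Notation PL := (PL sv rho i0 j0).
Local Notation s := (sv i0).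
Local Notation R := <[(sv i0 * sv j0)%g]>%g.
Local Notation N := 'N_W(WL)%g.
Local Notation sW := (WLW (i0 := i0) (j0 := j0)).
Local Notation f := (fun k : 'I_2 => if k == 0 then i0 else j0).
Local Notation Mx := (Mx rho i0 j0).
Local Notation dl := (dl sv rho i0 j0).

Lemma MxE g k l : Mx g k l = rho g (f k) (f l).
Proof.
rewrite /Mx /Eb -rowsubE.
have -> : (rowsub f 1%:M)^T = colsub f 1%:M :> 'M[algC]_(n, 2).
  by apply/matrixP => a b; rewrite !mxE eq_sym.
by rewrite mulmx_colsub mulmx1 !mxE.
Qed.

Lemma det_MxE g : \det (Mx g) = rho g i0 i0 * rho g j0 j0 - rho g i0 j0 * rho g j0 i0.
Proof. by rewrite det22 !MxE. Qed.

Lemma det_Mx_WL u : u \in WL -> \det (Mx u) = \det (rho u).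
Proof.
move=> uL; rewrite (det_Mx H ij) ?WL_N //; congr (\det _).
rewrite mulmxBl mul1mx mulmxBr mulmx1 (rho_PL H uL).
by rewrite opprB addrCA [1%:M + _]addrC subrK subrK.
Qed.

Lemma rootE i g j : rho g i j = root i g 0 j. Proof. by rewrite mxE. Qed.

Lemma det_Mx_fix d : root i0 d = alpha i0 -> root j0 d = alpha j0 -> \det (Mx d) = 1.
Proof.
move=> ei ej; rewrite det_MxE !rootE ei ej !mxE !eqxx /= (negPf ij).
by rewrite [j0 == i0]eq_sym (negPf ij) mulr1 mulr0 subr0.
Qed.

Lemma det_Mx_swap d : root i0 d = alpha j0 -> root j0 d = alpha i0 -> \det (Mx d) = -1.
Proof.
move=> ei ej; rewrite det_MxE !rootE ei ej !mxE !eqxx /= (negPf ij).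
by rewrite [j0 == i0]eq_sym (negPf ij) mulr1 mulr0 sub0r.
Qed.

(** The alternative is stable under products, so it is checked on rotations, on reflections of
    [W_L], and on dominant elements, which fix or exchange [s] and [t]. *)
Lemma N_conjR g : g \in N ->
  (\det (Mx g) = 1 /\ forall x, x \in R -> (x ^ g = x)%g) \/
  (\det (Mx g) = -1 /\ forall x, x \in R -> (x ^ g = x^-1)%g).
Proof.
pose Q g := (\det (Mx g) = 1 /\ forall x, x \in R -> (x ^ g = x)%g) \/
  (\det (Mx g) = -1 /\ forall x, x \in R -> (x ^ g = x^-1)%g).
have QM g1 g2 : g1 \in N -> g2 \in N -> Q g1 -> Q g2 -> Q (g1 * g2)%g.
  move=> g1N g2N; rewrite /Q (MxM H ij) // det_mulmx.
  case=> -[-> h1]; case=> -[-> h2].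
  - by left; split=> [|x xR]; rewrite ?mulr1 // conjgM h1 // h2.
  - by right; split=> [|x xR]; rewrite ?mul1r // conjgM h1 // h2.
  - by right; split=> [|x xR]; rewrite ?mulr1 // conjgM h1 // h2 // groupV.
  - by left; split=> [|x xR]; rewrite ?mulrNN ?mulr1 // conjgM h1 // h2 ?groupV // invgK.
have QX x d : d \in W -> root i0 d = alpha i0 -> root j0 d = alpha j0 -> x \in R -> (x ^ d = x)%g.
  move=> dW ei ej /cycleP[k ->]; rewrite conjXg; congr (_ ^+ _)%g.
  by rewrite conjMg (root_eq_conj H dW ei) (root_eq_conj H dW ej).
have QS x d : d \in W -> root i0 d = alpha j0 -> root j0 d = alpha i0 -> x \in R -> (x ^ d =
    x^-1)%g.
  move=> dW ei ej /cycleP[k ->]; rewrite conjXg -expgVn; congr (_ ^+ _)%g.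
  by rewrite conjMg (root_eq_conj H dW ei) (root_eq_conj H dW ej) invMg !(svV H).
move=> gN; have [u [d [uL dN dX ->]]] := N_decomp H gN.
apply: QM => //; first exact: WL_N.
  case: (WL_cases H uL) => uR.
    left; rewrite det_Mx_WL // (det_R H uR); split=> // x xR.
    by rewrite conjgE (RC xR uR) mulKg.
  right; rewrite det_Mx_WL //; have uE : u = (s * (s * u))%g by rewrite mulgA (svK H) mul1g.
  rewrite {1}uE (det_sR H uR); split=> // x xR; rewrite uE conjgM (RJs H xR).
  by rewrite conjgE (RC (groupVr xR) uR) mulKg.
have [dW _] := NWP dN; case: (NL_dich H ij dN dX) => -[ei ej].
  by left; rewrite det_Mx_fix //; split=> // x; apply: QX.
by right; rewrite det_Mx_swap //; split=> // x; apply: QS.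
Qed.

Lemma epsilon_sqr g : g \in W -> epsilon rho g * epsilon rho g = 1.
Proof. by move=> gW; rewrite /epsilon (det_rho H gW) -expr2 sqrr_sign. Qed.

Lemma alphaL_sqr g : g \in N -> alphaL rho L g * alphaL rho L g = 1.
Proof.
move=> gN; have [gW _] := NWP gN.
have := epsilon_sqr gW; rewrite (epsilonE H ij gN).
by case: (N_conjR gN) => -[-> _]; rewrite ?mulr1 // !mulrN1 mulrNN.
Qed.

Lemma dlE g : g \in N -> dl g = \det (Mx g).
Proof. by move=> gN; rewrite /dl (epsilonE H ij gN) mulrAC alphaL_sqr // mul1r. Qed.

Lemma dlM g h : g \in N -> h \in N -> dl (g * h)%g = dl g * dl h.
Proof. by move=> gN hN; rewrite !dlE ?groupM // (MxM H ij) // det_mulmx. Qed.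

Lemma dl_WL u : u \in WL -> dl u = \det (rho u).
Proof. by move=> uL; rewrite dlE ?WL_N // det_Mx_WL. Qed.

Lemma dl_conjR g : g \in N ->
  (dl g = 1 /\ forall x, x \in R -> (x ^ g = x)%g) \/
  (dl g = -1 /\ forall x, x \in R -> (x ^ g = x^-1)%g).
Proof. by move=> gN; rewrite dlE //; apply: N_conjR. Qed.

Lemma dl_sqr g : g \in N -> dl g * dl g = 1.
Proof. by move=> gN; case: (dl_conjR gN) => -[-> _]; rewrite ?mulr1 // mulrNN mulr1. Qed.

Lemma R_normJ g x : g \in N -> ((x ^ g)%g \in R) = (x \in R).
Proof.
move=> gN; suff h g' y : g' \in N -> y \in R -> (y ^ g')%g \in R.
  apply/idP/idP => xR; last exact: h.
  by rewrite -(conjgK g x); apply: h; rewrite ?groupV.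
by move=> g'N yR; case: (dl_conjR g'N) => -[_ e]; rewrite e ?groupV.
Qed.

Lemma det_rhoJ u g : u \in W -> g \in W -> \det (rho (u ^ g)%g) = \det (rho u).
Proof.
move=> uW gW; rewrite conjgE !(rhoM H) ?groupM ?groupV // !det_mulmx mulrCA.
by rewrite -det_mulmx -(rhoM H) ?groupV // mulVg (rho1 H) det1 mulr1.
Qed.

Lemma s_conj g : g \in N -> (s * s ^ g)%g \in R.
Proof.
move=> gN; have [gW gJ] := NWP gN.
by rewrite (sR_det H) ?gJ ?svi_WL // det_rhoJ ?sv_gen // (det_rho_sv H).
Qed.

Lemma cuspidalE w : w \in WL -> cuspidal sv rho L w = (w \in R) && (w != 1%g).
Proof.
move=> wL; have wW := sW wL; apply/(cuspidalP H ij)/andP => [[_ h]|[wR w1]].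
  have w1 : w != 1%g.
    apply/negP => /eqP e; have := h (alpha i0) (@inPlane_alphai n i0 j0).
    rewrite e (rho1 H) mulmx1 => /(_ erefl)/rowP/(_ i0); rewrite !mxE !eqxx => /eqP.
    by rewrite oner_eq0.
  split=> //; rewrite (R_det H) //; case: (WL_cases H wL) => [/(det_R H)->//|swR].
  have w2 : (w * w = 1)%g.
    have e : (s * (s * w) = w)%g by rewrite mulgA (svK H) mul1g.
    by have := sRK H swR; rewrite e.
  (* Here [w] is an involution and fixes [v + v w]. A cuspidal one is therefore -1 on the plane,
     whose determinant is 1 and not -1. *)
  have neg v : inPlane v -> v *m rho w = - v.
    move=> vE; apply/eqP; rewrite -addr_eq0; apply/eqP; apply: h.
      by apply: inPlaneD => //; apply: (inPlane_rho H).
    by rewrite mulmxDl -mulmxA -(rhoM H) // w2 (rho1 H) mulmx1 addrC.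
  rewrite -(det_Mx_WL wL) det_MxE !rootE -!mul_delta_mx_mx.
  rewrite !neg; [|exact: inPlane_alphaj|exact: inPlane_alphai].
  by rewrite !mxE !eqxx /= [j0 == i0]eq_sym (negPf ij) oppr0 mul0r subr0 mulrNN mulr1.
split=> // v vE vw.
(* As [sv i] inverts [w], the reflected vector is fixed as well; if it differs from [v], then [w]
   fixes [alpha i]. Determinant 1 makes the other diagonal entry 1, so [w] is dominant and hence
   trivial. *)
have key i j : (i = i0 /\ j = j0) \/ (i = j0 /\ j = i0) -> (v *m G *m (alpha i)^T) 0 0 = 0.
  move=> hij; apply/eqP/contraT => c0; case/negP: w1.
  have iL : sv i \in WL by case: hij => -[-> _]; rewrite ?svi_WL ?svj_WL.
  have ww : (w^-1 ^ sv i = w)%g.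
    case: hij => -[-> _]; first by rewrite (RJs H (groupVr wR)) invgK.
    have := sr H i0 j0 => <-.
    by rewrite conjgM (RJs H (groupVr wR)) invgK conjgE (RC wR) ?cycle_id // mulKg.
  have swE : (sv i * w = w^-1 * sv i)%g by rewrite -[in LHS]ww conjgE (svV H) !mulgA (svK H) mul1g.
  have vwV : v *m rho w^-1%g = v by rewrite -{1}vw -mulmxA (rhoVr H) // mulmx1.
  have ai : root i w = alpha i.
    have : v *m rho (sv i) *m rho w = v *m rho (sv i).
      by rewrite -mulmxA -(rhoM H) ?sv_gen // swE (rhoM H) ?groupV ?sv_gen // mulmxA vwV.
    rewrite (mul_sv H) mulmxBl vw => /addrI/oppr_inj; rewrite -scalemxAl mul_delta_mx_mx.
    by move/scalerI; apply; rewrite mulf_neq0 ?pnatr_eq0.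
  apply/eqP; apply: (XL_triv H (i0 := i0) (j0 := j0)) => //; first by move=> v'; apply: (WL_out H).
  have alpha_nng k : nng (alpha k) by apply/nngP => l; rewrite mxE ler0n.
  have det1 : rho w i i * rho w j j - rho w i j * rho w j i = 1.
    have := det_Mx_WL wL; rewrite (det_R H wR) det_MxE.
    by case: hij => -[-> ->] // <-; rewrite mulrC [in X in _ - X]mulrC.
  have nij : (j == i) = false.
    by case: hij => -[-> ->]; rewrite ?(negPf ij) // eq_sym (negPf ij).
  have rjj : rho w j j = 1.
    by move: det1; rewrite !(rootE i) ai !mxE !eqxx /= nij mul0r mul1r subr0.
  have pj : nng (root j w).
    by case: (root_dich H j wW) => // /nngP/(_ j); rewrite !mxE rjj oppr_ge0 ler10.
  rewrite /XL; case: hij => -[ei ej]; subst i j; rewrite pj ai alpha_nng //.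
have ki := key i0 j0 (or_introl (conj erefl erefl)).
have kj := key j0 i0 (or_intror (conj erefl erefl)).
have fixs i : (v *m G *m (alpha i)^T) 0 0 = 0 -> v *m rho (sv i) = v.
  by move=> e; rewrite (mul_sv H) e mulr0 scale0r subr0.
apply: (fix_inPlane H ij vE); apply/memFix; apply: gen_ind => [|a u aL uL IHu].
  by rewrite (rho1 H) mulmx1.
have aW : a \in W by apply: sW; apply: mem_gen.
by rewrite (rhoM H) ?(sW uL) // mulmxA; case/set2P: aL => ->; rewrite fixs.
Qed.

(** Cuspidality makes [Fix W_L] the full fixed space of [x], so the centralizer preserves it. A
    conjugate of [u] then fixes it pointwise and falls into [W_L] by [Fix_stabilizer]. *)
Lemma cent_R_sub x : x \in R -> x != 1%g -> 'C_W[x]%g \subset N.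
Proof.
move=> xR x1; have xL := R_WL xR.
have /(cuspidalP H ij)[_ cx] : cuspidal sv rho L x by rewrite cuspidalE // xR x1.
have Fx (y : 'rV[algC]_n) : y *m rho x = y -> (y <= FixL)%MS.
  move=> yx; suff /eqP : y - y *m PL = 0.
    by rewrite subr_eq0 => /eqP->; apply: PL_Fix.
  apply: cx; first exact: sub_PL_inPlane.
  by rewrite mulmxBl yx -mulmxA (PL_rho H xL).
suff cent g u : g \in 'C_W[x]%g -> u \in WL -> (u ^ g)%g \in WL.
  apply/subsetP => g gC; have [gW _] := setIP gC; apply/setIP; split=> //.
  by apply/normP/eqP; rewrite eqEcard cardJg leqnn andbT; apply/subsetP => _ /imsetP[u uL ->];
      apply: cent.
move=> /setIP[gW /cent1P gx] uL.
have uW := sW uL; have xW := sW xL.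
apply: (Fix_stabilizer H ij); first by rewrite groupJ.
apply/row_subP => k; rewrite sub_kermx mulmxBr mulmx1 subr_eq0; apply/eqP.
set y := row k FixL; have yF : (y <= FixL)%MS by apply: row_sub.
have ygF : (y *m rho g^-1%g <= FixL)%MS.
  apply: Fx; have yx : y *m rho x = y by move/memFix: yF => ->.
  rewrite -mulmxA -(rhoM H) ?groupV //.
  have -> : (g^-1 * x = x * g^-1)%g by rewrite -[x in LHS](mulgK g) -gx !mulgA mulVg mul1g.
  by rewrite (rhoM H) ?groupV // mulmxA yx.
rewrite conjgE !(rhoM H) ?groupM ?groupV // !mulmxA.
by have /memFix -> := ygF; rewrite // -mulmxA -(rhoM H) ?groupV // mulVg (rho1 H) mulmx1.
Qed.

End NormalizerAction.

(** * Traces on invariant subspaces *)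

Lemma tr_restr_basis m k (X F : 'M[algC]_m) (B : 'M[algC]_(k, m)) (A : 'M[algC]_k) :
  row_free B -> (B :=: X)%MS -> B *m F = A *m B -> \tr (restr X F) = \tr A.
Proof.
move=> Bfree BX BF; rewrite /restr; set Rb := row_base X.
have Rfree : row_free Rb by apply: row_base_free.
have RX : (Rb :=: X)%MS := eq_row_base X.
pose P := Rb *m pinvmx B; pose Q := B *m pinvmx Rb.
have PB : P *m B = Rb by rewrite mulmxKpV // RX BX.
have QR : Q *m Rb = B by rewrite mulmxKpV // RX BX.
have QP : Q *m P = 1%:M by apply: (row_free_inj Bfree); rewrite -mulmxA PB QR mul1mx.
have -> : Rb *m F *m pinvmx Rb = P *m (A *m Q).
  by rewrite -{1}PB -(mulmxA P) BF /Q -!mulmxA.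
by rewrite mxtrace_mulC -mulmxA QP mulmx1.
Qed.

(** The subspace is presented as the image under [B] of the row space of an idempotent [E], where
    [B'] undoes [B], and [P] is the action pulled back along [B]. The trace becomes one on the whole
    source, with no basis of the subspace to choose. *)
Lemma tr_restr_idem m k (X F : 'M[algC]_m) (B : 'M[algC]_(k, m)) (B' : 'M[algC]_(m, k))
    (E P : 'M[algC]_k) :
    E *m E = E -> E *m B *m B' = E -> (E *m B :=: X)%MS ->
    E *m B *m F = E *m P *m B -> E *m P = P *m E ->
  \tr (restr X F) = \tr (E *m P).
Proof.
move=> EE EB' EX EBF EP.
have [q [C [Q [CQ Qfree Cfull]]]] : exists q (C : 'M[algC]_(k, q)) (Q : 'M[algC]_(q, k)),
    [/\ C *m Q = E, row_free Q & row_full C].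
  exists (\rank E), (col_base E), (row_base E).
  by rewrite mulmx_base row_base_free col_base_full.
have QC : Q *m C = 1%:M.
  apply: (row_free_inj Qfree); rewrite mul1mx.
  by apply: (row_full_inj Cfull); rewrite 2!mulmxA CQ -mulmxA CQ EE.
have QE : Q *m E = Q by rewrite -CQ mulmxA QC mul1mx.
have QBB' : Q *m B *m B' = Q by rewrite -{1}QE -!mulmxA (mulmxA E) EB' QE.
rewrite (@tr_restr_basis _ _ _ _ (Q *m B) (Q *m P *m C)).
- by rewrite -mulmxA mxtrace_mulC -mulmxA CQ EP.
- rewrite /row_free eqn_leq rank_leq_row /=.
  by rewrite -{1}(eqP Qfree) -{1}QBB' mxrankM_maxl.
- apply: eqmx_trans EX; apply/eqmxP/andP; split.
    by rewrite -[Q in (Q *m B <= _)%MS]QE -mulmxA submxMl.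
  by rewrite -CQ -mulmxA submxMl.
- have -> : Q *m B *m F = Q *m (E *m B *m F) by rewrite !mulmxA QE.
  have -> : Q *m P *m C *m (Q *m B) = Q *m (P *m E) *m B by rewrite -CQ !mulmxA.
  by rewrite EBF -EP !mulmxA.
Qed.

(** [D] embeds the quotient [Y / I] and intertwines [F] with [F']. In a basis of [I] completed by
    lifts of a basis of [Y *m D], the action is block triangular. *)
Lemma tr_restr_quot m k (Y I F : 'M[algC]_m) (D : 'M[algC]_(m, k)) (F' : 'M[algC]_k) :
    (I <= Y)%MS -> (Y *m F <= Y)%MS -> (I *m F <= I)%MS -> I *m D = 0 ->
    (forall v : 'rV_m, (v <= Y)%MS -> v *m D = 0 -> (v <= I)%MS) ->
    Y *m F *m D = Y *m D *m F' ->
  \tr (restr Y F) - \tr (restr I F) = \tr (restr <<Y *m D>>%MS F').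
Proof.
move=> IY YF IF ID kerD YFD.
set B1 := row_base I; set Z := row_base (Y *m D).
have B1I : (B1 :=: I)%MS := eq_row_base I.
have ZY : (Z :=: Y *m D)%MS := eq_row_base _.
have kerD' p (V : 'M[algC]_(p, m)) : (V <= Y)%MS -> V *m D = 0 -> (V <= I)%MS.
  move=> VY VD; apply/row_subP => i; apply: kerD; first exact: submx_trans (row_sub _ _) VY.
  by rewrite -row_mul VD row0.
have /submxP[K ZK] : (Z <= Y *m D)%MS by rewrite ZY.
pose C := K *m Y; have CY : (C <= Y)%MS by apply: submxMl.
have CD : C *m D = Z by rewrite -mulmxA -ZK.
have Zfree : row_free Z by apply: row_base_free.
have B1free : row_free B1 by apply: row_base_free.
have /submxP[A1 eA1] : (B1 *m F <= B1)%MS.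
  by rewrite B1I; apply: submx_trans IF; rewrite submxMr // B1I.
have /submxP[A2 eA2] : (Z *m F' <= Z)%MS.
  have -> : Z *m F' = K *m (Y *m F *m D) by rewrite YFD [in LHS]ZK !mulmxA.
  by rewrite ZY mulmx_sub // submxMr.
have B1D : B1 *m D = 0.
  have /submxP[T ->] : (B1 <= I)%MS by rewrite B1I.
  by rewrite -mulmxA ID mulmx0.
have /submxP[A3 eA3] : (C *m F - A2 *m C <= B1)%MS.
  rewrite B1I; apply: kerD'.
    apply: addmx_sub; last by rewrite eqmx_opp mulmx_sub.
    by apply: submx_trans YF; apply: submxMr.
  rewrite mulmxBl -[A2 *m C *m D]mulmxA CD -eA2 -CD /C -!mulmxA.
  by rewrite (mulmxA Y F) YFD -!mulmxA subrr.
rewrite (@tr_restr_basis _ _ Y F (col_mx B1 C) (block_mx A1 0 A3 A2)).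
- rewrite mxtrace_block (@tr_restr_basis _ _ I F B1 A1) // addrAC subrr add0r.
  by apply/esym; apply: (@tr_restr_basis _ _ _ _ Z) => //; rewrite ?genmxE; apply: eqmx_trans ZY
      (eqmx_sym (genmxE _)).
- apply: inj_row_free => v; rewrite -[v]hsubmxK mul_row_col => e.
  have v2 : rsubmx v = 0.
    apply: (row_free_inj Zfree); rewrite mul0mx -CD.
    have := congr1 (mulmx^~ D) e.
    by rewrite mulmxDl -mulmxA B1D mulmx0 add0r mul0mx mulmxA.
  have v1 : lsubmx v = 0.
    by apply: (row_free_inj B1free); rewrite mul0mx; move: e; rewrite v2 mul0mx addr0.
  by rewrite v1 v2 row_mx0.
- apply/eqmxP/andP; split.
    by rewrite col_mx_sub CY B1I IY.
  apply/row_subP => i; set v := row i Y.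
  have /submxP[w vw] : (v *m D <= Z)%MS by rewrite ZY submxMr ?row_sub.
  rewrite -[v](subrK (w *m C)) addmx_sub //.
    apply: submx_trans (_ : (_ <= B1)%MS) _; last by rewrite -addsmxE addsmxSl.
    rewrite B1I; apply: kerD; last by rewrite mulmxBl vw -mulmxA CD subrr.
    by rewrite addmx_sub ?row_sub ?eqmx_opp ?mulmx_sub.
  by apply: submx_trans (submxMl _ _) _; rewrite -addsmxE addsmxSr.
- by rewrite mul_col_mx mul_block_col mul0mx addr0 eA1 -eA3 subrK.
Qed.

(** * Indicator bases *)

Section IndicatorBasis.
Variable T : finType.
Local Notation bas x := (delta_mx 0 (enum_rank x) : 'rV[algC]_#|T|).

Lemma bas_sum k (A : pred T) (h : T -> 'rV[algC]_k) (x : T) :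
  bas x *m (\sum_(y | A y) (bas y)^T *m h y) = if A x then h x else 0.
Proof.
have bb y : bas x *m ((bas y)^T *m h y) = (x == y)%:R *: h y.
  rewrite mulmxA trmx_delta mul_delta_mx_cond (inj_eq enum_rank_inj).
  case: eqP => _; last by rewrite mulr0n mul0mx scale0r.
  rewrite mulr1n scale1r.
  have -> : delta_mx 0 0 = 1%:M :> 'M[algC]_1 by apply/matrixP => a b; rewrite !ord1 !mxE.
  by rewrite mul1mx.
rewrite mulmx_sumr; case: ifP => Ax.
  rewrite (bigD1 x) //= big1 ?addr0 => [|y /andP[_ yx]]; first by rewrite bb eqxx scale1r.
  by rewrite bb eq_sym (negPf yx) scale0r.
rewrite big1 // => y Ay; rewrite bb; case: eqP => [e|_]; last by rewrite scale0r.
by rewrite e Ay in Ax.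
Qed.

Lemma bas_ext k (A B : 'M[algC]_(#|T|, k)) :
  (forall x, bas x *m A = bas x *m B) -> A = B.
Proof.
move=> h; apply/row_matrixP => i; rewrite -(enum_valK i).
by have := h (enum_val i); rewrite -!rowE.
Qed.

Lemma bas_sub k p (A : 'M[algC]_(#|T|, k)) (Z : 'M[algC]_(p, k)) :
  (forall x, (bas x *m A <= Z)%MS) -> (A <= Z)%MS.
Proof.
move=> h; apply/row_subP => i; rewrite -(enum_valK i).
by have := h (enum_val i); rewrite -!rowE.
Qed.

Lemma bas_tr (x y : T) : \tr ((bas x)^T *m bas y) = (x == y)%:R.
Proof.
rewrite mxtrace_mulC trmx_delta mul_delta_mx_cond (inj_eq enum_rank_inj) eq_sym.
case: eqP => _; last by rewrite mulr0n mxtrace0.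
by rewrite mulr1n /mxtrace big_ord1 mxE.
Qed.

End IndicatorBasis.

Section GroupVectors.
Variable gT : finGroupType.
Implicit Types (a b c g h w x y : gT).

Lemma gvec_sum k (A : pred gT) (f : gT -> 'rV[algC]_k) x :
  gvec x *m (\sum_(y | A y) (gvec y)^T *m f y) = if A x then f x else 0.
Proof. exact: bas_sum. Qed.

Lemma gvec_ext k (A B : 'M[algC]_(gN gT, k)) :
  (forall x, gvec x *m A = gvec x *m B) -> A = B.
Proof. exact: bas_ext. Qed.

Lemma gvec_sub k p (A : 'M[algC]_(gN gT, k)) (Z : 'M[algC]_(p, k)) :
  (forall x, (gvec x *m A <= Z)%MS) -> (A <= Z)%MS.
Proof. exact: bas_sub. Qed.

Lemma gvec_tr x y : \tr ((gvec x)^T *m gvec y) = (x == y)%:R.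
Proof. exact: bas_tr. Qed.

Lemma gvec_rmul x h : gvec x *m rmul h = gvec (x * h)%g.
Proof. exact: (gvec_sum predT (fun y => gvec (y * h)%g)). Qed.

Lemma ebas_sum k (A : pred {set gT}) (f : {set gT} -> 'rV[algC]_k) R :
  ebas R *m (\sum_(U | A U) (ebas U)^T *m f U) = if A R then f R else 0.
Proof. exact: bas_sum. Qed.

Lemma ebas_osact (R : {set gT}) (w : gT) : ebas R *m osact w = wedge [seq (t ^ w)%g | t <- enum R].
Proof. exact: (ebas_sum predT). Qed.

Definition cjmx (w : gT) : 'M[algC]_(gN gT) := \sum_(y : gT) (gvec y)^T *m gvec (y ^ w)%g.

Lemma gvec_cjmx x w : gvec x *m cjmx w = gvec (x ^ w)%g.
Proof. exact: (gvec_sum predT (fun y => gvec (y ^ w)%g)). Qed.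

(** * Exterior products of two generators *)

Local Notation rk := (@enum_rank gT).

(** The sign in [wedge] is counted against [enum_rank], whereas [osact], [rel] and [EX] list a set
    by [enum]; this reconciles the two orders. *)
Lemma enum_sorted (A : {set gT}) : sorted (fun x y => rk x < rk y)%N (enum A).
Proof.
rewrite /enum_mem; apply: sorted_filter; first by move=> y x z; apply: ltn_trans.
have : sorted ltn (map (fun x => val (rk x)) (enum gT)).
  suff -> : map (fun x => val (rk x)) (enum gT) = iota 0 #|gT| by apply: iota_ltn_sorted.
  rewrite -val_enum_ord (map_comp val rk); congr map.
  apply: (@eq_from_nth _ (rk 1%g)); first by rewrite size_map -cardE size_enum_ord.
  move=> i; rewrite size_map -cardE => lt; rewrite (nth_map 1%g) -?cardE //.
  apply: val_inj; rewrite /= nth_enum_ord //.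
  have := enum_valK (Ordinal lt); rewrite (enum_val_nth 1%g) => -> //.
by rewrite sorted_map enumT.
Qed.

Lemma enum_pair a b : (rk a < rk b)%N -> enum [set a; b] = [:: a; b].
Proof.
move=> lt; have tr : transitive (fun x y : gT => rk x < rk y)%N by move=> y x z; apply: ltn_trans.
apply: (irr_sorted_eq tr); [by move=> x; rewrite /= ltnn | exact: enum_sorted | by rewrite /= lt |].
by move=> x; rewrite mem_enum !inE.
Qed.

Lemma inversions2 a b : inversions [:: a; b] = (rk b < rk a)%N.
Proof.
rewrite /inversions /= !big_ord_recl big_ord0 !big_mkcond !big_ord_recl !big_ord0 /=.
by rewrite [X in (_ + (X + _))%N]big_mkcond !big_ord_recl big_ord0 /= !addn0.
Qed.

Lemma wedge_diag a : wedge [:: a; a] = 0.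
Proof. by rewrite /wedge /= inE eqxx. Qed.

Lemma wedge_lt a b : (rk a < rk b)%N -> wedge [:: a; b] = ebas [set a; b].
Proof.
move=> lt; have ab : a != b by apply/negP => /eqP e; rewrite e ltnn in lt.
rewrite /wedge /= inE ab inversions2 ltnNge (ltnW lt) /= expr0 scale1r.
by congr ebas; apply/setP => x; rewrite !inE.
Qed.

Lemma wedgeN a b : wedge [:: b; a] = - wedge [:: a; b].
Proof.
have [->|ab] := eqVneq a b; first by rewrite wedge_diag oppr0.
rewrite /wedge /= !inE eq_sym ab !inversions2.
have -> : [set x in [:: b; a]] = [set x in [:: a; b]] by apply/setP => x; rewrite !inE orbC.
have : val (rk a) != val (rk b) by rewrite (inj_eq val_inj) (inj_eq enum_rank_inj).
by case: ltngtP => //= _ _; rewrite ?expr0 ?expr1 ?scale1r ?scaleN1r ?opprK.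
Qed.

Lemma wedge_wlog (P : gT -> gT -> Prop) :
    (forall a, P a a) -> (forall a b, P a b -> P b a) ->
    (forall a b, (rk a < rk b)%N -> P a b) ->
  forall a b, P a b.
Proof.
move=> P0 PS Plt a b; have [->//|ab] := eqVneq a b.
have : val (rk a) != val (rk b) by rewrite (inj_eq val_inj) (inj_eq enum_rank_inj).
by rewrite neq_ltn => /orP[] lt; [apply: Plt | apply/PS/Plt].
Qed.

Lemma wedge_osact a b w : wedge [:: a; b] *m osact w = wedge [:: (a ^ w)%g; (b ^ w)%g].
Proof.
move: a b; apply: wedge_wlog => [a|a b e|a b lt]; first by rewrite !wedge_diag mul0mx.
  by rewrite wedgeN mulNmx e -wedgeN.
by rewrite wedge_lt // ebas_osact enum_pair.
Qed.

(** The boundary of [e_a e_b e_c], that is, the Orlik-Solomon relation of a dependent triple. *)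
Definition r3 a b c := wedge [:: b; c] - wedge [:: a; c] + wedge [:: a; b].

Lemma r3_osact a b c w : r3 a b c *m osact w = r3 (a ^ w)%g (b ^ w)%g (c ^ w)%g.
Proof. by rewrite /r3 mulmxDl mulmxBl !wedge_osact. Qed.

Lemma r3_swap12 a b c : r3 b a c = - r3 a b c.
Proof. by rewrite /r3 (wedgeN a b) !opprD opprK [in RHS]addrAC [in RHS]addrC addrA addrAC. Qed.

Lemma r3_swap23 a b c : r3 a c b = - r3 a b c.
Proof.
rewrite /r3 (wedgeN b c) !opprD opprK -!addrA; congr (_ + _); exact: addrC.
Qed.

Lemma rel_set0 (R : {set gT}) a b c : enum R = [:: a; b; c] -> Defs.rel set0 R = r3 a b c.
Proof.
move=> eR; have cR : #|R| = 3%N by rewrite cardE eR.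
rewrite /Defs.rel cR !big_ord_recl big_ord0 /= enum_set0 eR /= expr0 scale1r expr1 scaleN1r.
by rewrite -signr_odd expr0 scale1r addr0 addrA.
Qed.

(** [enum] lists the triple in an unknown order, which changes [r3] at most by a sign and so does
    not affect its span. *)
Lemma rel_sub p (Z : 'M[algC]_(p, eN gT)) a b c : uniq [:: a; b; c] ->
  (Defs.rel set0 [set a; b; c] <= Z)%MS = (r3 a b c <= Z)%MS.
Proof.
move=> u; have u' := u; move: u'; rewrite /= !inE !negb_or => /andP[/andP[ab ac] /andP[bc _]].
have : perm_eq (enum [set a; b; c]) [:: a; b; c].
  apply: uniq_perm => //; first exact: enum_uniq.
  by move=> x; rewrite mem_enum !inE orbA.
case e: (enum _) => [|x [|y [|z [|? ?]]]] pe; have := perm_size pe => //= _.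
rewrite (rel_set0 e).
have u2 : uniq [:: x; y; z] by rewrite (perm_uniq pe).
have : [/\ x \in [:: a; b; c], y \in [:: a; b; c] & z \in [:: a; b; c]].
  by rewrite -!(perm_mem pe) !inE !eqxx !orbT.
move: u2; rewrite /= !inE !negb_or => /andP[/andP[xy xz] /andP[yz _]].
have sg (A B : 'rV[algC]_(eN gT)) : A = - B -> (A <= Z)%MS = (B <= Z)%MS by move=> ->; rewrite
    eqmx_opp.
case=> /or3P[]/eqP ex /or3P[]/eqP ey /or3P[]/eqP ez; subst x y z; rewrite ?eqxx // in xy xz yz *.
- by apply: sg; apply: r3_swap23.
- by apply: sg; apply: r3_swap12.
- by rewrite r3_swap23 r3_swap12 opprK.
- by rewrite r3_swap12 r3_swap23 opprK.
- by rewrite r3_swap12 r3_swap23 r3_swap12 !opprK eqmx_opp.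
Qed.

End GroupVectors.

(** * The component of the Orlik-Solomon algebra at [Fix W_L] *)

Section OrlikSolomonComponent.
Variables (gT : finGroupType) (n : nat) (sv : 'I_n -> gT) (rho : gT -> 'M[algC]_n).
Hypothesis H : coxeter_rep sv rho.
Variables i0 j0 : 'I_n.
Hypothesis ij : i0 != j0.
Local Notation W := <<[set sv i | i : 'I_n]>>%g.
Local Notation G := (Gram sv).
Local Notation WL := <<[set sv i0; sv j0]>>%g.
Local Notation FixL := (Fix rho WL).
Local Notation s := (sv i0).
Local Notation t := (sv j0).
Local Notation R := <[(sv i0 * sv j0)%g]>%g.
Local Notation N := 'N_W(WL)%g.
Local Notation sW := (WLW (i0 := i0) (j0 := j0)).
Local Notation T := (Tset [set sv i | i : 'I_n]).

(** The reflections of [W_L], encoded as the coset [s R]. *)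
Definition TL : {set gT} := [set a | (sv i0 * a)%g \in R].

Lemma TLE a : a \in TL = ((s * a)%g \in R). Proof. by rewrite inE. Qed.

Lemma TL_WL a : a \in TL -> a \in WL.
Proof.
by rewrite TLE => aR; have := sR_WL aR; rewrite mulgA (svK H) mul1g.
Qed.

Lemma TL_T a : a \in TL -> a \in T.
Proof. by rewrite TLE => /(sR_Tset H); rewrite mulgA (svK H) mul1g. Qed.

Lemma T_TL a : a \in T -> a \in WL -> a \in TL.
Proof. by move=> aT aL; rewrite TLE (Tset_WL H). Qed.

Lemma TLJ a g : g \in N -> a \in TL -> (a ^ g)%g \in TL.
Proof.
move=> gN aTL; have [gW gJ] := NWP gN.
by apply: T_TL; [apply: TsetJ; first exact: TL_T | rewrite gJ; apply: TL_WL].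
Qed.

Lemma capH_sub1 m (A : 'M[algC]_(m, n)) (Q : {set gT}) a : a \in Q ->
  (A <= capH rho Q)%MS -> (A <= kermx (rho a - 1%:M))%MS.
Proof. by move=> aQ; rewrite sub_capH => /forall_inP/(_ a aQ). Qed.

Lemma rank_capH2 a b : a \in T -> b \in T -> a != b ->
  \rank (capH rho [set a; b]) = (n - 2)%N.
Proof.
move=> aT bT ab; have [u ru nu] := Tset_rfl H aT; have [v rv nv] := Tset_rfl H bT.
rewrite -(Tset_free H aT bT ab ru rv nu nv) -(rank_ker_col H).
suff /eqmxP/eqmx_rank -> : (capH rho [set a; b] :=: kermx (G *m (col_mx u v)^T))%MS by [].
apply: eqmx_of_sub => C.
rewrite sub_kermx tr_col_mx mul_mx_row mul_mx_row row_mx_eq0 !mulmxA.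
rewrite -!sub_ker_rfl // -ru -rv sub_capH.
apply/forall_inP/andP => [h|[h1 h2] c /set2P[]->//].
by split; apply: h; rewrite !inE eqxx ?orbT.
Qed.

Lemma rank_capH1 a : a \in T -> \rank (capH rho [set a]) = (n - 1)%N.
Proof.
move=> aT; have [u ru nu] := Tset_rfl H aT.
have u1 : \rank u = 1%N.
  rewrite rank_rV; case: eqP nu => // -> /matrixP/(_ 0 0).
  by rewrite !mul0mx !mxE => /eqP; rewrite eq_sym oner_eq0.
rewrite -u1 -(rank_ker_col H).
suff /eqmxP/eqmx_rank -> : (capH rho [set a] :=: kermx (G *m u^T))%MS by [].
apply: eqmx_of_sub => C; rewrite sub_kermx mulmxA -sub_ker_rfl // -ru sub_capH.
by apply/forall_inP/idP => [h|h c /set1P->//]; apply: h; rewrite inE.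
Qed.

Lemma n_gt1 : (1 < n)%N.
Proof.
case: n i0 j0 ij => [[]//|[|//]] [i hi] [j hj] /eqP[].
by apply: val_inj => /=; move: hi hj; rewrite !ltnS !leqn0 => /eqP-> /eqP->.
Qed.

Lemma not_dependent (Q : {set gT}) : Q \subset T -> (#|Q| <= 2)%N -> dependent rho Q = false.
Proof.
move=> QT Q2; rewrite /dependent; case c: #|Q| Q2 => [|[|[|//]]] _ //.
  move/eqP: c => /cards1P[a e]; move: QT; rewrite e sub1set => aT.
  by rewrite rank_capH1 // subKn // ltnW ?n_gt1.
move/eqP: c => /cards2P[a [b [ab e]]]; move: QT; rewrite e subUset !sub1set => /andP[aT bT].
by rewrite rank_capH2 // subKn ?n_gt1.
Qed.

Lemma FixL_capH2 : (FixL :=: capH rho [set s; t])%MS.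
Proof.
apply: eqmx_of_sub => C; apply/idP/idP => [/memFix h|].
  rewrite sub_capH; apply/forall_inP => a aL.
  by rewrite sub_kermx mulmxBr mulmx1 h ?subrr ?mem_gen.
rewrite sub_capH => /forall_inP h; apply/memFix; apply: gen_ind => [|a u aL uL IHu].
  by rewrite (rho1 H) mulmx1.
have aW : a \in W by apply: sW; apply: mem_gen.
rewrite (rhoM H) ?(sW uL) // mulmxA; have := h a aL.
by rewrite sub_kermx mulmxBr mulmx1 subr_eq0 => /eqP->.
Qed.

Lemma st_neq : s != t. Proof. by rewrite (inj_eq (cox_inj H)). Qed.

Lemma s_T i : sv i \in T.
Proof. by apply/imset2P; exists (sv i) 1%g; rewrite ?mem_sv ?group1 ?conjg1. Qed.

Lemma rank_FixL : \rank FixL = (n - 2)%N.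
Proof. by rewrite FixL_capH2 rank_capH2 ?s_T ?st_neq. Qed.

Lemma capH_TL (Q : {set gT}) : Q \subset TL -> (FixL <= capH rho Q)%MS.
Proof.
move=> QTL; rewrite sub_capH; apply/forall_inP => a aQ.
have aL := TL_WL (subsetP QTL a aQ); rewrite sub_kermx mulmxBr mulmx1 subr_eq0.
by apply/eqP; have /memFix -> := submx_refl FixL.
Qed.

(** If the intersection is [Fix W_L], both reflections fix it pointwise and lie in [W_L]; conversely
    inclusion is an equality, since both sides have codimension 2. *)
Lemma capH2_Fix a b : a \in T -> b \in T -> a != b ->
  (capH rho [set a; b] == FixL)%MS = (a \in TL) && (b \in TL).
Proof.
move=> aT bT ab; apply/idP/andP => [/andP[_ h]|[aTL bTL]].
  have in_TL c : c \in [set a; b] -> c \in T -> c \in TL.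
    move=> cab cT; apply: T_TL => //; apply: (Fix_stabilizer H ij); first exact: TsetW.
    exact: capH_sub1 h.
  by split; apply: in_TL; rewrite ?inE ?eqxx ?orbT.
have sub : (FixL <= capH rho [set a; b])%MS.
  by apply: capH_TL; rewrite subUset !sub1set aTL bTL.
by rewrite andbC -(mxrank_leqif_eq sub).2 rank_FixL rank_capH2 // !eqxx.
Qed.

Local Notation EX2 := (EX rho [set sv i | i : 'I_n] 2 FixL).
Local Notation I2 := (OSideal rho [set sv i | i : 'I_n] 2).

Lemma EX_subP p (Z : 'M[algC]_(p, eN gT)) :
  (EX2 <= Z)%MS <-> (forall a b, a \in TL -> b \in TL -> (wedge [:: a; b] <= Z)%MS).
Proof.
split=> [/sumsmx_subP h|h].
  move=> a b; move: a b; apply: wedge_wlog => [a _ _|a b e bT aT|a b lt aTL bTL].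
  - by rewrite wedge_diag sub0mx.
  - by rewrite wedgeN eqmx_opp e.
  have ab : a != b by apply/negP => /eqP e; rewrite e ltnn in lt.
  have := h [set a; b]; rewrite powersetE subUset !sub1set !TL_T // cards2 ab /=.
  by rewrite capH2_Fix ?TL_T // aTL bTL => /(_ isT); rewrite genmxE enum_pair.
apply/sumsmx_subP => Q /andP[]; rewrite powersetE => QT /andP[/cards2P[a [b [ab e]]]]; subst Q.
move: QT; rewrite subUset !sub1set => /andP[aT bT]; rewrite capH2_Fix // => /andP[aTL bTL].
rewrite genmxE; have : perm_eq (enum [set a; b]) [:: a; b].
  apply: uniq_perm; [exact: enum_uniq | by rewrite /= inE ab | by move=> x; rewrite mem_enum !inE].
case e: (enum _) => [|x [|y [|? ?]]] pe; have := perm_size pe => //= _.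
have xE c : c \in [:: x; y] -> c \in TL by rewrite (perm_mem pe) 2!in_cons in_nil orbF =>
    /orP[]/eqP->.
by apply: h; apply: xE; rewrite !inE eqxx ?orbT.
Qed.

(** In degree 2 the generators satisfy [#|U| + #|R| = 3], and a dependent set has at least three
    elements, so [U] is empty. *)
Lemma OSideal_subP p (Z : 'M[algC]_(p, eN gT)) :
  (I2 <= Z)%MS <-> (forall a b c, uniq [:: a; b; c] -> a \in T -> b \in T -> c \in T ->
     dependent rho [set a; b; c] -> (r3 a b c <= Z)%MS).
Proof.
split=> [/sumsmx_subP h a b c u aT bT cT dep|h].
  have := h set0; rewrite powersetE sub0set => /(_ isT)/sumsmx_subP/(_ [set a; b; c]).
  rewrite powersetE !subUset !sub1set aT bT cT dep cards0 add0n /=.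
  have -> : #|[set a; b; c]| == 3%N.
    move: u; rewrite /= !inE !negb_or => /andP[/andP[ab ac] /andP[bc _]].
    by rewrite setUC cardsU1 !inE cards2 ab (eq_sym c) (eq_sym c) (negPf ac) (negPf bc).
  by move=> /(_ isT); rewrite genmxE rel_sub.
apply/sumsmx_subP => U; rewrite powersetE => UT; apply/sumsmx_subP => Q /andP[].
rewrite powersetE => QT /andP[dep /eqP cUQ]; rewrite genmxE.
have Q3 : #|Q| = 3%N.
  apply/eqP; rewrite eqn_leq -{1}cUQ leq_addl /=.
  rewrite ltnNge; apply/negP => /(not_dependent QT); by rewrite dep.
have U0 : U = set0.
  by apply/eqP; rewrite -cards_eq0 -(eqn_add2r 3) -{1}Q3 cUQ.
rewrite U0; have := enum_uniq (mem Q); have := cardE Q; rewrite Q3.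
case e: (enum Q) => [|a [|b [|c [|? ?]]]] //= _ u.
have QE : Q = [set a; b; c] by apply/setP => x; rewrite -mem_enum e !inE orbA.
rewrite (rel_set0 e); rewrite QE !subUset !sub1set in QT dep; case/andP: QT => /andP[aT bT] cT.
exact: h.
Qed.

End OrlikSolomonComponent.

(** * The trace on the component at [Fix W_L] *)

Section OrlikSolomonTrace.
Variables (gT : finGroupType) (n : nat) (sv : 'I_n -> gT) (rho : gT -> 'M[algC]_n).
Hypothesis H : coxeter_rep sv rho.
Variables i0 j0 : 'I_n.
Hypothesis ij : i0 != j0.
Local Notation S := [set sv i | i : 'I_n].
Local Notation W := <<[set sv i | i : 'I_n]>>%g.
Local Notation L := [set sv i0; sv j0].
Local Notation WL := <<[set sv i0; sv j0]>>%g.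
Local Notation FixL := (Fix rho WL).
Local Notation s := (sv i0).
Local Notation R := <[(sv i0 * sv j0)%g]>%g.
Local Notation N := 'N_W(WL)%g.
Local Notation T := (Tset [set sv i | i : 'I_n]).
Local Notation TL := (TL sv i0 j0).
Local Notation EX2 := (EX rho [set sv i | i : 'I_n] 2 FixL).
Local Notation I2 := (OSideal rho [set sv i | i : 'I_n] 2).
Local Notation Y2 := (EX2 + I2)%MS.

(* [a_u a_v |-> v - u] on products of reflections of [W_L], and [0] on the other
   products, so that the relations of the other flats are killed. *)
Definition dmx : 'M[algC]_(eN gT, gN gT) :=
  \sum_(Q : {set gT} | (Q \subset TL) && (#|Q| == 2%N))
    (ebas Q)^T *m (gvec (nth 1%g (enum Q) 1) - gvec (nth 1%g (enum Q) 0)).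

Lemma wedge_dmx a b : wedge [:: a; b] *m dmx =
  if (a \in TL) && (b \in TL) then gvec b - gvec a else 0.
Proof.
move: a b; apply: wedge_wlog => [a|a b e|a b lt].
- by rewrite wedge_diag mul0mx subrr; case: ifP.
- by rewrite wedgeN mulNmx e andbC; case: ifP; rewrite ?oppr0 // opprB.
have ab : a != b by apply/negP => /eqP e; rewrite e ltnn in lt.
by rewrite wedge_lt // ebas_sum subUset !sub1set cards2 ab andbT enum_pair.
Qed.

(** If at most one of the three reflections lies in [W_L], each term is killed. If two do,
    dependence makes the third fix [Fix W_L] pointwise, so it lies in [W_L] too and the three
    differences cancel. *)
Lemma OSideal_dmx : I2 *m dmx = 0.
Proof.
apply/eqP; rewrite -sub_kermx; apply/(OSideal_subP H ij) => a b c u aT bT cT dep.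
rewrite sub_kermx /r3 mulmxDl mulmxBl !wedge_dmx.
have two x y z : x \in [set a; b; c] -> y \in [set a; b; c] -> x != y -> z \in [set a; b; c] ->
    x \in TL -> y \in TL -> z \in TL.
  move=> xQ yQ xy zQ xTL yTL.
  have inT w : w \in [set a; b; c] -> w \in T by rewrite !inE -orbA => /or3P[]/eqP->.
  apply: (T_TL H (inT z zQ)); apply: (Fix_stabilizer H ij); first exact: TsetW (inT z zQ).
  have := capH2_Fix H ij (inT x xQ) (inT y yQ) xy; rewrite xTL yTL => /andP[le _].
  have sub : (capH rho [set a; b; c] <= capH rho [set x; y])%MS.
    rewrite sub_capH; apply/forall_inP => w wxy; apply: capH_sub1 (submx_refl _).
    by case/set2P: wxy => ->.
  have c3 : #|[set a; b; c]| = 3%N.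
    move: u; rewrite /= !inE !negb_or => /andP[/andP[ab ac] /andP[bc _]].
    by rewrite setUC cardsU1 !inE cards2 ab (eq_sym c) (eq_sym c) (negPf ac) (negPf bc).
  have rk : (\rank (capH rho [set x; y]) <= \rank (capH rho [set a; b; c]))%N.
    rewrite (rank_capH2 H) ?inT //; move: dep; rewrite /dependent c3.
    by rewrite ltnS !leq_subLR addnC.
  have eq := (mxrank_leqif_sup sub).2; rewrite eqn_leq mxrankS //= rk in eq.
  apply: submx_trans (_ : (_ <= capH rho [set x; y])%MS) _.
    by apply: capH_TL; rewrite ?subUset ?sub1set ?xTL ?yTL.
  by apply: submx_trans (esym eq) _; apply: capH_sub1 (submx_refl _).
have /and3P[ab ac bc] : [&& a != b, a != c & b != c].
  by move: u; rewrite /= !inE negb_or andbT andbA.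
have ia : a \in [set a; b; c] by rewrite !inE eqxx.
have ib : b \in [set a; b; c] by rewrite !inE eqxx orbT.
have ic : c \in [set a; b; c] by rewrite !inE eqxx orbT.
case: (boolP (a \in TL)) => aTL; case: (boolP (b \in TL)) => bTL; case: (boolP (c \in TL)) => cTL;
  rewrite /= ?subr0 ?addr0 ?eqxx //.
- by move: (gvec a) (gvec b) (gvec c) => x y z; apply/eqP/rowP => i; rewrite !mxE; ring.
- by rewrite (two a b c) in cTL.
- by rewrite (two a c b) in bTL.
- by rewrite (two b c a) in aTL.
Qed.

Lemma EX_p : (n - \rank FixL)%N = 2%N.
Proof. by rewrite (rank_FixL H ij) subKn ?(n_gt1 ij). Qed.

Lemma osact_EX g : g \in N -> (EX2 *m osact g <= EX2)%MS.
Proof.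
move=> gN; rewrite submxE -mulmxA -sub_kermx; apply/(EX_subP H ij) => a b aTL bTL.
rewrite sub_kermx mulmxA -submxE wedge_osact.
by move/(EX_subP H ij): (submx_refl EX2); apply; apply: (TLJ H).
Qed.

Lemma capHJ (Q : {set gT}) g : g \in W -> Q \subset T ->
  \rank (capH rho [set (a ^ g)%g | a in Q]) = \rank (capH rho Q).
Proof.
move=> gW QT; suff -> : \rank (capH rho [set (a ^ g)%g | a in Q]) = \rank (capH rho Q *m rho g).
  by rewrite mxrankMfree // row_free_unit (rho_unit H).
suff e : (capH rho [set (a ^ g)%g | a in Q] :=: capH rho Q *m rho g)%MS by rewrite e.
have gU := rho_unit H gW.
have QW a : a \in Q -> a \in W by move=> aQ; apply: TsetW; apply: (subsetP QT).
apply: eqmx_of_sub => C; rewrite -[C in RHS](mulmxKV gU) submxMfree ?row_free_unit //.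
rewrite !sub_capH; apply/forall_inP/forall_inP => h a aQ.
  have aW := QW a aQ; have := h (a ^ g)%g (imset_f _ aQ).
  rewrite !sub_kermx !mulmxBr !mulmx1 !subr_eq0 conjgE !(rhoM H) ?groupM ?groupV //.
  move/eqP=> e; apply/eqP; rewrite -(rhoV H gW); apply: (can_inj (mulmxK gU)).
  by rewrite -!mulmxA e -(rhoM H) ?groupV // mulVg (rho1 H) mulmx1.
have /imsetP[b bQ ->] := aQ; have bW := QW b bQ; have := h b bQ.
rewrite !sub_kermx !mulmxBr !mulmx1 !subr_eq0 -(rhoV H gW) => /eqP e.
rewrite conjgE !(rhoM H) ?groupM ?groupV // !mulmxA e -mulmxA.
by rewrite -(rhoM H) ?groupV // mulVg (rho1 H) mulmx1.
Qed.

Lemma osact_OSideal g : g \in W -> (I2 *m osact g <= I2)%MS.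
Proof.
move=> gW; rewrite submxE -mulmxA -sub_kermx; apply/(OSideal_subP H ij) => a b c u aT bT cT dep.
rewrite sub_kermx mulmxA -submxE r3_osact.
have QT : [set a; b; c] \subset T by rewrite !subUset !sub1set aT bT cT.
have im : [set (x ^ g)%g | x in [set a; b; c]] = [set (a ^ g)%g; (b ^ g)%g; (c ^ g)%g].
  by rewrite !imsetU !imset_set1.
move/(OSideal_subP H ij): (submx_refl I2); apply; rewrite ?TsetJ //.
  by move: u; rewrite /= !inE !(inj_eq (conjg_inj g)).
by move: dep; rewrite /dependent -im (capHJ gW QT) card_imset //; apply: conjg_inj.
Qed.

Lemma s_TL : s \in TL.
Proof. by rewrite TLE (svK H) group1. Qed.

(** The difference is the relation of the triple [s], [a], [b]: modulo the ideal, the component is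
    spanned by the products whose first factor is [s]. *)
Lemma EX_mod a b : a \in TL -> b \in TL ->
  (wedge [:: a; b] - (wedge [:: s; b] - wedge [:: s; a]) <= I2)%MS.
Proof.
move=> aTL bTL; have -> : wedge [:: a; b] - (wedge [:: s; b] - wedge [:: s; a]) = r3 s a b.
  by rewrite opprB addrA addrAC.
have [u|nu] := boolP (uniq [:: s; a; b]).
  move/(OSideal_subP H ij): (submx_refl I2); apply; rewrite ?(TL_T H s_TL) ?(TL_T H aTL) ?(TL_T H
      bTL) //.
  rewrite /dependent.
  have c3 : #|[set s; a; b]| = 3%N.
    move: u; rewrite /= !inE !negb_or => /andP[/andP[ab ac] /andP[bc _]].
    by rewrite setUC cardsU1 !inE cards2 ab (eq_sym b) (eq_sym b) (negPf ac) (negPf bc).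
  have sub : (FixL <= capH rho [set s; a; b])%MS.
    by apply: capH_TL; rewrite ?subUset ?sub1set ?s_TL ?aTL ?bTL.
  have := mxrankS sub; rewrite (rank_FixL H ij) c3 => le; by rewrite ltnS leq_subLR addnC
      -leq_subLR.
suff -> : r3 s a b = 0 by rewrite sub0mx.
move: nu; rewrite /= !inE andbT negb_and !negbK.
case/orP=> [/orP[]/eqP e|/eqP e]; rewrite /r3 -?e.
- by rewrite wedge_diag subrr add0r.
- by rewrite wedge_diag subr0 (wedgeN s a) addNr.
- by rewrite wedge_diag sub0r addNr.
Qed.

(* A section of [dmx] modulo the Orlik-Solomon relations. *)
Definition thmx : 'M[algC]_(gN gT, eN gT) :=
  \sum_(b : gT) (gvec b)^T *m wedge [:: s; b].

Lemma gvec_thmx b : gvec b *m thmx = wedge [:: s; b].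
Proof. exact: (gvec_sum predT). Qed.

Lemma ker_dmx (v : 'rV[algC]_(eN gT)) : (v <= Y2)%MS -> v *m dmx = 0 -> (v <= I2)%MS.
Proof.
move=> vY vD; suff : (Y2 *m (1%:M - dmx *m thmx) <= I2)%MS.
  move=> h; have : (v *m (1%:M - dmx *m thmx) <= I2)%MS.
    by apply: submx_trans h; apply: submxMr.
  by rewrite mulmxBr mulmx1 mulmxA vD mul0mx subr0.
rewrite submxE -mulmxA -sub_kermx addsmx_sub; apply/andP; split.
  apply/(EX_subP H ij) => a b aTL bTL; rewrite sub_kermx mulmxA -submxE.
  rewrite mulmxBr mulmx1 mulmxA wedge_dmx aTL bTL mulmxBl !gvec_thmx.
  exact: EX_mod.
by rewrite sub_kermx mulmxA -submxE mulmxBr mulmx1 mulmxA OSideal_dmx mul0mx subr0.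
Qed.

Lemma Y2_equiv g : g \in N -> Y2 *m osact g *m dmx = Y2 *m dmx *m cjmx g.
Proof.
move=> gN; have [gW _] := NWP gN.
apply/eqP; rewrite -subr_eq0 -!mulmxA -mulmxBr -sub_kermx addsmx_sub; apply/andP; split.
  apply/(EX_subP H ij) => a b aTL bTL; rewrite sub_kermx mulmxBr !mulmxA wedge_osact.
  by rewrite !wedge_dmx !(TLJ H) // aTL bTL /= mulmxBl !gvec_cjmx subrr.
rewrite sub_kermx mulmxBr !mulmxA OSideal_dmx mul0mx subr0.
have /submxP[A ->] := osact_OSideal gW.
by rewrite -mulmxA OSideal_dmx mulmx0.
Qed.

(* The projection of [C[TL]] onto its sum-zero part. *)
Definition emx : 'M[algC]_(gN gT) :=
  \sum_(a in TL) (gvec a)^T *m (gvec a - #|TL|%:R^-1 *: \sum_(b in TL) gvec b).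

Lemma gvec_emx a : gvec a *m emx =
  if a \in TL then gvec a - #|TL|%:R^-1 *: \sum_(b in TL) gvec b else 0.
Proof. exact: gvec_sum. Qed.

Let cTL : (#|TL|%:R : algC) != 0.
Proof. by rewrite pnatr_eq0 -lt0n; apply/card_gt0P; exists s; apply: s_TL. Qed.

Lemma sum_emx : (\sum_(b in TL) gvec b) *m emx = 0.
Proof.
rewrite mulmx_suml (eq_bigr (fun b => gvec b - #|TL|%:R^-1 *: \sum_(b in TL) gvec b)).
  by rewrite sumrB sumr_const -scaler_nat scalerA divff // scale1r subrr.
by move=> b bTL; rewrite gvec_emx bTL.
Qed.

Lemma emxK : emx *m emx = emx.
Proof.
apply: gvec_ext => a; rewrite mulmxA gvec_emx; case: ifP => aTL; last by rewrite mul0mx.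
by rewrite mulmxBl -scalemxAl sum_emx scaler0 subr0 gvec_emx aTL.
Qed.

Lemma sum_TLJ g : g \in N -> \sum_(b in TL) gvec (b ^ g)%g = \sum_(b in TL) gvec b.
Proof.
move=> gN; rewrite [RHS](reindex_inj (conjg_inj g)) /=; apply: eq_bigl => b.
apply/idP/idP => [|bTL]; first exact: (TLJ H).
by rewrite -(conjgK g b); apply: (TLJ H); rewrite ?groupV.
Qed.

Lemma emx_cjmx g : g \in N -> emx *m cjmx g = cjmx g *m emx.
Proof.
move=> gN; apply: gvec_ext => a; rewrite !mulmxA gvec_cjmx !gvec_emx.
have -> : ((a ^ g)%g \in TL) = (a \in TL).
  apply/idP/idP => [aTL|]; last exact: (TLJ H).
  by rewrite -(conjgK g a); apply: (TLJ H); rewrite ?groupV.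
case: ifP => _; last by rewrite mul0mx.
rewrite mulmxBl gvec_cjmx -scalemxAl mulmx_suml; congr (_ - _ *: _).
by rewrite -(sum_TLJ gN); apply: eq_bigr => b _; rewrite gvec_cjmx.
Qed.

Lemma emx_Y2 : (emx :=: Y2 *m dmx)%MS.
Proof.
apply/eqmxP/andP; split.
  apply: gvec_sub => a; rewrite gvec_emx; case: ifP => aTL; last exact: sub0mx.
  have -> : gvec a - #|TL|%:R^-1 *: \sum_(b in TL) gvec b =
            #|TL|%:R^-1 *: \sum_(b in TL) (gvec a - gvec b).
    by rewrite sumrB sumr_const scalerBr -scaler_nat scalerA mulVf // scale1r.
  apply: scalemx_sub; apply: summx_sub => b bTL.
  have <- : wedge [:: b; a] *m dmx = gvec a - gvec b by rewrite wedge_dmx aTL bTL.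
  apply: submxMr; apply: submx_trans (addsmxSl _ _).
  by move/(EX_subP H ij): (submx_refl EX2); apply.
rewrite submxE -mulmxA -sub_kermx addsmx_sub; apply/andP; split.
  apply/(EX_subP H ij) => a b aTL bTL; rewrite sub_kermx mulmxA -submxE wedge_dmx aTL bTL /=.
  have -> : gvec b - gvec a = (gvec b - gvec a) *m emx.
    by rewrite mulmxBl !gvec_emx aTL bTL opprB addrA subrK.
  exact: submxMl.
by rewrite sub_kermx mulmxA OSideal_dmx mul0mx.
Qed.

Lemma PsiTE g : g \in N ->
  PsiT rho S L g = #|[set a in TL | (a ^ g)%g == a]|%:R - 1.
Proof.
move=> gN; have [gW _] := NWP gN; rewrite /PsiT EX_p.
rewrite (@tr_restr_quot _ _ Y2 I2 (osact g) dmx (cjmx g)) ?addsmxSr ?osact_OSideal //; first last.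
- exact: Y2_equiv.
- exact: ker_dmx.
- exact: OSideal_dmx.
- rewrite submxE -mulmxA -sub_kermx addsmx_sub; apply/andP; split.
    rewrite sub_kermx mulmxA -submxE; exact: submx_trans (osact_EX gN) (addsmxSl _ _).
  rewrite sub_kermx mulmxA -submxE; exact: submx_trans (osact_OSideal gW) (addsmxSr _ _).
rewrite (@tr_restr_idem _ _ _ _ 1%:M 1%:M emx (cjmx g)) ?mulmx1 ?emxK ?emx_cjmx //; last first.
  by apply: eqmx_trans emx_Y2 (eqmx_sym (genmxE _)).
rewrite -emx_cjmx // /emx mulmx_suml raddf_sum /=.
rewrite (eq_bigr (fun a => ((a ^ g)%g == a)%:R - #|TL|%:R^-1)) => [|a aTL].
  rewrite sumrB sumr_const -[_ *+ #|_|]mulr_natr mulVf // -sum1_card natr_sum; congr (_ - _).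
  by rewrite big_mkcond [RHS]big_mkcond; apply: eq_bigr => a _; rewrite inE; case: (a \in TL) =>
      //=; case: eqP.
rewrite -mulmxA mulmxBl gvec_cjmx mulmxBr linearB /= gvec_tr eq_sym; congr (_ - _).
rewrite -scalemxAl -scalemxAr linearZ /= mulmx_suml mulmx_sumr raddf_sum /=.
(* Only the preimage of [a] under conjugation by [g] contributes to the diagonal, so the averages
   add up to the subtracted 1. *)
rewrite (bigD1 (a ^ g^-1)%g) /=; last by apply: (TLJ H); rewrite ?groupV.
rewrite gvec_cjmx conjgKV gvec_tr eqxx big1 ?addr0 ?mulr1 // => b /andP[_ ba].
rewrite gvec_cjmx gvec_tr; case: eqP => // e; case/eqP: ba.
by rewrite e conjgK.
Qed.

End OrlikSolomonTrace.

(** * The element [e_L] *)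

Section LongestElement.
Variables (gT : finGroupType) (n : nat) (sv : 'I_n -> gT) (rho : gT -> 'M[algC]_n).
Hypothesis H : coxeter_rep sv rho.
Local Notation S := [set sv i | i : 'I_n].
Local Notation W := <<[set sv i | i : 'I_n]>>%g.
Local Notation alpha i := (delta_mx 0 i : 'rV[algC]_n).
Local Notation root i w := (row i (rho w)).

Lemma longest_mul (A : {group gT}) : A \subset W ->
  exists2 w, w \in A & forall i, sv i \in A -> nng (- root i w).
Proof.
move=> AW.
case: (@arg_maxnP _ 1%g (mem A) (fun w => len S w) (group1 _)) => w wA wmax.
have wW := subsetP AW w wA; exists w => // i iA.
rewrite -(rootS H) //; apply: (root_nng H); first by rewrite groupM ?sv_gen.
rewrite mulgA (svK H) mul1g ltn_neqAle (len_parity H) ?mem_sv //=.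
exact: (wmax (sv i * w)%g (groupM iA wA)).
Qed.

Lemma nng_mulN (v : 'rV[algC]_n) w : nng v -> (forall i, nng (- root i w)) -> nng (- (v *m rho w)).
Proof.
move=> /nngP vp wp; apply/nngP => j; rewrite !mxE -sumrN; apply: sumr_ge0 => i _.
by rewrite -mulrN; apply: mulr_ge0 => //; have /nngP/(_ j) := wp i; rewrite !mxE.
Qed.

Lemma alpha_nng i : nng (alpha i).
Proof. by apply/nngP => j; rewrite mxE ler0n. Qed.

Lemma root_rootV i w : w \in W -> root i w *m rho w^-1%g = alpha i.
Proof. by move=> wW; rewrite -row_mul (rhoVr H) // row1. Qed.

Lemma not_nng_anti i w : w \in W -> nng (root i w) -> nng (- root i w) -> False.
Proof. by move=> wW p q; have := root_neq0 H i wW; rewrite (nng_anti p q) eqxx. Qed.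

(* Minus the longest element is nonnegative with a nonnegative inverse, hence monomial. *)
Lemma longest_simple : exists2 w, w \in W & forall i, exists l, root i w = - alpha l.
Proof.
have [w wW wn] := longest_mul (subxx W).
have wVW : w^-1%g \in W by rewrite groupV.
have wVn i : nng (- root i w^-1%g).
  case: (root_dich H i wVW) => // p.
  have := nng_mulN p (fun j => wn j (sv_gen _ j)).
  rewrite -{2}(invgK w) root_rootV ?groupV // => q.
  have := not_nng_anti (group1 W) (i := i); rewrite (rho1 H) row1 => /(_ (alpha_nng i) q).
  by [].
exists w^-1%g; rewrite // => i.
have e : alpha i = \sum_l (- root i w^-1%g 0 l) *: (- root l w).
  rewrite -[LHS](root_rootV i wVW) invgK [X in X *m _]row_sum_delta mulmx_suml.
  by apply: eq_bigr => l _; rewrite -scalemxAl mul_delta_mx_mx scalerN scaleNr opprK.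
have p0 l : 0 <= - root i w^-1%g 0 l by have /nngP/(_ l) := wVn i; rewrite !mxE.
have q0 l j : 0 <= (- root l w) 0 j by have /nngP := wn l (sv_gen _ l).
have [l pl] : exists l, - root i w^-1%g 0 l != 0.
  apply/existsP; apply: contraT => /existsPn h; have := root_neq0 H i wVW.
  case/negP; apply/eqP/rowP => l; rewrite [RHS]mxE; apply/eqP.
  by have := h l; rewrite negbK oppr_eq0.
have zero j : j != i -> root l w 0 j = 0.
  move=> ji; have := congr1 (fun v : 'rV[algC]_n => v 0 j) e.
  rewrite /= summxE mxE (negPf ji) andbF => /esym/eqP.
  rewrite psumr_eq0 => [/allP/(_ l)|k _]; last by rewrite mxE mulr_ge0.
  rewrite mem_index_enum mxE mulf_eq0 (negPf pl) /= => /(_ isT).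
  by rewrite mxE oppr_eq0 => /eqP.
have lE : root l w = root l w 0 i *: alpha i.
  apply/rowP => j; rewrite [RHS]mxE; have [->|ji] := eqVneq j i; first by rewrite [alpha i _
      _]mxE !eqxx mulr1.
  by rewrite zero // [alpha i _ _]mxE (negPf ji) andbF mulr0.
have := root_norm H l wW; rewrite lE linearZ /= -!scalemxAl -scalemxAr (alpha_norm H) scalerA.
move=> /matrixP/(_ 0 0); rewrite !mxE eqxx mulr1 => /eqP; rewrite -expr2 sqrf_eq1.
have le0 : rho w l i <= 0 by have := q0 l i; rewrite !mxE oppr_ge0.
move=> /orP[]/eqP c1.
  by move: le0; rewrite c1 ler10.
exists l; move: lE; rewrite mxE c1 scaleN1r => lE.
have := root_rootV l wW; rewrite lE mulNmx mul_delta_mx_mx => <-.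
by rewrite opprK.
Qed.

End LongestElement.

(** * Coset representatives and the numbers [m_KL] *)

Section Counting.
Variables (gT : finGroupType) (n : nat) (sv : 'I_n -> gT) (rho : gT -> 'M[algC]_n).
Hypothesis H : coxeter_rep sv rho.
Variables i0 j0 : 'I_n.
Hypothesis ij : i0 != j0.
Local Notation S := [set sv i | i : 'I_n].
Local Notation W := <<[set sv i | i : 'I_n]>>%g.
Local Notation G := (Gram sv).
Local Notation alpha i := (delta_mx 0 i : 'rV[algC]_n).
Local Notation root i w := (row i (rho w)).
Local Notation L := [set sv i0; sv j0].
Local Notation WL := <<[set sv i0; sv j0]>>%g.
Local Notation XL := (XL rho i0 j0).
Local Notation N := 'N_W(WL)%g.
Local Notation sW := (WLW (i0 := i0) (j0 := j0)).

Lemma Xset_L w : (w \in Xset S L) = (w \in W) && XL w.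
Proof.
rewrite inE; case: (boolP (w \in W)) => //= wW; rewrite (XLE H) //.
apply/forall_inP/andP => [h|[h1 h2] x /set2P[]->//].
by split; apply: h; rewrite !inE eqxx ?orbT.
Qed.

Lemma Xset_1 i w : (w \in Xset S [set sv i]) = (w \in W) && nng (root i w).
Proof.
rewrite inE; case: (boolP (w \in W)) => //= wW; rewrite (root_nngE H) //.
by apply/forall_inP/idP => [h|h x /set1P->//]; apply: h; rewrite inE.
Qed.

Lemma Xset_0 w : (w \in Xset S set0) = (w \in W).
Proof.
by rewrite inE andb_idr // => _; apply/forall_inP => x; rewrite inE.
Qed.

Lemma sum_W_decomp (M : nmodType) (F : gT -> M) :
  \sum_(w in W) F w = \sum_(u in WL) \sum_(d in Xset S L) F (u * d)%g.
Proof.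
have inj : {in setX WL (Xset S L) &, injective (fun p : gT * gT => p.1 * p.2)%g}.
  move=> [u d] [u' d'] /setXP[/= uL]; rewrite Xset_L => /andP[dW dX] /setXP[/= u'L].
  rewrite Xset_L => /andP[d'W d'X] /= e.
  have dE : (u^-1 * u' * d' = d)%g by rewrite -mulgA -e mulKg.
  have u1 : (u^-1 * u' = 1)%g.
    by apply: (XL_uniq H ij) d'W d'X _; rewrite ?dE // groupM ?groupV.
  move: dE; rewrite u1 mul1g => ->; congr (_, _).
  by rewrite -[u']mul1g -(mulgV u) -mulgA u1 mulg1.
have -> : \sum_(w in W) F w = \sum_(w in [set (p.1 * p.2)%g | p in setX WL (Xset S L)]) F w.
  apply: eq_bigl => w; apply/idP/imsetP => [wW|[[u d] /setXP[/= uL]]].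
    have [u [d [uL dW dX ->]]] := XL_decomp H i0 j0 wW.
    by exists (u, d) => //; apply/setXP; rewrite Xset_L uL dW.
  by rewrite Xset_L => /andP[dW _] ->; rewrite groupM ?(sW uL).
rewrite big_imset //= pair_big /=; apply: eq_bigl => -[u d].
by rewrite in_setX.
Qed.

Lemma card_W : #|W| = (#|WL| * #|Xset S L|)%N.
Proof.
rewrite -!sum1_card sum_W_decomp big_distrl /=; apply: eq_bigr => u _.
by rewrite mul1n sum1_card.
Qed.

Lemma card_W2 i : #|W| = (2 * #|Xset S [set sv i]|)%N.
Proof.
have -> : #|W| = (#|W :&: Xset S [set sv i]| + #|W :\: Xset S [set sv i]|)%N.
  by rewrite cardsID.
have XW : W :&: Xset S [set sv i] = Xset S [set sv i].
  by apply/setIidPr/subsetP => w; rewrite Xset_1 => /andP[].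
rewrite XW mul2n -addnn; congr (_ + _)%N.
rewrite -(card_imset (Xset S [set sv i]) (mulgI (sv i))); apply: eq_card => w.
apply/idP/imsetP => [|[v]].
  case/setDP=> wW nX; exists (sv i * w)%g; last by rewrite mulgA (svK H) mul1g.
  rewrite Xset_1 groupM ?sv_gen //= (rootS H) //.
  by case: (root_dich H i wW) => // p; rewrite Xset_1 wW p in nX.
rewrite Xset_1 => /andP[vW vp] ->; rewrite inE groupM ?sv_gen // andbT Xset_1 groupM ?sv_gen //=.
rewrite (rootS H) //; apply/negP => np; exact: (not_nng_anti H vW vp np).
Qed.

Lemma Xsharp_1 i w : (w \in Xsharp S [set sv i]) = [&& w \in W, nng (root i w) & (sv i ^ w)%g \in
    S].
Proof. by rewrite inE Xset_1 conjg_set1 sub1set andbA. Qed.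

Lemma root_conj_pm i k w : w \in W -> (sv i ^ w)%g = sv k ->
  root i w = alpha k \/ root i w = - alpha k.
Proof.
move=> wW e; have := rho_svJ H i wW; rewrite e (rho_sv H) (reflE H) => rE.
have := mul_rfl_id (root_norm H i wW); rewrite -rE mul_rfl.
have := root_norm H i wW; move: (root i w) => b nb.
set q := (_ *m _ *m _) 0 0 => e2.
have bb : b + b = (2 * q) *: alpha k by rewrite -{2}[b]opprK -e2 opprB addrC subrK.
have bq : b = q *: alpha k.
  have n2 : (2 : algC) != 0 by rewrite pnatr_eq0.
  by apply: (scalerI n2); rewrite scalerA -bb scaler_nat mulr2n.
move: nb; rewrite bq linearZ /= -!scalemxAl -scalemxAr (alpha_norm H) scalerA.
move=> /matrixP/(_ 0 0); rewrite !mxE mulr1 => /eqP; rewrite -expr2 sqrf_eq1.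
by move=> /orP[]/eqP->; [left; rewrite scale1r | right; rewrite scaleN1r].
Qed.

Lemma root_conj_simple i k w : w \in W -> nng (root i w) -> (sv i ^ w)%g = sv k -> root i w =
    alpha k.
Proof.
move=> wW wp e; case: (root_conj_pm wW e) => // e2.
by move: wp; rewrite e2 => /nngP/(_ k); rewrite !mxE !eqxx oppr_ge0 ler10.
Qed.

(* The involution-like map [x |-> sv i * x * v0] exchanges the elements of
   [Xsharp S [set sv i]] which are dominant for [sv j] with the others. *)
Lemma half_Xsharp i j : i != j ->
  #|Xsharp S [set sv i]| = (2 * #|[set x in Xsharp S [set sv i] | nng (root j x)]|)%N.
Proof.
move=> nij; have [v0 v0W v0s] := longest_simple H.
have v0n k : nng (- root k v0) by have [l ->] := v0s k; rewrite opprK alpha_nng.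
set A := [set x in _ | _]; set X := Xsharp _ _; pose B := X :\: A.
have AX : A \subset X by apply/subsetP => x; rewrite inE => /andP[].
have -> : #|X| = (#|A| + #|B|)%N by rewrite -(cardsID A X) (setIidPr AX).
pose f x := (sv i * x * v0)%g.
have f_inj : injective f by move=> x y /mulIg/mulgI.
have XW x : x \in X -> x \in W by rewrite Xsharp_1 => /andP[].
have fW x : x \in X -> f x \in W by move=> /XW xW; rewrite !groupM ?sv_gen.
have rf k x : x \in X -> root k (f x) = root k (sv i * x)%g *m rho v0.
  by move=> /XW xW; rewrite /f (rhoM H) ?row_mul ?groupM ?sv_gen.
have fX x : x \in X -> f x \in X.
  move=> xX; rewrite Xsharp_1 fW //=; move: (xX).
  rewrite Xsharp_1 => /and3P[xW xp /imsetP[k _ ek]].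
  have rk := root_conj_simple xW xp ek; have [l el] := v0s k.
  have rE : root i (f x) = alpha l.
    by rewrite rf // (rootS H) // rk mulNmx mul_delta_mx_mx el opprK.
  rewrite rE alpha_nng /=; apply/imsetP; exists l => //.
  exact: (root_eq_conj H (fW x xX) rE).
have rjx x : x \in X -> root j (sv i * x)%g = root j x - (2 * G i j) *: root i x.
  move=> /XW xW; rewrite (rhoM H) ?sv_gen // row_mul -[row j (rho (sv i))]mul_delta_mx_mx (rho_sv
      H).
  by rewrite (alpha_refl H) mulmxBl -scalemxAl !mul_delta_mx_mx.
have Gle : 0 <= - (2 * G i j).
  have := chebU_ge0 (order_sv_gt1 H nij) (order_sv_gt1 H nij); rewrite /= mulr1 subr0.
  have -> : 'Re (#[sv i * sv j]%g.-root (-1)) = - G i j by rewrite mxE opprK.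
  by rewrite mulrN.
have AB x : x \in A -> f x \in B.
  rewrite inE => /andP[xX jp]; rewrite inE fX // andbT inE fX //=.
  have ip : nng (root i x) by move: xX; rewrite Xsharp_1 => /and3P[].
  apply/negP => p; apply: (not_nng_anti H (fW x xX) p); rewrite rf //.
  by apply: nng_mulN => //; rewrite rjx // -scaleNr; apply: nngD => //; apply: nngZ.
have BA x : x \in B -> f x \in A.
  case/setDP=> xX xA; rewrite inE fX //= rf //.
  move: (xX); rewrite Xsharp_1 => /and3P[xW xp /imsetP[k _ ek]].
  have rk := root_conj_simple xW xp ek.
  have jn : nng (- root j x).
    by case: (root_dich H j xW) => // jp; rewrite inE xX jp in xA.
  have sxW : (sv i * x)%g \in W by rewrite groupM ?sv_gen.
  (* Otherwise the nonpositive [root j x] becomes nonnegative after adding a multiple of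
     [root i x = alpha k]. It would then be a multiple of [root i x], and [alpha j] one of
     [alpha i]. *)
  suff q : nng (- root j (sv i * x)%g).
    by have := nng_mulN q v0n; rewrite mulNmx opprK.
  case: (root_dich H j sxW) => // p; exfalso.
  have z l : l != k -> root j x 0 l = 0.
    move=> lk; apply/eqP; rewrite eq_le; apply/andP; split.
      by have /nngP/(_ l) := jn; rewrite mxE oppr_ge0.
    have /nngP/(_ l) := p; rewrite rjx // rk; move: (root j x) (2 * G i j) => b c.
    by rewrite !mxE (negPf lk) andbF mulr0 subr0.
  have jk : root j x = root j x 0 k *: root i x.
    rewrite rk; apply/rowP => l; rewrite [RHS]mxE; have [->|lk] := eqVneq l k.
      by rewrite [alpha k _ _]mxE !eqxx mulr1.
    by rewrite z // [alpha k _ _]mxE (negPf lk) andbF mulr0.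
  have := congr1 (mulmx^~ (rho x^-1%g)) jk; rewrite -scalemxAl !(root_rootV H) //.
  move/rowP/(_ j); rewrite !mxE !eqxx eq_sym (negPf nij) mulr0 => /eqP.
  by rewrite oner_eq0.
rewrite mul2n -addnn; congr (_ + _)%N; apply/eqP; rewrite eqn_leq; apply/andP; split.
  rewrite -(card_imset _ f_inj); apply: subset_leq_card.
  by apply/subsetP => _ /imsetP[x xB ->]; apply: BA.
rewrite -(card_imset _ f_inj); apply: subset_leq_card.
by apply/subsetP => _ /imsetP[x xA ->]; apply: AB.
Qed.

End Counting.

(** * Solving the defining system for [e_L] *)

Section QuasiIdempotent.
Variables (gT : finGroupType) (n : nat) (sv : 'I_n -> gT) (rho : gT -> 'M[algC]_n).
Hypothesis H : coxeter_rep sv rho.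
Variables i0 j0 : 'I_n.
Hypothesis ij : i0 != j0.
Local Notation S := [set sv i | i : 'I_n].
Local Notation W := <<[set sv i | i : 'I_n]>>%g.
Local Notation root i w := (row i (rho w)).
Local Notation L := [set sv i0; sv j0].
Local Notation WL := <<[set sv i0; sv j0]>>%g.
Local Notation XL := (XL rho i0 j0).
Local Notation s := (sv i0).
Local Notation t := (sv j0).
Local Notation R := <[(sv i0 * sv j0)%g]>%g.

Lemma id_Xset (K : {set gT}) : K \subset S -> 1%g \in Xset S K.
Proof.
move=> KS; rewrite inE group1; apply/forall_inP => x xK.
have /imsetP[i _ ->] := subsetP KS x xK; rewrite len1 mulg1 lt0n.
have := len_parity H (mem_sv sv i) (group1 W); by rewrite mulg1 len1.
Qed.

Lemma mKL_diag (K : {set gT}) : K \subset S -> mKL S K K != 0.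
Proof.
move=> KS; rewrite /mKL subxx pnatr_eq0 -lt0n; apply/card_gt0P; exists 1%g.
by rewrite inE [X in _ && X]inE conjsg1 KS id_Xset.
Qed.

(** [Mmat] is triangular for inclusion with nonzero diagonal. In the coordinate of a largest set in
    the support of [v], only the diagonal term remains. *)
Lemma Mmat_unit : Mmat S \in unitmx.
Proof.
rewrite -row_free_unit; apply: inj_row_free => v vM; apply/rowP => i; rewrite mxE.
apply/eqP/contraT => vi.
case: (@arg_maxnP _ i (fun i => v 0 i != 0) (fun i => #|enum_val i|) vi) => k vk kmax.
have := congr1 (fun M : 'rV_#|Pset S| => M 0 k) vM; rewrite /= [RHS]mxE mxE (bigD1 k) //= big1.
  move/eqP; rewrite addr0 mulf_eq0 (negPf vk) mxE /= => /eqP.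
  by move/eqP; rewrite (negPf (mKL_diag _)) // -powersetE enum_valP.
move=> j jk; have [->|vj] := eqVneq (v 0 j) 0; first by rewrite mul0r.
rewrite mxE /mKL; case: ifP => [sub|_]; last by rewrite mulr0.
case/eqP: jk; apply: enum_val_inj; apply/esym/eqP; rewrite eqEcard sub; exact: kmax.
Qed.

Lemma eL_sum (K : {set gT}) : K \subset S ->
  \sum_(J in Pset S) mKL S K J *: eL S J = xJ S K.
Proof.
move=> KS; have KP : K \in Pset S by rewrite powersetE.
pose k := enum_rank_in (set0_Pset S) K.
have kE : enum_val k = K by rewrite enum_rankK_in.
rewrite big_enum_val /=.
have e i : mKL S K (enum_val i) *: eL S (enum_val i) =
    \sum_(l < #|Pset S|) (Mmat S k i * invmx (Mmat S) i l) *: xJ S (enum_val l).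
  rewrite /eL big_enum_val /= scaler_sumr; apply: eq_bigr => l _.
  by rewrite !enum_valP /= !enum_valK_in scalerA [Mmat S k i]mxE kE.
rewrite (eq_bigr _ (fun i _ => e i)) exchange_big /=.
rewrite (eq_bigr (fun l => (1%:M : 'M[algC]_#|Pset S|) k l *: xJ S (enum_val l))) => [|l _].
  rewrite (bigD1 k) //= big1 => [|l lk]; last by rewrite mxE eq_sym (negPf lk) scale0r.
  by rewrite mxE eqxx scale1r addr0 kE.
by rewrite -scaler_suml -(mulmxV Mmat_unit) mxE.
Qed.

Lemma subset_pair (J : {set gT}) : J \subset L ->
  [\/ J = set0, J = [set s], J = [set t] | J = L].
Proof.
move=> JL; have JE x : x \in J -> x = s \/ x = t by move=> /(subsetP JL)/set2P.
case: (boolP (s \in J)) => sJ; case: (boolP (t \in J)) => tJ.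
- apply: Or44; apply/eqP; rewrite eqEsubset JL; apply/subsetP => x /set2P[]->//.
- apply: Or42; apply/setP => x; rewrite inE; apply/idP/eqP => [xJ|->//].
  by case: (JE x xJ) => // xt; rewrite -xt xJ in tJ.
- apply: Or43; apply/setP => x; rewrite inE; apply/idP/eqP => [xJ|->//].
  by case: (JE x xJ) => // xt; rewrite -xt xJ in sJ.
apply: Or41; apply/setP => x; rewrite inE; apply/negP => xJ.
by case: (JE x xJ) => xt; [rewrite -xt xJ in sJ | rewrite -xt xJ in tJ].
Qed.

Lemma L_sub : L \subset S.
Proof. by rewrite subUset !sub1set !mem_sv. Qed.

Lemma conjs0g x : (set0 :^ x)%g = set0 :> {set gT}.
Proof. by apply/setP => y; rewrite mem_conjg !inE. Qed.

Lemma xJ_0 : xJ S set0 = #|W|%:R *: eL S set0.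
Proof.
rewrite -(eL_sum (sub0set S)) (bigD1 set0) ?powersetE ?sub0set //= big1 ?addr0 => [|J /andP[_ J0]].
  congr (_ *: _); rewrite /mKL subxx; congr (_%:R); apply: eq_card => w.
  by rewrite inE [X in _ && X]inE Xset_0 conjs0g sub0set andbT andbb.
by rewrite /mKL subset0 (negPf J0) scale0r.
Qed.

Lemma Xsharp0 w : (w \in Xsharp S set0) = (w \in W).
Proof. by rewrite inE Xset_0 conjs0g sub0set andbT. Qed.

Lemma xJ_1 i : xJ S [set sv i] =
  #|Xsharp S [set sv i]|%:R *: eL S [set sv i] + #|Xset S [set sv i]|%:R *: eL S set0.
Proof.
have iS : [set sv i] \subset S by rewrite sub1set mem_sv.
have i0' : [set sv i] != set0 by apply/set0Pn; exists (sv i); rewrite inE.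
rewrite -(eL_sum iS) (bigD1 [set sv i]) ?powersetE //= (bigD1 set0) /=; last first.
  by rewrite powersetE sub0set eq_sym.
rewrite big1 ?addr0 => [|J /andP[/andP[_ J1] J0]].
  congr (_ *: _ + _ *: _).
    rewrite /mKL subxx; congr (_%:R); apply: eq_card => w.
    by rewrite inE; apply: andb_idl; rewrite inE => /andP[].
  rewrite /mKL sub0set; congr (_%:R); apply: eq_card => w.
  by rewrite inE Xsharp0; apply: andb_idr; rewrite (Xset_1 H) => /andP[].
by rewrite /mKL subset1 (negPf J1) (negPf J0) scale0r.
Qed.

Lemma mL1 i : (i = i0 \/ i = j0) ->
  2 * mKL S L [set sv i] = #|Xsharp S [set sv i]|%:R.
Proof.
move=> hi; pose j := if i == i0 then j0 else i0.
have ji : (j0 == i0) = false by rewrite eq_sym (negPf ij).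
have nij : i != j by rewrite /j; case: hi => ->; rewrite ?eqxx // ji /= ji.
rewrite (half_Xsharp H nij) natrM; congr (_ * _).
have -> : mKL S L [set sv i] = #|Xset S L :&: Xsharp S [set sv i]|%:R.
  by rewrite /mKL sub1set; case: hi => ->; rewrite !inE eqxx ?orbT.
congr (_%:R); apply: eq_card => w; rewrite in_setI (Xset_L H) [RHS]inE (Xsharp_1 H).
rewrite /XL /j; case: hi => ->.
  by rewrite eqxx; case: (w \in W) => //=; case: nng; rewrite ?andbF //= andbC.
rewrite ji; case: (w \in W) => //=.
by case: (nng (root j0 w)); rewrite ?andbF ?andbT //= andbC.
Qed.

Lemma xJ_L : xJ S L = mKL S L L *: eL S L + mKL S L [set s] *: eL S [set s]
  + mKL S L [set t] *: eL S [set t] + #|Xset S L|%:R *: eL S set0.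
Proof.
have nst := st_neq H ij.
have sL : s \in L by rewrite !inE eqxx.
have tL : t \in L by rewrite !inE eqxx orbT.
have d1 : [set s] != L.
  by apply/negP => /eqP e; move: tL; rewrite -e inE eq_sym (negPf nst).
have d2 : [set t] != L.
  by apply/negP => /eqP e; move: sL; rewrite -e inE (negPf nst).
have d3 : [set t] != [set s] by rewrite (inj_eq set1_inj) eq_sym.
have z0 (A : {set gT}) x : x \in A -> set0 != A.
  by move=> xA; apply/negP => /eqP e; rewrite -e inE in xA.
have ms i : [set sv i] \subset S by rewrite sub1set mem_sv.
rewrite -(eL_sum L_sub) (bigD1 L) ?powersetE ?L_sub //= -!addrA; congr (_ + _).
rewrite (bigD1 [set s]) ?powersetE ?ms //=; congr (_ + _).
rewrite (bigD1 [set t]) ?powersetE ?ms ?d2 ?d3 //=; congr (_ + _).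
rewrite (bigD1 set0) /=; last first.
  by rewrite powersetE sub0set (z0 L s) // (z0 _ s) ?inE ?eqxx // (z0 _ t) ?inE ?eqxx.
rewrite big1 ?addr0 => [|J /andP[/andP[/andP[/andP[_ n1] n2] n3] n4]].
  rewrite /mKL sub0set; congr (_%:R *: _); apply: eq_card => w.
  by rewrite inE Xsharp0; apply: andb_idr; rewrite (Xset_L H) => /andP[].
rewrite /mKL; case: ifP => [/subset_pair[]e|_]; last exact: scale0r.
all: by rewrite e eqxx in n1 n2 n3 n4.
Qed.

(** Only the four subsets of [L] enter. The halves eliminate the singletons by [mL1]; the last
    coefficient eliminates the empty set, as [#|Xset S L|] and [#|Xset S [set sv i]|] are
    [|W| / |W_L|] and [|W| / 2]. *)
Lemma eL_formula : mKL S L L *: eL S L =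
  xJ S L - 2^-1 *: xJ S [set s] - 2^-1 *: xJ S [set t] + (2^-1 - #|WL|%:R^-1) *: xJ S set0.
Proof.
have n2 : (2 : algC) != 0 by rewrite pnatr_eq0.
have cL : (#|WL|%:R : algC) != 0 by rewrite pnatr_eq0 -lt0n cardG_gt0.
rewrite xJ_L !xJ_1 xJ_0 -!mL1; try by [left | right].
have W2 i : (#|W|%:R : algC) = 2 * #|Xset S [set sv i]|%:R by rewrite (card_W2 H i) natrM.
have e1 i : #|Xset S [set sv i]|%:R = 2^-1 * #|W|%:R :> algC by rewrite (W2 i) mulKf.
have e2 : #|Xset S L|%:R = #|WL|%:R^-1 * #|W|%:R :> algC by rewrite (card_W H ij) natrM mulKf.
rewrite !e1 e2; move: (mKL S L L) (mKL S L [set s]) (mKL S L [set t]) (#|W|%:R) (#|WL|%:R) cL.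
move: (eL S L) (eL S [set s]) (eL S [set t]) (eL S set0) => v1 v2 v3 v4 a b c w l l0.
by apply/rowP => k; rewrite !mxE; field; rewrite l0.
Qed.

End QuasiIdempotent.

(** * The trace on [e_L CW_L] *)

Section PhiTrace.
Variables (gT : finGroupType) (n : nat) (sv : 'I_n -> gT) (rho : gT -> 'M[algC]_n).
Hypothesis H : coxeter_rep sv rho.
Variables i0 j0 : 'I_n.
Hypothesis ij : i0 != j0.
Local Notation S := [set sv i | i : 'I_n].
Local Notation W := <<[set sv i | i : 'I_n]>>%g.
Local Notation alpha i := (delta_mx 0 i : 'rV[algC]_n).
Local Notation root i w := (row i (rho w)).
Local Notation L := [set sv i0; sv j0].
Local Notation WL := <<[set sv i0; sv j0]>>%g.
Local Notation inPlane := (inPlane i0 j0).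
Local Notation XL := (XL rho i0 j0).
Local Notation R := <[(sv i0 * sv j0)%g]>%g.
Local Notation N := 'N_W(WL)%g.
Local Notation sW := (WLW (i0 := i0) (j0 := j0)).
Local Notation XS := (Xset [set sv i | i : 'I_n] [set sv i0; sv j0]).

(** Characterizes the longest element of [W_L] by the signs of its roots, which makes its uniqueness
    and its invariance under dominant elements immediate. *)
Definition isW0 (w : gT) : Prop :=
  [/\ w \in WL, nng (- root i0 w) & nng (- root j0 w)].

Lemma isW0_ex : exists w, isW0 w.
Proof.
have [w wL wn] := longest_mul H (WL_sub sv i0 j0 : _ \subset W).
by exists w; split=> //; apply: wn; rewrite ?svi_WL ?svj_WL.
Qed.

Lemma comb_npos v w : inPlane v -> nng v -> nng (- root i0 w) -> nng (- root j0 w) ->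
  nng (- (v *m rho w)).
Proof.
move=> vE /nngP vp ni nj; rewrite (mul_inPlane rho ij w vE) opprD -!scalerN.
by apply: nngD; apply: nngZ.
Qed.

Lemma isW0V w : isW0 w -> isW0 w^-1%g.
Proof.
case=> wL ni nj; have wW := sW wL; have wVL : w^-1%g \in WL by rewrite groupV.
have key k : inPlane (root k w^-1%g) -> nng (- root k w^-1%g).
  move=> kE; case: (root_dich H k (sW wVL)) => // p.
  have := comb_npos kE p ni nj; rewrite -{2}(invgK w) (root_rootV H) ?groupV // => q.
  by have := nng_anti (alpha_nng k) q => /rowP/(_ k)/eqP; rewrite !mxE !eqxx oner_eq0.
by split=> //; apply: key; [apply: (root_inPlanei H) | apply: (root_inPlanej H)].
Qed.

Lemma isW0_uniq u w : isW0 u -> isW0 w -> u = w.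
Proof.
move=> [uL ui uj] w0; have [wVL wi wj] := isW0V w0; have wL : w \in WL by case: w0.
have pos k : inPlane (root k u) -> nng (- root k u) -> nng (root k (u * w^-1)%g).
  move=> kE kn; rewrite (rhoM H) ?(sW uL) ?(sW wVL) // row_mul -[root k u]opprK mulNmx.
  by apply: comb_npos => //; apply: inPlaneN.
have uwL : (u * w^-1)%g \in WL by rewrite groupM.
suff e : (u * w^-1 = 1)%g by rewrite -[u](mulgKV w) e mul1g.
apply: (XL_triv H (sW uwL) (i0 := i0) (j0 := j0)) => [v|]; first exact: (WL_out H).
by apply/andP; split; apply: pos => //; [apply: (root_inPlanei H) | apply: (root_inPlanej H)].
Qed.

Lemma isW0K w : isW0 w -> (w * w = 1)%g.
Proof. by move=> w0; rewrite -{2}(isW0_uniq (isW0V w0) w0) mulgV. Qed.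

Lemma isW0_neq1 w : isW0 w -> w != 1%g.
Proof.
case=> _ ni _; apply/negP => /eqP e; move: ni; rewrite e (rho1 H) row1 => /nngP/(_ i0).
by rewrite !mxE !eqxx oppr_ge0 ler10.
Qed.

Lemma NL_inv d : d \in N -> XL d ->
  (root i0 d^-1%g = alpha i0 /\ root j0 d^-1%g = alpha j0) \/
  (root i0 d^-1%g = alpha j0 /\ root j0 d^-1%g = alpha i0).
Proof.
move=> dN dX; have [dW _] := NWP dN.
case: (NL_dich H ij dN dX) => -[ei ej]; [left | right];
  have := root_rootV H i0 dW; have := root_rootV H j0 dW;
  by rewrite ei ej !mul_delta_mx_mx.
Qed.

Lemma isW0J w d : isW0 w -> d \in N -> XL d -> (w ^ d = w)%g.
Proof.
move=> w0 dN dX; have [wL wi wj] := w0; have [dW dJ] := NWP dN.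
apply: isW0_uniq => //; have key k l : root k d^-1%g = alpha l -> inPlane (root l w) ->
    nng (- root l w) -> nng (- root k (w ^ d)%g).
  move=> e lE ln; rewrite conjgE !(rhoM H) ?groupM ?groupV ?(sW wL) // row_mul e.
  by rewrite mulmxA mul_delta_mx_mx -mulNmx; apply: (nng_comb ij) => //; apply: inPlaneN.
have Ei := root_inPlanei H wL; have Ej := root_inPlanej H wL.
split; first by rewrite dJ.
  by case: (NL_inv dN dX) => -[ei ej]; [apply: key ei _ _ | apply: key ei _ _].
by case: (NL_inv dN dX) => -[ei ej]; [apply: key ej _ _ | apply: key ej _ _].
Qed.

(* Left multiplication by [x_L]. *)
Definition BL : 'M[algC]_(gN gT) :=
  \sum_(u : gT) (gvec u)^T *m (\sum_(d in XS) gvec (d^-1 * u)%g).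

Lemma gvec_BL u : gvec u *m BL = \sum_(d in XS) gvec (d^-1 * u)%g.
Proof. exact: (gvec_sum predT). Qed.

Lemma BL_rmul h : BL *m rmul h = rmul h *m BL.
Proof.
apply: gvec_ext => u; rewrite !mulmxA gvec_rmul !gvec_BL mulmx_suml.
by apply: eq_bigr => d _; rewrite gvec_rmul mulgA.
Qed.

(** A condition seen only by the [W_L]-part of [w = u * d] factors out [x_L] on the left; this gives
    [x_K = x_L x_K^L] for the subsets [K] of [L], where [x_K^L] is formed in [W_L]. *)
Lemma sum_BL (p q : pred gT) :
    (forall u d, u \in WL -> d \in XS -> p (u * d)%g = q u) ->
  \sum_(w in W | p w) gvec w^-1%g = \sum_(u in WL) (q u)%:R *: (gvec u^-1%g *m BL).
Proof.
move=> pq; rewrite big_mkcondr /= (sum_W_decomp H ij); apply: eq_bigr => u uL.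
rewrite (eq_bigr (fun d => (q u)%:R *: gvec (d^-1 * u^-1)%g)) => [|d dX].
  by rewrite -scaler_sumr gvec_BL.
by rewrite pq // invMg; case: (q u); rewrite ?scale1r ?scale0r.
Qed.

Lemma xJ_BL0 : xJ S set0 = \sum_(u in WL) (gvec u^-1%g *m BL).
Proof.
have -> : xJ S set0 = \sum_(w in W | predT w) gvec w^-1%g.
  by apply: eq_big => // w; rewrite (Xset_0) andbT.
rewrite (@sum_BL predT predT) //; by apply: eq_bigr => u _; rewrite scale1r.
Qed.

Lemma xJ_BL1 k : (k = i0 \/ k = j0) ->
  xJ S [set sv k] = \sum_(u in WL) (nng (root k u))%:R *: (gvec u^-1%g *m BL).
Proof.
move=> hk; have -> : xJ S [set sv k] = \sum_(w in W | nng (root k w)) gvec w^-1%g.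
  by apply: eq_bigl => w; rewrite (Xset_1 H).
apply: sum_BL => u d uL; rewrite (Xset_L H) => /andP[dW dX].
apply: (nng_root_mul H ij) => //.
by case: hk => ->; [apply: (root_inPlanei H) | apply: (root_inPlanej H)].
Qed.

Lemma sum_delta (V : lmodType algC) (F : gT -> V) a : a \in WL ->
  \sum_(u in WL) (u == a)%:R *: F u = F a.
Proof.
move=> aL; rewrite (bigD1 a) //= eqxx scale1r big1 ?addr0 // => u /andP[_ /negPf->].
exact: scale0r.
Qed.

Lemma xJ_BLL : xJ S L = \sum_(u in WL) (u == 1%g)%:R *: (gvec u^-1%g *m BL).
Proof.
rewrite sum_delta ?group1 // gvec_BL; apply: eq_bigr => d _.
by rewrite invg1 mulg1.
Qed.

Section WithLongest.
Variable w0 : gT.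
Hypothesis w0P : isW0 w0.

(* The product [e_L^L u] in the group algebra of [W_L]. *)
Definition eErow (u : gT) : 'rV[algC]_(gN gT) :=
  2^-1 *: gvec u + 2^-1 *: gvec (w0 * u)%g - #|WL|%:R^-1 *: \sum_(v in WL) gvec v.

Definition Emx : 'M[algC]_(gN gT) := \sum_(u in WL) (gvec u)^T *m eErow u.

Lemma gvec_Emx u : gvec u *m Emx = if u \in WL then eErow u else 0.
Proof. exact: gvec_sum. Qed.

Let w0L : w0 \in WL. Proof. by case: w0P. Qed.

Lemma w0V : (w0^-1 = w0)%g.
Proof. by apply/eqP; rewrite eq_invg_mul isW0K. Qed.

(** Coefficients are compared at each [u] by the signs of its two roots: both are positive only at
    1, both negative only at [w0], and for mixed signs the halves cancel. *)
Lemma eL_Emx : mKL S L L *: eL S L = gvec 1%g *m Emx *m BL.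
Proof.
rewrite (eL_formula H ij) xJ_BL0 !xJ_BL1 ?xJ_BLL; try by [left | right].
rewrite gvec_Emx group1 /eErow mulg1 mulmxBl mulmxDl -!scalemxAl mulmx_suml.
have -> : \sum_(v in WL) gvec v *m BL = \sum_(u in WL) (gvec u^-1%g *m BL).
  by rewrite (reindex_inj invg_inj) /=; apply: eq_bigl => u; rewrite groupV.
have -> : gvec 1%g *m BL = \sum_(u in WL) (u == 1%g)%:R *: (gvec u^-1%g *m BL).
  by rewrite sum_delta ?group1 // invg1.
have -> : gvec w0 *m BL = \sum_(u in WL) (u == w0)%:R *: (gvec u^-1%g *m BL).
  by rewrite sum_delta // w0V.
rewrite !scaler_sumr -!sumrB -!big_split -sumrB /=; apply: eq_bigr => u uL.
rewrite !scalerA -!scalerBl -!scalerDl -!scalerBl; congr (_ *: _).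
have Ei := root_inPlanei H uL; have Ej := root_inPlanej H uL.
have uW := sW uL.
have u1E : (u == 1%g) = nng (root i0 u) && nng (root j0 u).
  apply/eqP/andP => [->|[pi pj]]; first by rewrite (rho1 H) !row1 !alpha_nng.
  apply: (XL_triv H uW (i0 := i0) (j0 := j0)) => [v|]; first exact: (WL_out H).
  by rewrite /XL pi pj.
have nn k : nng (- root k u) = ~~ nng (root k u).
  case: (root_dich H k uW) => [p|p].
    by rewrite p; apply/negbTE/negP => q; apply: (not_nng_anti H uW p q).
  by rewrite p; apply/esym/negP => q; apply: (not_nng_anti H uW q p).
have u0E : (u == w0) = ~~ nng (root i0 u) && ~~ nng (root j0 u).
  rewrite -!nn; apply/eqP/andP => [->|[ni nj]]; first by case: w0P.
  by apply: isW0_uniq.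
have cL : (#|WL|%:R : algC) != 0 by rewrite pnatr_eq0 -lt0n cardG_gt0.
rewrite u1E u0E; move: (#|WL|%:R) cL => l l0.
by case: (nng (root i0 u)); case: (nng (root j0 u)) => /=; field.
Qed.

Lemma sum_WL_Emx : (\sum_(v in WL) gvec v) *m Emx = 0.
Proof.
rewrite mulmx_suml (eq_bigr eErow) => [|v vL]; last by rewrite gvec_Emx vL.
rewrite /eErow sumrB big_split /= -!scaler_sumr sumr_const.
have -> : \sum_(v in WL) gvec (w0 * v)%g = \sum_(v in WL) gvec v.
  by rewrite [RHS](reindex_inj (mulgI w0)) /=; apply: eq_bigl => v; rewrite groupMl.
rewrite -[_ *+ #|_|]scaler_nat scalerA mulVf ?pnatr_eq0 -?lt0n ?cardG_gt0 //.
rewrite -scalerDl -scalerBl.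
have -> : 2^-1 + 2^-1 - 1 = 0 :> algC by field.
exact: scale0r.
Qed.

Lemma EmxK : Emx *m Emx = Emx.
Proof.
apply: gvec_ext => u; rewrite mulmxA gvec_Emx; case: ifP => uL; last by rewrite mul0mx.
rewrite {1}/eErow mulmxBl mulmxDl -!scalemxAl sum_WL_Emx scaler0 subr0 !gvec_Emx uL groupM //.
have -> : eErow (w0 * u)%g = eErow u.
  by rewrite /eErow mulgA isW0K // mul1g [_ *: _ + _]addrC.
rewrite -scalerDl; have -> : 2^-1 + 2^-1 = 1 :> algC by field.
exact: scale1r.
Qed.

(** Undoes [BL] on [CW_L]: among the translates [d^-1 * u], only the one with [d = 1] stays in
    [W_L]. *)
Definition prWL : 'M[algC]_(gN gT) := \sum_(u in WL) (gvec u)^T *m gvec u.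

Lemma gvec_prWL u : gvec u *m prWL = if u \in WL then gvec u else 0.
Proof. exact: gvec_sum. Qed.

Lemma BL_prWL u : u \in WL -> gvec u *m BL *m prWL = gvec u.
Proof.
move=> uL; rewrite gvec_BL mulmx_suml.
have X1 : 1%g \in XS by apply: (id_Xset H); apply: L_sub.
rewrite (bigD1 1%g) //= invg1 mul1g gvec_prWL uL big1 ?addr0 // => d /andP[].
rewrite (Xset_L H) => /andP[dW dX] d1; rewrite gvec_prWL groupMr // groupV.
case: ifP => // dL; case/eqP: d1.
by apply: (XL_triv H dW _ dX) => v; apply: (WL_out H).
Qed.

Lemma Emx_BL : Emx *m BL *m prWL = Emx.
Proof.
apply: gvec_ext => u; rewrite !mulmxA gvec_Emx; case: ifP => uL; last by rewrite !mul0mx.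
rewrite /eErow !mulmxBl !mulmxDl -!scalemxAl !BL_prWL ?groupM // !mulmx_suml.
by congr (_ - _ *: _); apply: eq_bigr => v vL; apply: BL_prWL.
Qed.

Lemma eLCWL_Emx : (Emx *m BL :=: eLCWL S L)%MS.
Proof.
have nz : mKL S L L != 0 by apply: (mKL_diag H); apply: L_sub.
have eLE h : h \in WL -> eL S L *m rmul h = (mKL S L L)^-1 *: (gvec h *m Emx *m BL).
  move=> hL; have -> : eL S L = (mKL S L L)^-1 *: (gvec 1%g *m Emx *m BL).
    by rewrite -eL_Emx scalerA mulVf // scale1r.
  rewrite -scalemxAl -(mulmxA _ BL) BL_rmul mulmxA; congr (_ *: (_ *m _)).
  rewrite !gvec_Emx group1 hL /eErow mulmxBl mulmxDl -!scalemxAl !gvec_rmul mulg1 mul1g mulmx_suml.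
  congr (_ - _ *: _); rewrite [RHS](reindex_inj (mulIg h)) /=.
  by apply: eq_big => v; rewrite ?groupMr // => _; rewrite gvec_rmul.
apply/eqmxP/andP; split.
  apply: gvec_sub => u; rewrite mulmxA; case: (boolP (u \in WL)) => uL; last first.
    by rewrite gvec_Emx (negPf uL) mul0mx sub0mx.
  apply: submx_trans (_ : (_ <= <<eL S L *m rmul u>>)%MS) _.
    by rewrite genmxE eLE // eqmx_scale ?invr_neq0.
  by rewrite /eLCWL (bigD1 u) //= addsmxSl.
apply/sumsmx_subP => h hL; rewrite genmxE eLE // -mulmxA.
by rewrite scalemx_sub // submxMl.
Qed.

Section Normalizing.
Variables g d : gT.
Hypotheses (dN : d \in N) (dX : XL d) (gd : (g * d^-1)%g \in WL).

(* [x_L d = x_L] turns right multiplication of [x_L u] by [g] into [u |-> d^-1 u g]. *)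
Definition Pg : 'M[algC]_(gN gT) := \sum_(u : gT) (gvec u)^T *m gvec (d^-1 * u * g)%g.

Lemma gvec_Pg u : gvec u *m Pg = gvec (d^-1 * u * g)%g.
Proof. exact: (gvec_sum predT (fun u => gvec (d^-1 * u * g)%g)). Qed.

Lemma Pg_WL u : ((d^-1 * u * g)%g \in WL) = (u \in WL).
Proof.
have [_ dJ] := NWP dN.
have -> : (d^-1 * u * g = (u * (g * d^-1)) ^ d)%g by rewrite conjgE !mulgA mulgKV.
by rewrite dJ groupMr.
Qed.

Lemma Xset_Ld x : (d^-1 * x)%g \in XS = (x \in XS).
Proof.
have [dW _] := NWP dN; rewrite !(Xset_L H) groupMl ?groupV //.
case: (boolP (x \in W)) => //= xW.
rewrite /XL !(rhoM H) ?groupV // !row_mul.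
by case: (NL_inv dN dX) => -[-> ->]; rewrite !mul_delta_mx_mx // andbC.
Qed.

Lemma BL_Pg : BL *m rmul g = Pg *m BL.
Proof.
apply: gvec_ext => u; rewrite !mulmxA gvec_Pg !gvec_BL mulmx_suml.
rewrite (reindex_inj (mulgI d)) /=; apply: eq_big => x.
  by rewrite -Xset_Ld mulKg.
by move=> _; rewrite gvec_rmul invMg !mulgA.
Qed.

Lemma sum_Pg : \sum_(v in WL) gvec (d^-1 * v * g)%g = \sum_(v in WL) gvec v.
Proof.
rewrite [RHS](reindex_inj (mulgI d^-1%g)) [RHS](reindex_inj (mulIg g)) /=.
by apply: eq_big => v; rewrite mulgA // Pg_WL.
Qed.

Lemma Emx_Pg : Emx *m Pg = Pg *m Emx.
Proof.
apply: gvec_ext => u; rewrite !mulmxA gvec_Pg !gvec_Emx Pg_WL.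
case: ifP => uL; last by rewrite mul0mx.
rewrite /eErow mulmxBl mulmxDl -!scalemxAl !gvec_Pg mulmx_suml.
have -> : (w0 * (d^-1 * u * g) = d^-1 * (w0 * u) * g)%g.
  have c : (w0 * d^-1 = d^-1 * w0)%g by rewrite -{1}(isW0J w0P dN dX) conjgE !mulgA mulgK.
  by rewrite !mulgA c.
by congr (_ - _ *: _); rewrite -[RHS]sum_Pg; apply: eq_bigr => v _; rewrite gvec_Pg.
Qed.

(** The diagonal entry of [Emx *m Pg] at [u] is one half for each of [u = d^-1 u g] and
    [u = d^-1 w0 u g], mutually exclusive since [w0 != 1]; the averages contribute the -1. *)
Lemma PhiTE : PhiT S L g =
  2^-1 * #|[set u in WL | ((u * g * u^-1)%g == d) || ((u * g * u^-1)%g == (w0 * d)%g)]|%:R - 1.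
Proof.
rewrite /PhiT (@tr_restr_idem _ _ _ _ BL prWL Emx Pg).
- rewrite /Emx mulmx_suml raddf_sum /=.
  have cL : (#|WL|%:R : algC) != 0 by rewrite pnatr_eq0 -lt0n cardG_gt0.
  rewrite (eq_bigr (fun u => 2^-1 * (((u * g * u^-1)%g == d) || ((u * g * u^-1)%g == (w0 *
      d)%g))%:R - #|WL|%:R^-1)).
    rewrite sumrB sumr_const -[_ *+ #|_|]mulr_natr mulVf // -mulr_sumr; congr (_ * _ - _).
    rewrite -sum1_card natr_sum big_mkcond [RHS]big_mkcond.
    by apply: eq_bigr => u _; rewrite inE; case: (u \in WL) => //=; case: (_ || _).
  move=> u uL; rewrite -mulmxA /eErow mulmxBl mulmxDl -!scalemxAl mulmxBr mulmxDr -!scalemxAr.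
  rewrite linearB linearD !linearZ /= !gvec_Pg !gvec_tr mulmx_suml mulmx_sumr raddf_sum /=.
  rewrite (eq_bigr (fun v => \tr ((gvec u)^T *m gvec (d^-1 * v * g)%g))); last by move=> v _;
      rewrite gvec_Pg.
  rewrite -(raddf_sum (@mxtrace _ _)) -mulmx_sumr sum_Pg mulmx_sumr raddf_sum /=.
  rewrite (bigD1 u) //= gvec_tr eqxx big1 => [|v /andP[_ vu]]; last by rewrite gvec_tr eq_sym
      (negPf vu).
  rewrite addr0 mulr1 -mulrDr; congr (_ * _ - _).
  have e1 : (u == d^-1 * u * g)%g = ((u * g * u^-1)%g == d).
    rewrite -[LHS](inj_eq (mulgI d)) -[RHS](inj_eq (mulIg u)) /= !mulgA mulgV mul1g mulgKV.
    exact: eq_sym.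
  have e2 : (u == d^-1 * (w0 * u) * g)%g = ((u * g * u^-1)%g == (w0 * d)%g).
    rewrite -[LHS](inj_eq (mulgI (w0 * d)%g)) -[RHS](inj_eq (mulIg u)) /= !mulgA mulgKV.
    by rewrite mulgK isW0K // mul1g eq_sym.
  rewrite e1 e2; have : (d == w0 * d)%g = false.
    by apply/negbTE; rewrite -{1}[d]mul1g (inj_eq (mulIg d)) eq_sym isW0_neq1.
  by move=> nd; case: eqP => [->|_]; rewrite ?nd ?addr0 ?add0r.
- exact: EmxK.
- exact: Emx_BL.
- exact: eLCWL_Emx.
- by rewrite -!mulmxA BL_Pg.
- exact: Emx_Pg.
Qed.

End Normalizing.
End WithLongest.
End PhiTrace.

(** * A self-duality of a cyclic group *)

Section CyclicPairing.
Variables (gT : finGroupType) (r : gT).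
Local Notation R := <[r]>%g.

Definition omega : algC := sval (C_prim_root_exists (order_gt0 r)).

Definition lg (x : gT) : nat :=
  if [pick i : 'I_#[r]%g | (r ^+ i)%g == x] is Some i then val i else 0%N.

(** On exponents, [(r^i, r^j) |-> omega^(i j)]; the discrete logarithm [lg] defaults to 0 outside
    [<r>]. *)
Definition pairing (x y : gT) : algC := omega ^+ (lg x * lg y).

Lemma omegaP : (#[r]%g).-primitive_root omega.
Proof. exact: svalP (C_prim_root_exists (order_gt0 r)). Qed.

Lemma lgK x : x \in R -> (r ^+ lg x = x)%g.
Proof.
move=> xR; rewrite /lg; case: pickP => [i /eqP//|h].
have /cyclePmin[i lt e] := xR.
by have := h (Ordinal lt); rewrite /= e eqxx.
Qed.

Lemma omega_exp i j : (r ^+ i = r ^+ j)%g -> omega ^+ i = omega ^+ j.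
Proof.
move/eqP; rewrite eq_expg_mod_order => e; apply/eqP.
by rewrite (eq_prim_root_expr omegaP).
Qed.

Lemma pairingC x y : pairing x y = pairing y x.
Proof. by rewrite /pairing mulnC. Qed.

Lemma pairingMr x y y' : y \in R -> y' \in R ->
  pairing x (y * y')%g = pairing x y * pairing x y'.
Proof.
move=> yR y'R; rewrite /pairing -exprD -mulnDr !(mulnC (lg x)) !exprM.
by congr (_ ^+ _); apply: omega_exp; rewrite expgD !lgK ?groupM.
Qed.

Lemma pairing1r x : pairing x 1%g = 1.
Proof.
have e : omega ^+ lg 1%g = omega ^+ 0 by apply: omega_exp; rewrite lgK ?group1.
by rewrite /pairing mulnC exprM e expr0 expr1n.
Qed.

Lemma pairing_neq0 x y : pairing x y != 0.
Proof.
rewrite expf_neq0 //; apply/negP => /eqP o0; have := prim_expr_order omegaP.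
by rewrite o0 expr0n gtn_eqF ?order_gt0 // => /esym/eqP; rewrite oner_eq0.
Qed.

Lemma pairingVr x y : y \in R -> pairing x y^-1%g = (pairing x y)^-1.
Proof.
move=> yR; apply: (mulfI (pairing_neq0 x y)).
by rewrite -pairingMr ?groupV // mulgV pairing1r divff ?pairing_neq0.
Qed.

Lemma pairingVl x y : x \in R -> pairing x^-1%g y = (pairing x y)^-1.
Proof. by move=> xR; rewrite pairingC pairingVr // pairingC. Qed.

Lemma pairingXr x y k : y \in R -> pairing x (y ^+ k)%g = pairing x y ^+ k.
Proof.
move=> yR; elim: k => [|k IHk]; first by rewrite expg0 pairing1r.
by rewrite expgS pairingMr ?groupX // IHk exprS.
Qed.

Lemma pairingXl x y k : x \in R -> pairing (x ^+ k)%g y = pairing x y ^+ k.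
Proof. by move=> xR; rewrite pairingC pairingXr // pairingC. Qed.

Lemma pairing_gen x : x \in R -> (pairing x r == 1) = (x == 1%g).
Proof.
move=> xR; rewrite /pairing mulnC exprM.
have -> : omega ^+ lg r = omega.
  by rewrite -[RHS]expr1; apply: omega_exp; rewrite lgK ?cycle_id.
by rewrite -(prim_order_dvd omegaP) order_dvdn lgK.
Qed.

Lemma pairing_sum x : x \in R -> \sum_(y in R) pairing x y = (#[r]%g)%:R * (x == 1%g)%:R.
Proof.
move=> xR; have [->|x1] := eqVneq x 1%g.
  rewrite mulr1 -[LHS]/(\sum_(y in R) _) (eq_bigr (fun=> 1)) ?sumr_const //.
  by move=> y _; rewrite pairingC pairing1r.
rewrite mulr0; apply/eqP; have := pairing_gen xR; rewrite (negPf x1) => ne.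
set c := \sum_(y in R) _; have : c * (pairing x r - 1) == 0.
  rewrite mulrBr mulr1 subr_eq0 mulr_suml /c [X in _ == X](reindex_inj (mulIg r)) /=.
  apply/eqP; apply: eq_big => y; first by rewrite groupMr ?cycle_id.
  by move=> yR; rewrite pairingMr ?cycle_id.
by rewrite mulf_eq0 subr_eq0 ne orbF.
Qed.

(* Expand the indicator of [z ^+ k = c] in the characters [pairing x]. *)
Lemma card_power_fiber k c : c \in R ->
  #|[set z in R | (z ^+ k)%g == c]|%:R = \sum_(x in R | (x ^+ k)%g == 1%g) pairing x c.
Proof.
move=> cR; have m0 : (#[r]%g%:R : algC) != 0 by rewrite pnatr_eq0 -lt0n order_gt0.
apply: (mulfI m0).
have -> : #[r]%g%:R * #|[set z in R | (z ^+ k)%g == c]|%:R =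
    \sum_(z in R) \sum_(x in R) pairing x (z ^+ k * c^-1)%g.
  rewrite -sum1_card natr_sum mulr_sumr big_mkcond [RHS]big_mkcond.
  apply: eq_bigr => z _; rewrite inE; case: (boolP (z \in R)) => //= zR.
  rewrite (eq_bigr (fun x => pairing (z ^+ k * c^-1)%g x)); last by move=> x _; apply: pairingC.
  by rewrite pairing_sum ?groupM ?groupX ?groupV // -eq_mulgV1; case: eqP; rewrite ?mulr0.
rewrite exchange_big /= (eq_bigr (fun x => (pairing x c)^-1 * (#[r]%g%:R * ((x ^+ k)%g ==
    1%g)%:R))).
  rewrite (reindex_inj invg_inj) /= mulr_sumr [RHS]big_mkcondr /=.
  apply: eq_big => x; first exact: groupV.
  rewrite groupV => xR; rewrite pairingVl // invrK expgVn invg_eq1.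
  by case: eqP => _; rewrite ?mulr1 ?mulr0 // mulrC.
move=> x xR; rewrite -pairing_sum ?groupX // mulr_sumr; apply: eq_bigr => z zR.
by rewrite pairingMr ?groupX ?groupV // pairingVr // pairingXr // pairingXl // mulrC.
Qed.

End CyclicPairing.

(** * Both traces as sums over nontrivial rotations *)

Section TraceFormulas.
Variables (gT : finGroupType) (n : nat) (sv : 'I_n -> gT) (rho : gT -> 'M[algC]_n).
Hypothesis H : coxeter_rep sv rho.
Variables i0 j0 : 'I_n.
Hypothesis ij : i0 != j0.
Local Notation S := [set sv i | i : 'I_n].
Local Notation W := <<[set sv i | i : 'I_n]>>%g.
Local Notation alpha i := (delta_mx 0 i : 'rV[algC]_n).
Local Notation root i w := (row i (rho w)).
Local Notation L := [set sv i0; sv j0].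
Local Notation WL := <<[set sv i0; sv j0]>>%g.
Local Notation XL := (XL rho i0 j0).
Local Notation s := (sv i0).
Local Notation t := (sv j0).
Local Notation r := (sv i0 * sv j0)%g.
Local Notation R := <[(sv i0 * sv j0)%g]>%g.
Local Notation N := 'N_W(WL)%g.
Local Notation sW := (WLW (i0 := i0) (j0 := j0)).
Local Notation TL := (TL sv i0 j0).
Local Notation dl := (dl sv rho i0 j0).
Local Notation pr := (pairing (sv i0 * sv j0)%g).
Local Notation isW0 := (isW0 sv rho i0 j0).

Lemma pairingJ g x y : g \in N -> x \in R -> y \in R -> pr (x ^ g)%g (y ^ g)%g = pr x y.
Proof.
move=> gN xR yR; case: (dl_conjR H ij gN) => -[_ e]; rewrite !e //.
by rewrite pairingVl // pairingVr // invrK.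
Qed.

(** The reflection [s z] is fixed by [g] when [c * z ^ g = z]. If [g] centralizes [R], all of them
    or none are fixed; if [g] inverts [R], the equation is [z^2 = c]. The term [x = 1] accounts for
    the subtracted 1. *)
Lemma PsiT_sum g : g \in N ->
  PsiT rho S L g = \sum_(x in R | ((x ^ g)%g == x) && (x != 1%g)) pr x (s * s ^ g)%g.
Proof.
move=> gN; rewrite (PsiTE H ij gN); have cR := s_conj H gN; set c := (s * s ^ g)%g in cR *.
have sg : (s ^ g = s * c)%g by rewrite mulgA (svK H) mul1g.
suff -> : #|[set a in TL | (a ^ g)%g == a]|%:R = \sum_(x in R | (x ^ g)%g == x) pr x c.
  rewrite (bigD1 1%g) /=; last by rewrite group1 conj1g eqxx.
  rewrite pairingC pairing1r addrAC subrr add0r.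
  by apply: eq_bigl => x; rewrite andbA.
have -> : #|[set a in TL | (a ^ g)%g == a]| = #|[set z in R | (c * z ^ g == z)%g]|.
  rewrite -(card_imset [set z in R | _] (mulgI s)); apply: eq_card => a.
  apply/idP/imsetP => [|[z]].
    rewrite inE TLE => /andP[aR /eqP ag]; exists (s * a)%g; last by rewrite mulgA (svK H) mul1g.
    rewrite inE aR conjMg ag; apply/eqP.
    have e : (s ^ g * s ^ g = 1)%g by rewrite -conjMg (svK H) conj1g.
    by rewrite /c -(mulgA s) (mulgA (s ^ g)%g) e mul1g.
  rewrite inE => /andP[zR /eqP e] ->.
  by rewrite inE TLE mulgA (svK H) mul1g zR conjMg sg -mulgA e eqxx.
case: (dl_conjR H ij gN) => -[_ Jg].
  have -> : [set z in R | (c * z ^ g == z)%g] = if c == 1%g then R else set0.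
    apply/setP => z; rewrite inE; case: (boolP (z \in R)) => zR /=; last by case: eqP; rewrite
        ?inE // (negPf zR).
    by rewrite Jg // -{2}[z]mul1g (inj_eq (mulIg z)); case: eqP; rewrite ?inE.
  have -> : \sum_(x in R | (x ^ g)%g == x) pr x c = \sum_(x in R) pr c x.
    by apply: eq_big => [x|x _]; [apply: andb_idr => xR; rewrite Jg | apply: pairingC].
  by rewrite pairing_sum //; case: eqP; rewrite ?mulr1 ?mulr0 // cards0.
have -> : [set z in R | (c * z ^ g == z)%g] = [set z in R | (z ^+ 2 == c)%g].
  apply/setP => z; rewrite !inE; case: (boolP (z \in R)) => zR //=.
  by rewrite Jg // expgS expg1 -(inj_eq (mulIg z)) mulgKV eq_sym.
rewrite card_power_fiber //; apply: eq_bigl => x; case: (boolP (x \in R)) => xR //=.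
by rewrite Jg // expgS expg1 eq_invg_mul.
Qed.

Lemma rflN (b : 'rV[algC]_n) : rfl sv (- b) = rfl sv b.
Proof. by rewrite /rfl [(- b)^T]raddfN /= !mulmxN scalerN mulNmx opprK. Qed.

Lemma root_pm_conj i k e w : w \in W -> e = 1 \/ e = -1 -> root i w = e *: alpha k ->
  (sv i ^ w)%g = sv k.
Proof.
move=> wW he re; apply: (rho_inj H); rewrite ?groupJ ?sv_gen //.
rewrite (rho_svJ H) // re (rho_sv H) (reflE H).
by case: he => ->; rewrite ?scale1r // scaleN1r rflN.
Qed.

Lemma isW0_roots w : isW0 w -> exists k l, (k = i0 /\ l = j0 \/ k = j0 /\ l = i0) /\
  (root i0 w = - alpha k /\ root j0 w = - alpha l).
Proof.
move=> w0; have [wL wi wj] := w0; have [_ wi' wj'] := isW0V H ij w0.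
have := @N_monomial _ _ _ _ H _ _ ij (-1) w _ (WL_N wL).
rewrite mulrNN mulr1 !scaleN1r => /(_ erefl wi wj wi' wj').
by case=> -[e1 e2]; [exists i0, j0 | exists j0, i0]; rewrite -e1 -e2 !opprK; split; auto.
Qed.

(** In the coset [W_L d], the elements [d] and [w0 d] are those sending the simple roots of [L] to
    simple roots with a common sign. The image of [s], with the action on [r], determines that of
    [t]; the value of [dl] then forces the two signs to agree. *)
Lemma good_conj d v w0 : d \in N -> XL d -> v \in WL -> isW0 w0 ->
  ((v * d)%g == d) || ((v * d)%g == (w0 * d)%g) =
  ((s * s ^ (v * d))%g == if dl (v * d)%g == 1 then 1%g else r).
Proof.
move=> dN dX vL w0P; set h := (v * d)%g.
have hN : h \in N by rewrite groupM // (WL_N).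
have [hW hJ] := NWP hN; have [dW dJ] := NWP dN; have vW := sW vL.
have hE : (h == d) || (h == (w0 * d)%g) = (v == 1%g) || (v == w0).
  by rewrite /h -{2}[d]mul1g !(inj_eq (mulIg d)).
have dlh : dl h = \det (Mx rho i0 j0 h) := dlE H ij hN.
have N1F := N1_neq1.
have detMs (a b : algC) :
   root i0 h = a *: alpha j0 -> root j0 h = b *: alpha i0 -> dl h = - (a * b).
  move=> e1 e2; rewrite dlh det_MxE !rootE e1 e2 !mxE !eqxx /=.
  by rewrite [j0 == i0]eq_sym (negPf ij) !mulr0 ?mul0r !mulr1 sub0r.
have detMd (a b : algC) :
   root i0 h = a *: alpha i0 -> root j0 h = b *: alpha j0 -> dl h = a * b.
  move=> e1 e2; rewrite dlh det_MxE !rootE e1 e2 !mxE !eqxx /=.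
  by rewrite [j0 == i0]eq_sym (negPf ij) !mulr0 ?mul0r !mulr1 subr0.
have ss1 : (s * s ^ h == 1)%g = ((s ^ h)%g == s).
  by rewrite -(inj_eq (mulgI s)) mulgA (svK H) mul1g mulg1.
have ssr : (s * s ^ h == r)%g = ((s ^ h)%g == t) by rewrite (inj_eq (mulgI s)).
have sgn (a : algC) : a = 1 \/ a = -1 -> a * a = 1 by case=> ->; rewrite ?mulrNN mulr1.
apply/idP/idP.
  rewrite hE => v1.
  have [k [l [a [hkl ha e1 e2]]]] : exists k l (a : algC),
      [/\ k = i0 /\ l = j0 \/ k = j0 /\ l = i0, a = 1 \/ a = -1,
        root i0 h = a *: alpha k & root j0 h = a *: alpha l].
    have dd := NL_dich H ij dN dX.
    have [k0 [l0 [hkl0 [d1 d2]]]] : exists k l, (k = i0 /\ l = j0 \/ k = j0 /\ l = i0) /\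
        (root i0 d = alpha k /\ root j0 d = alpha l).
      by case: dd => -[d1 d2]; [exists i0, j0 | exists j0, i0]; auto.
    case/orP: v1 => /eqP v1.
      by exists k0, l0, 1; rewrite /h v1 mul1g !scale1r; split; auto.
    have [k1 [l1 [hkl1 [w1 w2]]]] := isW0_roots w0P.
    rewrite /h (rhoM H) // v1 !row_mul w1 w2 !mulNmx !mul_delta_mx_mx.
    case: hkl1 => -[-> ->]; rewrite d1 d2 -!scaleN1r.
      by exists k0, l0, (-1); split; auto.
    by exists l0, k0, (-1); split; auto; case: hkl0 => -[-> ->]; auto.
  have aa := sgn a ha.
  case: hkl => -[ek el]; subst k l.
    by rewrite (detMd _ _ e1 e2) aa eqxx ss1 (root_pm_conj hW ha e1).
  by rewrite (detMs _ _ e1 e2) aa N1F ssr (root_pm_conj hW ha e1).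
rewrite hE => good.
have fin (a : algC) k l : a = 1 \/ a = -1 -> root i0 h = a *: alpha k -> root j0 h = a *: alpha l ->
    (v == 1%g) || (v == w0).
  have Ei := root_inPlanei H vL; have Ej := root_inPlanej H vL.
  case=> -> e1 e2.
    have -> : v = 1%g; last by rewrite eqxx.
    by apply: (XL_uniq H ij vL dW dX); rewrite -/h /XL e1 e2 !scale1r !alpha_nng.
  apply/orP; right; apply/eqP; apply: (isW0_uniq H ij) w0P; split=> //.
    case: (root_dich H i0 vW) => //; rewrite -(nng_root_mul H ij Ei vL dW dX) -/h e1 scaleN1r.
    by move/nngP/(_ k); rewrite !mxE !eqxx oppr_ge0 ler10.
  case: (root_dich H j0 vW) => //; rewrite -(nng_root_mul H ij Ej vL dW dX) -/h e2 scaleN1r.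
  by move/nngP/(_ l); rewrite !mxE !eqxx oppr_ge0 ler10.
have pm i k : (sv i ^ h)%g = sv k -> exists2 a : algC, a = 1 \/ a = -1 & root i h = a *: alpha k.
  move=> /(root_conj_pm H hW)[]->; [exists 1 | exists (-1)]; rewrite ?scale1r ?scaleN1r; auto.
have same (a b : algC) : a = 1 \/ a = -1 -> b = 1 \/ b = -1 -> a * b = 1 -> b = a.
  by case=> -> [] -> //; rewrite ?mulr1 ?mul1r => /eqP; rewrite N1F.
have th : (t ^ h = s ^ h * r ^ h)%g by rewrite -conjMg (sr H).
move: good; case: (dl_conjR H ij hN) => -[dE Jh]; rewrite dE ?eqxx ?N1F.
  rewrite ss1 => /eqP sh; move: th; rewrite sh (Jh _ (cycle_id r)) (sr H) => th.
  have [a ha e1] := pm _ _ sh; have [b hb e2] := pm _ _ th.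
  move: (detMd _ _ e1 e2); rewrite dE => /esym/(same _ _ ha hb) ba; rewrite ba in e2.
  exact: fin ha e1 e2.
rewrite ssr => /eqP sh; move: th; rewrite sh (Jh _ (cycle_id r)) invMg !(svV H).
rewrite mulgA (svK H) mul1g => th.
have [a ha e1] := pm _ _ sh; have [b hb e2] := pm _ _ th.
move: (detMs _ _ e1 e2); rewrite dE => /oppr_inj/esym/(same _ _ ha hb) ba; rewrite ba in e2.
exact: fin ha e1 e2.
Qed.

Lemma sum_WL (V : nmodType) (F : gT -> V) :
  \sum_(u in WL) F u = \sum_(x in R) F x + \sum_(x in R) F (s * x)%g.
Proof.
rewrite (bigID (mem R)) /=; congr (_ + _).
  by apply: eq_bigl => u; apply: andb_idl => /R_WL.
rewrite (reindex_inj (mulgI s)) /=; apply: eq_bigl => x.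
apply/andP/idP => [[sxL sxR]|xR]; last by rewrite sR_WL // (sR_notin H).
by case: (WL_cases H sxL) => [h|]; [rewrite h in sxR | rewrite mulgA (svK H) mul1g].
Qed.

Lemma s_conj_R x : x \in R -> (s ^ x = s * x ^+ 2)%g.
Proof. by move=> xR; rewrite conjgE mulgA (mulRs H (groupVr xR)) invgK -mulgA. Qed.

(** If [g] centralizes [R] this is again [s * s ^ g]; if [g] inverts [R] it acquires the factor
    [x^-4], the origin of the fourth powers below. *)
Lemma s_conj_conj g x : g \in N -> x \in R ->
  (s * s ^ (x * g * x^-1) = s * s ^ g * (x ^+ 2) ^ g * x ^- 2)%g.
Proof.
move=> gN xR; have cR := s_conj H gN; set c := (s * s ^ g)%g in cR *.
have sg : (s ^ g = s * c)%g by rewrite mulgA (svK H) mul1g.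
have yR : ((x ^+ 2) ^ g)%g \in R by rewrite (R_normJ H ij) // groupX.
have xVR : x^-1%g \in R by rewrite groupV.
have RJ a b : a \in R -> b \in R -> (a ^ b = a)%g by move=> aR bR; rewrite conjgE (RC aR bR) mulKg.
have e : (s ^ (x * g * x^-1) = ((s ^ x) ^ g) ^ x^-1)%g by rewrite !conjgM.
rewrite e (s_conj_R xR) (conjMg s) sg (conjMg (s * c)%g) (conjMg s c).
rewrite (s_conj_R xVR) (RJ _ _ cR xVR) (RJ _ _ yR xVR) expgVn.
have x2R : (x ^- 2)%g \in R by rewrite groupV groupX.
clear e; clearbody c; move: ((x ^+ 2) ^ g)%g (x ^- 2)%g yR x2R => y z yR x2R.
rewrite !mulgA (svK H) mul1g.
by rewrite (RC x2R cR) -!mulgA (RC x2R yR).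
Qed.

Lemma s_conj_s g C : g \in N -> (s * s ^ g)%g = C -> (s * s ^ (s * g * s^-1) = C^-1)%g.
Proof.
move=> gN e; have cR := s_conj H gN; rewrite e in cR.
have sg : (s ^ g = s * C)%g by rewrite -e mulgA (svK H) mul1g.
rewrite !conjgM (conjgE s s) (svV H) (svK H) mulg1 sg conjMg (conjgE s s) (svV H) (svK H) mulg1.
by rewrite mulgA (svK H) mul1g (RJs H cR).
Qed.

(** With [q = pr x r] a fourth root of unity, [(q + q^-1) / 2] is 1 at [x = 1], -1 when [x] has
    order two, and 0 when it has order four. *)
Lemma pairing4 x c : x \in R -> c \in R ->
  ((x ^+ 4)%g == 1%g)%:R * (2^-1 * (pr x (c * r^-1)%g + pr x (c * r)%g)) =
  (x == 1%g)%:R - ((x ^+ 2 == 1)%g && (x != 1%g))%:R * pr x c.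
Proof.
move=> xR cR; have rR := cycle_id r.
rewrite (pairingMr x cR (groupVr rR)) (pairingMr x cR rR) (pairingVr x rR) -mulrDr; set q := pr x r.
have q0 : q != 0 by apply: pairing_neq0.
have qk k : (q ^+ k == 1) = ((x ^+ k)%g == 1%g).
  by rewrite -(pairing_gen (groupX k xR)) pairingXl.
have [x1|x1] := eqVneq x 1%g.
  have -> : q = 1 by apply/eqP; rewrite (pairing_gen xR) x1.
  rewrite x1 !expg1n eqxx /= pairingC pairing1r invr1 !mul1r mul0r subr0.
  by field.
rewrite andbT; have [x2|x2] := eqVneq (x ^+ 2)%g 1%g.
  have -> : (x ^+ 4 = 1)%g by rewrite (expgM x 2 2) x2 expg1n.
  have : q ^+ 2 == 1 by rewrite qk x2.
  rewrite sqrf_eq1 => /orP[]/eqP qE.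
    by have := qk 1%N; rewrite expr1 expg1 qE eqxx (negPf x1).
  by rewrite qE eqxx invrN1 /= mulr0n mulr1n; field.
rewrite !mul0r subr0; have [x4|x4] := eqVneq (x ^+ 4)%g 1%g; last by rewrite mul0r.
have q4 : (q ^+ 2) ^+ 2 == 1 by rewrite -exprM qk x4.
move: q4; rewrite sqrf_eq1 qk (negPf x2) /= => /eqP q2.
have -> : q^-1 = - q by apply: (mulfI q0); rewrite divff // mulrN -expr2 q2 opprK.
by rewrite addNr !mulr0.
Qed.

(** The count in [PhiTE] splits into rotations and reflections [u]; the latter replace
    [s * s ^ (x g x^-1)] by its inverse. In the inverting case this produces fourth roots of both
    [c r^-1] and [c r], and [pairing4] reduces their average. *)
Lemma PhiT_sum g : g \in N ->
  PhiT S L g = \sum_(x in R | ((x ^ g)%g == x) && (x != 1%g)) dl g * pr x (s * s ^ g)%g.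
Proof.
move=> gN; have [w0 w0P] := isW0_ex H i0 j0.
have [u' [d [u'L dN dX gE]]] := N_decomp H gN.
have gd : (g * d^-1)%g \in WL by rewrite gE mulgK.
rewrite (PhiTE H ij w0P dN dX gd); have cR := s_conj H gN.
set c := (s * s ^ g)%g in cR *.
have dlu u : u \in WL -> dl (u * g * u^-1)%g = dl g.
  move=> uL; have uN := WL_N uL; have uVN : u^-1%g \in N by rewrite groupV.
  rewrite !(dlM H ij) ?groupM // mulrAC -(dlM H ij) // mulgV.
  by rewrite (dl_WL H ij) ?group1 // (rho1 H) det1 mul1r.
have cond u : u \in WL -> (((u * g * u^-1)%g == d) || ((u * g * u^-1)%g == (w0 * d)%g)) =
    ((s * s ^ (u * g * u^-1))%g == if dl g == 1 then 1%g else r).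
  move=> uL; have [dW dJ] := NWP dN.
  (* As [d] normalizes [W_L], the conjugate [u g u^-1] stays in the coset [W_L d]; [v] is its
     [W_L]-part. *)
  pose v := (u * u' * (u^-1) ^ d^-1)%g.
  have vL : v \in WL.
    have [_ dVJ] := NWP (groupVr dN).
    by apply: groupM; [apply: groupM | rewrite dVJ groupV].
  have e : (u * g * u^-1 = v * d)%g by rewrite gE /v conjgE invgK !mulgA mulgKV.
  by rewrite e (good_conj dN dX vL w0P) -e dlu.
have -> : #|[set u in WL | ((u * g * u^-1)%g == d) || ((u * g * u^-1)%g == (w0 * d)%g)]|%:R =
    \sum_(u in WL) ((s * s ^ (u * g * u^-1))%g == if dl g == 1 then 1%g else r)%:R :> algC.
  rewrite -sum1_card natr_sum big_mkcond [RHS]big_mkcond; apply: eq_bigr => u _.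
  by rewrite inE; case: (boolP (u \in WL)) => //= uL; rewrite cond //; case: eqP.
rewrite sum_WL.
have xgN x : x \in R -> (x * g * x^-1)%g \in N.
  by move=> xR; have xN := WL_N (R_WL xR); rewrite !groupM ?groupV.
have sx x : x \in R -> (s * s ^ (s * x * g * (s * x)^-1) = (s * s ^ (x * g * x^-1))^-1)%g.
  move=> xR; have -> : (s * x * g * (s * x)^-1 = s * (x * g * x^-1) * s^-1)%g by rewrite invMg
      !mulgA.
  by apply: s_conj_s => //; apply: xgN.
case: (dl_conjR H ij gN) => -[dE Jg]; rewrite dE ?eqxx ?N1_neq1.
  have e1 x : x \in R -> (s * s ^ (x * g * x^-1) = c)%g.
    by move=> xR; rewrite s_conj_conj // Jg ?groupX // -mulgA mulgV mulg1.
  have -> : \sum_(x in R) ((s * s ^ (x * g * x^-1))%g == 1%g)%:R = \sum_(x in R) (c == 1%g)%:R :>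
      algC.
    by apply: eq_bigr => x xR; rewrite e1.
  have -> : \sum_(x in R) ((s * s ^ (s * x * g * (s * x)^-1))%g == 1%g)%:R = \sum_(x in R) (c ==
      1%g)%:R :> algC.
    by apply: eq_bigr => x xR; rewrite sx // e1 // invg_eq1.
  have -> : \sum_(x in R | ((x ^ g)%g == x) && (x != 1%g)) 1 * pr x c = \sum_(x in R) pr c x - 1.
    rewrite [\sum_(x in R) pr c x](bigD1 1%g) ?group1 //= pairing1r addrAC subrr add0r.
    apply: eq_big => [x|x _]; last by rewrite mul1r pairingC.
    by case: (boolP (x \in R)) => //= xR; rewrite Jg // eqxx.
  rewrite pairing_sum // sumr_const -mulr_natl; congr (_ - _).
  by rewrite -[#|R|]/(#[r]%g); field.
have e1 x : x \in R -> (s * s ^ (x * g * x^-1) = c * x ^- 4)%g.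
  move=> xR; rewrite s_conj_conj // Jg ?groupX // -mulgA; congr (_ * _)%g.
  by rewrite -invMg -expgD.
have ->: \sum_(x in R) ((s * s ^ (x * g * x^-1))%g == r)%:R = #|[set x in R | (x ^+ 4)%g == (c *
    r^-1)%g]|%:R :> algC.
  rewrite -sum1_card natr_sum big_mkcond [RHS]big_mkcond; apply: eq_bigr => x _.
  rewrite inE; case: (boolP (x \in R)) => //= xR; rewrite e1 //.
  have -> : (c * x ^- 4 == r)%g = ((x ^+ 4)%g == (c * r^-1)%g).
    rewrite -(inj_eq (mulIg (x ^+ 4)%g)) mulgKV (RC (cycle_id r) (groupX 4 xR)).
    by rewrite -[RHS](inj_eq (mulIg r)) mulgKV eq_sym.
  by case: eqP.
have ->: \sum_(x in R) ((s * s ^ (s * x * g * (s * x)^-1))%g == r)%:R = #|[set x in R | (x ^+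
    4)%g == (c * r)%g]|%:R :> algC.
  rewrite -sum1_card natr_sum big_mkcond [RHS]big_mkcond; apply: eq_bigr => x _.
  rewrite inE; case: (boolP (x \in R)) => //= xR; rewrite sx // e1 //.
  have -> : ((c * x ^- 4)^-1 == r)%g = ((x ^+ 4)%g == (c * r)%g).
    rewrite invMg invgK -(inj_eq (mulIg c)) mulgKV (RC (cycle_id r) cR).
    by [].
  by case: eqP.
rewrite (card_power_fiber 4 (groupM cR (groupVr (cycle_id r)))).
rewrite (card_power_fiber 4 (groupM cR (cycle_id r))) -big_split /= mulr_sumr big_mkcondr /=.
rewrite (eq_bigr (fun x => (x == 1%g)%:R - ((x ^+ 2 == 1)%g && (x != 1%g))%:R * pr x c)); last
    first.
  by move=> x xR; rewrite -pairing4 //; case: eqP; rewrite ?mul1r ?mul0r.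
rewrite sumrB (bigD1 1%g) ?group1 //= eqxx [X in 1 + X]big1 => [|x /andP[_ /negPf->]] //.
rewrite addr0 addrAC subrr add0r -sumrN [RHS]big_mkcondr /=; apply: eq_bigr => x xR.
rewrite Jg // eq_invg_mul -expg2; case: (_ && _); rewrite ?mul1r ?mul0r ?oppr0 //.
by rewrite mulN1r.
Qed.

End TraceFormulas.

(** * Induced linear characters *)

Section LinearCharacters.
Variables (gT : finGroupType) (K : {group gT}).

(** Total in [f], with default 0, because the theorem asks for a class function at every set [C],
    cuspidal class or not. *)
Definition lin_of (f : gT -> algC) : 'CF(K) :=
  if [pick i : Iirr K | [forall g in K, 'chi_i g == f g]] is Some i then 'chi_i else 0.

Lemma lin_ofP (f : gT -> algC) :
    f 1%g = 1 -> {in K &, forall x y, f (x * y)%g = f x * f y} ->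
  lin_of f \is a linear_char /\ {in K, lin_of f =1 f}.
Proof.
move=> f1 fM; have rP : mx_repr K (fun g => (f g)%:M : 'M[algC]_1).
  by split=> [|x y xK yK]; rewrite ?f1 // fM // scalar_mxM.
pose rG := MxRepresentation rP.
have rE g : g \in K -> cfRepr rG g = f g.
  by move=> gK; rewrite cfunE gK mulr1n /= mxtrace_scalar.
have : cfRepr rG \is a linear_char.
  by rewrite qualifE /= cfRepr_char rE ?group1 // f1 eqxx.
move/lin_char_irr/irrP=> [i ei].
rewrite /lin_of; case: pickP => [j /forall_inP h|/(_ i)/negP[]]; last first.
  by apply/forall_inP => g gK; rewrite -ei rE.
split=> [|g gK]; last exact/eqP/h.
by rewrite qualifE /= irr_char (eqP (h _ (group1 _))) f1 eqxx.
Qed.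

End LinearCharacters.

Lemma sum_conj_orbit (gT : finGroupType) (K : {group gT}) (x : gT) (V : nmodType) (F : gT -> V) :
  \sum_(y in K) F (x ^ y^-1)%g = (\sum_(z in x ^: K) F z) *+ #|'C_K[x]|.
Proof.
rewrite (partition_big (fun y => (x ^ y^-1)%g) (mem (x ^: K))) /=; last first.
  by move=> y yK; apply: memJ_class; rewrite groupV.
rewrite -sumrMnl; apply: eq_bigr => _ /imsetP[z zK ->].
rewrite (eq_bigr (fun=> F (x ^ z)%g)) => [|y /andP[_ /eqP->]] //.
rewrite sumr_const; congr (_ *+ _).
rewrite -(card_imset 'C_K[x] (mulgI z^-1%g)); apply: eq_card => y.
apply/andP/imsetP => [[yK /eqP e]|[w /setIP[wK /cent1P wx] ->]].
  exists (z * y)%g; last by rewrite mulKg.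
  apply/setIP; split; first by rewrite groupM.
  by apply/cent1P; rewrite /commute (conjgC x) conjgM -e conjgKV.
rewrite groupM ?groupV //; split=> //; rewrite invMg invgK conjgM.
have -> : (x ^ w^-1 = x)%g by rewrite conjgE invgK mulgA wx mulgK.
by [].
Qed.

(** * Inducing from the centralizers of rotations *)

Section InducedSum.
Variables (gT : finGroupType) (n : nat) (sv : 'I_n -> gT) (rho : gT -> 'M[algC]_n).
Hypothesis H : coxeter_rep sv rho.
Variables i0 j0 : 'I_n.
Hypothesis ij : i0 != j0.
Local Notation W := <<[set sv i | i : 'I_n]>>%g.
Local Notation G := (Gram sv).
Local Notation L := [set sv i0; sv j0].
Local Notation WL := <<[set sv i0; sv j0]>>%g.
Local Notation s := (sv i0).
Local Notation R := <[(sv i0 * sv j0)%g]>%g.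
Local Notation N := 'N_W(WL)%g.
Local Notation dl := (dl sv rho i0 j0).
Local Notation pr := (pairing (sv i0 * sv j0)%g).
Local Notation cusp := (cusp_classes sv rho [set sv i0; sv j0]).

Lemma cusp_mem C x : C \in cusp -> x \in C -> [/\ x \in R, x != 1%g & C = x ^: WL].
Proof.
rewrite inE => /andP[CW /forall_inP h] xC; have [y yL e] := imsetP CW.
have xL : x \in WL.
  by move: xC; rewrite e => /imsetP[u uL ->]; rewrite groupJ.
have := h x xC; rewrite (cuspidalE H ij) // => /andP[xR x1]; split=> //.
by move: xC; rewrite e => /class_eqP.
Qed.

Lemma class_cusp x : x \in R -> x != 1%g -> x ^: WL \in cusp.
Proof.
move=> xR x1; rewrite inE mem_classes ?R_WL //; apply/forall_inP => _ /imsetP[u uL ->].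
have xuL : (x ^ u)%g \in WL by apply: groupJ => //; apply: R_WL.
have uN := WL_N uL; rewrite (cuspidalE H ij xuL) (R_normJ H ij _ uN) xR /=.
by rewrite conjg_eq1.
Qed.

(** The normalizer moves a rotation at most to its inverse, which conjugation by [s] already
    does. *)
Lemma class_N x : x \in R -> x ^: N = x ^: WL.
Proof.
move=> xR; apply/setP => y; apply/idP/idP => /imsetP[g gN ->]; last first.
  by apply: memJ_class; apply: WL_N.
case: (dl_conjR H ij gN) => -[_ ->] //; first exact: class_refl.
by rewrite -(RJs H xR); apply: memJ_class; apply: svi_WL.
Qed.

Definition psif (x g : gT) : algC := pr x (s * s ^ g)%g.
Definition phif (x g : gT) : algC := psif x g * (epsilon rho g * alphaL rho L g).

Lemma psif1 x : psif x 1%g = 1.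
Proof. by rewrite /psif conjg1 (svK H) pairing1r. Qed.

Lemma dl1 : dl 1%g = 1.
Proof. by rewrite (dl_WL H ij) ?group1 // (rho1 H) det1. Qed.

(** The map [g |-> s * s ^ g] is a cocycle, as [e] says; the twist by [h] disappears in the pairing
    because [h] fixes [x]. *)
Lemma psifM x g h : x \in R -> g \in N -> h \in N -> (x ^ h = x)%g ->
  psif x (g * h)%g = psif x g * psif x h.
Proof.
move=> xR gN hN xh; have cg := s_conj H gN; have ch := s_conj H hN.
have e : (s * s ^ (g * h) = (s * s ^ h) * (s * s ^ g) ^ h)%g.
  have hh : (s ^ h * s ^ h = 1)%g by rewrite -(conjMg s) (svK H) conj1g.
  rewrite conjgM (conjMg s) -(mulgA s (s ^ h)%g) (mulgA (s ^ h)%g (s ^ h)%g) hh.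
  by rewrite mul1g.
rewrite /psif e pairingMr //; last by rewrite (R_normJ H ij).
by rewrite -{2}xh (pairingJ H ij) // mulrC.
Qed.

(** Conjugating [g] by [y] changes the cocycle, up to transport by [y], by the coboundary
    [z^-1 * z ^ g], on which the pairing with [x'] is trivial since [g] fixes [x']. *)
Lemma psifJ x g y : x \in R -> g \in N -> y \in N -> ((x ^ y^-1) ^ g = x ^ y^-1)%g ->
  psif x (g ^ y)%g = psif (x ^ y^-1)%g g.
Proof.
move=> xR gN yN; set x' := (x ^ y^-1)%g => x'g; have yVN : y^-1%g \in N by rewrite groupV.
have x'R : x' \in R by rewrite (R_normJ H ij).
have cR := s_conj H gN; have zR := s_conj H yVN.
set c := (s * s ^ g)%g in cR *; set z := (s * s ^ y^-1)%g in zR *.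
have sg : (s ^ g = s * c)%g by rewrite mulgA (svK H) mul1g.
have sz : (s ^ y^-1 = s * z)%g by rewrite mulgA (svK H) mul1g.
have zgR : (z ^ g)%g \in R by rewrite (R_normJ H ij).
have e : (s * s ^ (g ^ y) = (z^-1 * c * z ^ g) ^ y)%g.
  have -> : (s ^ (g ^ y) = ((s ^ y^-1) ^ g) ^ y)%g by rewrite [(g ^ y)%g]conjgE !conjgM.
  rewrite -{1}[s](conjgKV y) -(conjMg (s ^ y^-1)%g) sz (conjMg s z) sg; congr (_ ^ _)%g.
  have szs : (s * z * s = z^-1)%g by rewrite -(mulgA s) (mulRs H zR) mulgA (svK H) mul1g.
  clearbody c z; move: (z ^ g)%g => y'; by rewrite !mulgA szs.
have wR : (z^-1 * c * z ^ g)%g \in R.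
  by apply: groupM => //; apply: groupM => //; rewrite groupV.
have xE : x = (x' ^ y)%g by rewrite conjgKV.
have pz : pr x' (z ^ g)%g = pr x' z by rewrite -(pairingJ H ij gN x'R zR) x'g.
have zVR : z^-1%g \in R by rewrite groupV.
have pE : pr x (s * s ^ (g ^ y))%g = pr x' (z^-1 * c * z ^ g)%g.
  by rewrite e [in LHS]xE (pairingJ H ij).
rewrite /psif pE (pairingMr _ (groupM zVR cR) zgR) (pairingMr _ zVR cR) (pairingVr _ zR) pz.
by rewrite mulrAC mulVf ?mul1r // pairing_neq0.
Qed.

Lemma phif_dl x g : phif x g = psif x g * dl g. Proof. by []. Qed.

Lemma dlJ g y : g \in N -> y \in N -> dl (g ^ y)%g = dl g.
Proof.
move=> gN yN; have yVN : y^-1%g \in N by rewrite groupV.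
rewrite conjgE !(dlM H ij) ?groupM // mulrCA -(dlM H ij) // mulVg dl1.
exact: mulr1.
Qed.

(** [g ^ y] centralizes [x] exactly when [g] fixes [x ^ y^-1]. Grouping the induction sum by this
    conjugate, each occurs [#|'C_W[x]|] times, which cancels the denominator. *)
Lemma Ind_orbit (F : gT -> gT -> algC) x (xi : 'CF('C_W[x])) g :
    x \in R -> x != 1%g -> g \in N ->
    (forall h, h \in 'C_W[x]%g -> xi h = F x h) ->
    (forall y, y \in N -> ((x ^ y^-1) ^ g = x ^ y^-1)%g -> F x (g ^ y)%g = F (x ^ y^-1)%g g) ->
  'Ind[N] xi g = \sum_(z in x ^: WL | (z ^ g)%g == z) F z g.
Proof.
move=> xR x1 gN xiE FJ; have CN := cent_R_sub H ij xR x1.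
have [gW gJ] := NWP gN.
pose f z := if (z ^ g)%g == z then F z g else 0.
rewrite cfIndE // (eq_bigr (fun y => f (x ^ y^-1)%g)) => [|y yN].
  have -> : \sum_(y in N) f (x ^ y^-1)%g = (\sum_(z in x ^: WL) f z) *+ #|'C_W[x]|.
    rewrite -(class_N xR) -[#|'C_W[x]|](_ : #|'C_N[x]| = _).
      exact: (sum_conj_orbit 'N_W(WL)%G x f).
    apply: eq_card => h; apply/setIP/setIP => [[hN hC]|[hW hC]]; split=> //.
      by case/NWP: hN.
    by apply: (subsetP CN); apply/setIP.
  rewrite -[(\sum_(z in _) _) *+ _]mulr_natl mulKf ?pnatr_eq0 -?lt0n ?cardG_gt0 //.
  by rewrite [RHS]big_mkcondr.
have [yW _] := NWP yN; rewrite /f.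
have eC : ((g ^ y)%g \in 'C_W[x]) = (((x ^ y^-1) ^ g)%g == (x ^ y^-1)%g).
  rewrite inE groupJ //=.
  have e2 : ((x ^ y^-1) ^ g == x ^ y^-1)%g = (x ^ (g ^ y) == x)%g.
    rewrite -(inj_eq (conjg_inj y)) conjgKV; congr (_ == _).
    by rewrite [(g ^ y)%g]conjgE !conjgM.
  rewrite e2; apply/cent1P/eqP => [c|c]; last by rewrite /commute (conjgC x) c.
  by rewrite conjgE -c mulKg.
case: ifP => h; last by rewrite cfun0 // eC h.
by rewrite xiE ?eC // FJ //; apply/eqP.
Qed.

Lemma sum_cusp (F : gT -> algC) (P : pred gT) :
  \sum_(C in cusp) \sum_(z in C | P z) F z = \sum_(x in R | P x && (x != 1%g)) F x.
Proof.
rewrite [RHS](partition_big (fun x => x ^: WL) (mem cusp)) /=; last first.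
  by move=> x /and3P[xR _ x1]; apply: class_cusp.
apply: eq_bigr => C Cc; apply: eq_bigl => x; apply/andP/idP => [[xC Px]|].
  by have [xR x1 ->] := cusp_mem Cc xC; rewrite xR Px x1 eqxx.
by case/andP=> /and3P[xR Px x1] /eqP <-; rewrite class_refl.
Qed.

End InducedSum.

Theorem theorem5p15 (gT : finGroupType) (n : nat) (sv : 'I_n -> gT)
    (rho : gT -> 'M[algC]_n) :
  injective sv ->
  coxeter_system [set sv i | i : 'I_n] ->
  geom_rep sv rho ->
  (3 <= n)%N ->
  forall L : {set gT}, L \subset [set sv i | i : 'I_n] -> #|L| = 2%N ->
  forall rep : {set gT} -> gT,
    (forall C, C \in cusp_classes sv rho L -> rep C \in C) ->
  exists phi psi : forall C : {set gT}, 'CF('C_(<<[set sv i | i : 'I_n]>>%g)[rep C]),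
    [/\ forall C, C \in cusp_classes sv rho L ->
           phi C \is a linear_char /\ psi C \is a linear_char,
        forall g, g \in 'N_(<<[set sv i | i : 'I_n]>>%g)(<<L>>%g) ->
           PhiT [set sv i | i : 'I_n] L g =
           \sum_(C in cusp_classes sv rho L)
              ('Ind['N_(<<[set sv i | i : 'I_n]>>%g)(<<L>>%g)] (phi C)) g,
        forall g, g \in 'N_(<<[set sv i | i : 'I_n]>>%g)(<<L>>%g) ->
           PsiT rho [set sv i | i : 'I_n] L g =
           \sum_(C in cusp_classes sv rho L)
              ('Ind['N_(<<[set sv i | i : 'I_n]>>%g)(<<L>>%g)] (psi C)) g
      & forall C, C \in cusp_classes sv rho L ->
           forall g, g \in 'C_(<<[set sv i | i : 'I_n]>>%g)[rep C] ->
             psi C g = phi C g * epsilon rho g * alphaL rho L g].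
Proof.
move=> sv_inj [S2 _] geom _ L LS cL rep repP.
have H : coxeter_rep sv rho by split=> // i; apply: S2; apply: mem_sv.
have /cards2P[a [b [ab LE]]] : #|L| == 2%N by rewrite cL.
have /imsetP[i0 _ aE] : a \in [set sv i | i : 'I_n].
  by apply: (subsetP LS); rewrite LE !inE eqxx.
have /imsetP[j0 _ bE] : b \in [set sv i | i : 'I_n].
  by apply: (subsetP LS); rewrite LE !inE eqxx orbT.
have ij : i0 != j0 by apply: contra ab => /eqP e; rewrite aE bE e.
rewrite aE bE in LE; subst L.
pose psi C := lin_of ('C_(<<[set sv i | i : 'I_n]>>)[rep C])%G (psif sv i0 j0 (rep C)).
pose phi C := lin_of ('C_(<<[set sv i | i : 'I_n]>>)[rep C])%G (phif sv rho i0 j0 (rep C)).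
have CP C : C \in cusp_classes sv rho [set sv i0; sv j0] ->
    [/\ rep C \in <[sv i0 * sv j0]>%g, rep C != 1%g & C = (rep C) ^: <<[set sv i0; sv j0]>>].
  by move=> CC; apply: (cusp_mem H ij CC (repP C CC)).
have cent C g : C \in cusp_classes sv rho [set sv i0; sv j0] ->
    g \in 'C_(<<[set sv i | i : 'I_n]>>%g)[rep C] ->
    g \in 'N_(<<[set sv i | i : 'I_n]>>)(<<[set sv i0; sv j0]>>) /\ (rep C ^ g = rep C)%g.
  move=> CC gC; have [xR x1 _] := CP C CC; split; first exact: (subsetP (cent_R_sub H ij xR x1)).
  by case/setIP: gC => _ /cent1P c; rewrite conjgE -c mulKg.
have psiP C : C \in cusp_classes sv rho [set sv i0; sv j0] -> psi C \is a linear_char /\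
    {in 'C_(<<[set sv i | i : 'I_n]>>)[rep C], psi C =1 psif sv i0 j0 (rep C)}.
  move=> CC; have [xR x1 _] := CP C CC; apply: lin_ofP; first exact: (psif1 H).
  by move=> g h /(cent C _ CC)[gN _] /(cent C _ CC)[hN xh]; apply: (psifM H ij).
have phiP C : C \in cusp_classes sv rho [set sv i0; sv j0] -> phi C \is a linear_char /\
    {in 'C_(<<[set sv i | i : 'I_n]>>)[rep C], phi C =1 phif sv rho i0 j0 (rep C)}.
  move=> CC; have [xR x1 _] := CP C CC; apply: lin_ofP.
    by rewrite phif_dl (psif1 H) (dl1 H ij) mulr1.
  move=> g h /(cent C _ CC)[gN _] /(cent C _ CC)[hN xh].
  by rewrite !phif_dl (psifM H ij) // (dlM H ij) // mulrACA.
exists phi, psi; split=> [C CC | g gN | g gN | C CC g gC].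
- by have [? _] := phiP C CC; have [? _] := psiP C CC.
- rewrite (PhiT_sum H ij gN) -(sum_cusp H ij (fun x => dl sv rho i0 j0 g * pairing _ x _) (fun x
    => (x ^ g)%g == x)).
  apply: eq_bigr => C CC; have [xR x1 CE] := CP C CC; have [_ phiE] := phiP C CC.
  rewrite (Ind_orbit H ij xR x1 gN phiE) -?CE => [|y yN e].
    by apply: eq_bigr => z _; rewrite phif_dl mulrC.
  by rewrite !phif_dl (dlJ H ij) // (psifJ H ij).
- rewrite (PsiT_sum H ij gN) -(sum_cusp H ij (fun x => pairing _ x _) (fun x => (x ^ g)%g == x)).
  apply: eq_bigr => C CC; have [xR x1 CE] := CP C CC; have [_ psiE] := psiP C CC.
  rewrite (Ind_orbit H ij xR x1 gN psiE) -?CE // => y yN e.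
  by rewrite (psifJ H ij).
have [gN _] := cent C g CC gC; have [_ psiE] := psiP C CC; have [_ phiE] := phiP C CC.
(* [phi] is [psi] times [dl], and [dl] squares to 1. *)
rewrite psiE // phiE // phif_dl -(mulrA _ (epsilon rho g)) -[epsilon _ _ * _]/(dl sv rho i0 j0 g).
by rewrite -mulrA (dl_sqr H ij gN) mulr1.
Qed.
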